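(* Let $n\in\{2,3\}$, let $k$ be a field, $A=k[X_1,\ldots,X_n]$ with its standard grading, $d\ge 1$, and let $f_1,\ldots,f_{n+1}\in A_d$ be homogeneous polynomials of degree $d$, not all zero. Let $I=(f_1,\ldots,f_{n+1})\subseteq A$, $X=\mathrm{Proj}(A/I)\subseteq\mathbb P^{n-1}_k$ and $B=k[T_1,\ldots,T_{n+1}]$. Assume that the rational map $\lambda:\mathbb P^{n-1}_k\dashrightarrow\mathbb P^n_k$, $x\mapsto (f_1(x):\cdots:f_{n+1}(x))$, is generically finite onto its image and that $X$ is supported on a finite (possibly empty) set of points. Assume that $I$ is locally generated by at most $n$ elements (i.e. for every $x\in X$ the ideal $\mathcal I_{X,x}\subseteq\mathcal O_{\mathbb P^{n-1}_k,x}$ can be generated by $n$ elements) and that there is a graded free resolution $$0\to\bigoplus_{i=1}^nA(-\mu_i-d)\xrightarrow{\ M\ }A(-d)^{n+1}\xrightarrow{[f_1\ f_2\ \cdots\ f_{n+1}]}A\to A/I\to0$$ with $M=[p_{i,j}]_{i=1,\ldots,n+1,\ j=1,\ldots,n}$. Put $$L_i:=\sum_{j=1}^{n+1}p_{j,i}T_j\in A[T_1,\ldots,T_{n+1}],\qquad i=1,\ldots,n,$$ which is bihomogeneous of bidegree $(\mu_i;1)$ in $(X;T)$, and let $\mathrm{Res}(L_1,\ldots,L_n)\in B$ be their resultant with respect to the homogeneous variables $X_1,\ldots,X_n$. Then for all integers $\nu\ge\eta$, $$\big(\mathrm{Res}(L_1,\ldots,L_n)\big)=\mathfrak S(\mathrm{Sym}_A(I)_\nu)\subset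 B .$$
   Context: $\mathfrak m=(X_1,\ldots,X_n)$, $I_X:=I:_A\mathfrak m^\infty$, $\eta:=(n-1)(d-1)-\mathrm{indeg}(I_X)$, where $\mathrm{indeg}(N)$ is the smallest degree in which a graded module $N$ is nonzero. $\mathrm{Sym}_A(I)_\nu$ is the $B$-module which is the image of $B\otimes_kA_\nu$ under the canonical surjection $A\otimes_kB=A[T_1,\ldots,T_{n+1}]\to\mathrm{Sym}_A(I)$, $T_i\mapsto f_i\in\mathrm{Sym}^1_A(I)=I$. $\mathfrak S(M)$ denotes the MacRae invariant of a finitely generated $B$-module $M$: if $M$ is torsion it is the principal ideal $\prod_{\mathfrak q}\mathfrak q^{\,\ell_{B_{\mathfrak q}}(M_{\mathfrak q})}$ over height one primes $\mathfrak q$ of $B$; if $M$ is not torsion, $\mathfrak S(M):=0$. $\mathrm{Res}$ is the classical (Macaulay) resultant of $n$ homogeneous forms in the $n$ variables $X_1,\ldots,X_n$, of degrees $\mu_1,\ldots,\mu_n$, with coefficients in $B$. If some $L_i$ has degree $\mu_i=0$ in the variables $X$, the usual convention is $\mathrm{Res}(L_1,\ldots,L_n)=L_i^{\prod_{j\ne i}\mu_j}$ (up to sign). *)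

(* Defs.v *)
From HB Require Import structures.
From mathcomp Require Import all_boot all_order all_algebra.
From mathcomp Require Import mpoly.

Set Implicit Arguments.
Unset Strict Implicit.
Unset Printing Implicit Defensive.

Import GRing.Theory.
Local Open Scope ring_scope.

(* Ideals are Prop-valued predicates, compared pointwise with [same_set]. *)

Section Ideals.
Variable R : comNzRingType.
Implicit Types I J p q : R -> Prop.

Definition same_set I J := forall x, I x <-> J x.

Definition is_ideal I :=
  I 0 /\ forall a x y : R, I x -> I y -> I (a * x + y).

Definition is_prime p :=
  [/\ is_ideal p, ~ p 1 & forall x y : R, p (x * y) -> p x \/ p y].

Definition ideal_gen r (g : 'I_r -> R) : R -> Prop :=
  fun x => exists c : 'I_r -> R, x = \sum_(i < r) c i * g i.

Definition principal (a : R) : R -> Prop := fun x => exists c, x = c * a.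

Definition ideal_one : R -> Prop := fun=> True.

Definition ideal_mul I J : R -> Prop := fun x =>
  exists r (a b : 'I_r -> R),
    (forall i, I (a i) /\ J (b i)) /\ x = \sum_(i < r) a i * b i.

Definition ideal_exp I (e : nat) : R -> Prop := iter e (ideal_mul I) ideal_one.

Definition strict_prime_chain r (c : nat -> R -> Prop) :=
  (forall i, (i <= r)%N -> is_prime (c i)) /\
  (forall i, (i < r)%N ->
     (forall x, c i x -> c i.+1 x) /\ exists x, c i.+1 x /\ ~ c i x).

Definition has_height q (h : nat) :=
  (exists c, strict_prime_chain h c /\ same_set (c h) q) /\
  ~ (exists c, strict_prime_chain h.+1 c /\ same_set (c h.+1) q).

Definition height_one q := is_prime q /\ has_height q 1.

End Ideals.

Section Localization.
Variables (B : comNzRingType) (q : B -> Prop) (M : lmodType B).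

(* Elements of M_q are written as fractions m/s with s not in q; a subset of
   M_q is a predicate N on pairs (m, s) that is compatible with [frac_eq]. *)
Definition frac_eq (m : M) (s : B) (m' : M) (s' : B) :=
  exists u, ~ q u /\ u *: (s' *: m - s *: m') = 0.

Definition loc_submod (N : M -> B -> Prop) :=
  [/\ forall m s, N m s -> ~ q s,
      forall m s m' s', ~ q s' -> frac_eq m s m' s' -> N m s -> N m' s',
      N 0 1,
      forall m s m' s', N m s -> N m' s' -> N (s' *: m + s *: m') (s * s')
    & forall a t m s, ~ q t -> N m s -> N (a *: m) (t * s)].

Definition loc_lt (N N' : M -> B -> Prop) :=
  (forall m s, N m s -> N' m s) /\ exists m s, N' m s /\ ~ N m s.

Definition has_loc_chain (r : nat) :=
  exists N : nat -> M -> B -> Prop,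
    (forall i, (i <= r)%N -> loc_submod (N i)) /\
    (forall i, (i < r)%N -> loc_lt (N i) (N i.+1)).

(* The length of the B_q-module M_q is l. *)
Definition loc_length (l : nat) := has_loc_chain l /\ ~ has_loc_chain l.+1.

End Localization.

Section MacRae.
Variables (B : comNzRingType) (M : lmodType B).

Definition torsion := forall m : M, exists b : B, b != 0 /\ b *: m = 0.

(* The q i are finitely many distinct height one primes containing all those
   at which the length is nonzero. *)
Definition macrae : B -> Prop := fun b =>
  (torsion /\
   exists r (q : 'I_r -> B -> Prop) (l : 'I_r -> nat),
     [/\ forall i, height_one (q i) /\ loc_length (q i) M (l i),
         forall i j, i <> j -> ~ same_set (q i) (q j),
         forall p, height_one p -> (forall i, ~ same_set p (q i)) ->
           loc_length p M 0
       & (\big[@ideal_mul B/@ideal_one B]_(i < r) ideal_exp (q i) (l i)) b])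
  \/ (~ torsion /\ b = 0).

End MacRae.

Section Saturation.
Variables (n : nat) (R : comNzRingType).
Implicit Types I : {mpoly R[n]} -> Prop.

Definition irrelevant : {mpoly R[n]} -> Prop := ideal_gen (fun i : 'I_n => 'X_i).

Definition saturation I : {mpoly R[n]} -> Prop := fun a =>
  exists N : nat, forall x, ideal_exp irrelevant N x -> I (a * x).

Definition is_indeg I (e : nat) :=
  (exists x, [/\ I x, x \is e.-homog & x != 0]) /\
  (forall e' x, I x -> x \is e'.-homog -> x != 0 -> (e <= e')%N).

(* Homogeneity in a possibly negative degree, where only 0 qualifies. *)
Definition homogz (nu : int) (x : {mpoly R[n]}) :=
  forall m, m \in msupp x -> (mdeg m)%:Z = nu.

End Saturation.

Section Projective.
Variables (n : nat) (k : fieldType).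
Local Notation A := {mpoly k[n]}.
Implicit Types (p I : A -> Prop) (f : 'I_n.+1 -> A).

(* The points of the scheme P^(n-1)_k = Proj A. *)
Definition proj_point p :=
  [/\ is_prime p, forall x e, p x -> p (pihomog mdeg e x)
    & exists i : 'I_n, ~ p 'X_i].

Definition finitely_many (P : (A -> Prop) -> Prop) :=
  exists r (c : 'I_r -> A -> Prop), forall p, P p -> exists i, same_set p (c i).

Definition proj_locus I p := proj_point p /\ forall x, I x -> p x.

(* Away from the base locus, the rational map given by f sends a point p of
   Proj A to the inverse image of p under k[T] -> A, T_i |-> f i.  The generic
   point of the closure of the image is the kernel of that map; generically
   finite means that the fibre over it is finite. *)
Definition rational_map_pullback f (G : {mpoly k[n.+1]}) : A :=
  mmap (@mpolyC n k) f G.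

Definition generic_fibre f p :=
  [/\ proj_point p, ~ (forall i, p (f i))
    & forall G, p (rational_map_pullback f G) <-> rational_map_pullback f G = 0].

Definition generically_finite f := finitely_many (generic_fibre f).

(* The fractions a/s in Frac(A) with a in J, s not in p, both homogeneous of
   the same degree.  For J = A this is the local ring of Proj A at p; for a
   homogeneous ideal J it is the stalk at p of the associated ideal sheaf. *)
Definition stalk p (J : A -> Prop) (z : {fraction A}) :=
  exists (e : nat) (a s : A),
    [/\ a \is e.-homog, s \is e.-homog, J a, ~ p s
      & z = FracField.tofrac a / FracField.tofrac s].

Definition local_ring p := stalk p (@ideal_one A).

Definition locally_generated_by I (r : nat) :=
  forall p, proj_locus I p ->
    exists g : 'I_r -> {fraction A},
      (forall i, stalk p I (g i)) /\
      forall z, stalk p I z ->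
        exists c : 'I_r -> {fraction A},
          (forall i, local_ring p (c i)) /\ z = \sum_(i < r) c i * g i.

(* 0 -> \oplus_i A(-mu_i - d) --P--> A(-d)^(n+1) --f--> A is a graded exact
   complex; maps act on column vectors. *)
Definition graded_resolution (d : nat) f (mu : 'I_n -> nat)
    (P : 'M[A]_(n.+1, n)) :=
  [/\ forall i, f i \is d.-homog,
      forall j i, P j i \is (mu i).-homog,
      forall v : 'cV[A]_n, P *m v = 0 -> v = 0
    & forall w : 'cV[A]_n.+1,
        (\row_j f j) *m w = 0 <-> exists v : 'cV[A]_n, w = P *m v].

End Projective.

Section SymmetricAlgebra.
Variables (A : comNzRingType) (I : A -> Prop).

Definition linear_on (S : comAlgType A) (g : A -> S) :=
  forall a x y : A, I x -> I y -> g (a * x + y) = a *: g x + g y.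

(* S, with iota : I -> S, is a symmetric algebra of the A-module I.  Only the
   restriction to I of a map with domain A is relevant. *)
Definition is_symmetric_algebra (S : comAlgType A) (iota : A -> S) :=
  linear_on iota /\
  forall (S' : comAlgType A) (g : A -> S'), linear_on g ->
    exists h : {lrmorphism S -> S'},
      (forall x, I x -> h (iota x) = g x) /\
      (forall h' : {lrmorphism S -> S'},
         (forall x, I x -> h' (iota x) = g x) -> h' =1 h).

End SymmetricAlgebra.

Section SymmetricPiece.
Variables (n : nat) (k : fieldType).
Local Notation A := {mpoly k[n]}.
Local Notation B := {mpoly k[n.+1]}.
(* The ring A \otimes_k B = A[T] is represented as B[X]. *)
Local Notation AB := {mpoly B[n]}.
Variables (f : 'I_n.+1 -> A) (S : comAlgType A) (iota : A -> S).

(* The A-algebra map A \otimes_k B -> S sending T_j to iota (f j). *)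
Definition sym_map (x : AB) : S :=
  mmap (mmap (fun c : k => (c%:MP : A)%:A) (fun j => iota (f j)))
       (fun i => ('X_i : A)%:A) x.

(* The B-module M is identified by j with the image of B \otimes_k A_nu in S, on
   which B acts through B -> A \otimes_k B -> S. *)
Definition is_sym_piece (nu : int) (M : lmodType B) (j : M -> S) :=
  [/\ injective j,
      forall x y, j (x + y) = j x + j y,
      forall (b : B) x, j (b *: x) = sym_map b%:MP * j x
    & forall s, (exists x, j x = s) <-> (exists2 y, homogz nu y & s = sym_map y)].

Definition syzygy_form (P : 'M[A]_(n.+1, n)) (i : 'I_n) : AB :=
  \sum_(j < n.+1) ('X_j : B) *: map_mpoly (@mpolyC n.+1 k) (P j i).

End SymmetricPiece.

Section Resultant.
Variables (n : nat) (mu : 'I_n -> nat).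

(* Indices (i, alpha), |alpha| = mu i, of the coefficients of n generic forms
   of degrees mu i in n variables. *)
Definition coef_index :=
  {x : 'I_n * 'X_{1..n < (\max_i mu i).+1} | mdeg x.2 == mu x.1}.

Definition coef_ring := {mpoly int[#|{: coef_index}|]}.

Definition generic_form (i : 'I_n) : {mpoly coef_ring[n]} :=
  \sum_(x : coef_index | (val x).1 == i)
     ('X_(enum_rank x) : coef_ring) *: 'X_[(val x).2].

Definition specialize (C : comNzRingType) (F : 'I_n -> {mpoly C[n]})
    (r : coef_ring) : C :=
  mmap (intr : int -> C)
       (fun v : 'I_#|{: coef_index}| => let x := val (enum_val v) in (F x.1)@_(x.2)) r.

(* For positive degrees, the resultant over Z of the generic forms is the
   generator of their elimination ideal, the degree 0 part of (P_1,...,P_n) : m^oo,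
   normalized to be 1 at X_1^mu_1, ..., X_n^mu_n. *)
Definition is_generic_resultant (r : coef_ring) :=
  same_set (fun a : coef_ring => saturation (ideal_gen generic_form) a%:MP)
           (principal r) /\
  specialize (fun i => 'X_i ^+ mu i : {mpoly int[n]}) r = 1.

Definition is_resultant (C : comNzRingType) (F : 'I_n -> {mpoly C[n]}) (r : C) :=
  ((forall i, (0 < mu i)%N) ->
     exists2 R, is_generic_resultant R & r = specialize F R) /\
  (forall i, mu i = 0%N -> r = (F i)@_0%MM ^+ (\prod_(j < n | j != i) mu j)%N).

End Resultant.

(* Main.v *)
(* Sym_A(I)_nu is the cokernel of the degree nu part Phi of the Koszul map
   (c_i) |-> \sum c_i L_i, because the L_i generate the kernel of
   A[T] -> Sym_A(I).  For generic coefficients, the generator r of the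
   elimination ideal is prime; r divides every maximal minor of Phi, some power
   of r is a combination of these minors, and a specialization to forms over
   Z[t] exhibits a minor that r divides exactly once.  Let p be a prime of B.
   Modulo p the L_i are not all zero and, for n = 3, have no common factor, so
   that the second Koszul map has the expected rank and one of its minors is a
   unit at p; the complementary minor of Phi then has the valuation of the
   resultant at p, and this valuation is the length of Sym_A(I)_nu at p.
   If the L_i had a common factor modulo p, let x be its generic point and t the
   image of T.  Either f(x) is nonzero, t is proportional to f(x), and the
   transcendence degree over k of the field generated by x and t is too large,
   or f(x) = 0 and the base locus contains a curve.
   The bound nu >= eta yields the inequality \sum mu_i < nu + n needed for the
   ranks.  When some mu_i is 0, L_i is a linear form in T that kills
   Sym_A(I)_nu, and the length at the corresponding prime is a dimension. *)
From HB Require Import structures.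
Require Import Defs.
From mathcomp Require Import all_boot all_order all_algebra.
From mathcomp Require Import mpoly zify ring.
From mathcomp Require boolp classical_sets.

Set Implicit Arguments.
Unset Strict Implicit.
Unset Printing Implicit Defensive.

Import GRing.Theory.
Local Open Scope ring_scope.

(** * Prime ideals and unique factorization *)

(** The delicate primes [p] are those dividing the resultant: there [Phi] can lose rank modulo [p],
    so the valuation of its minors cannot be read off the residue field. [Psi] keeps its expected
    rank, because this needs only the absence of a common factor of the forms modulo [p], not the
    absence of a common zero. The products of complementary minors of [Phi] and [Psi] are therefore
    compared over the ring of generic coefficients, where the resultant is a prime element, and only
    the outcome of the comparison is specialized to [B]. Localizations are never constructed. A
    submodule of a localized module is represented by a saturated submodule of a free module, so
    that lengths become statements about row spans of matrices. As [B] is a unique factorization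
    domain, its height one primes are generated by prime elements, and the equality of ideals
    becomes an equality between valuations and lengths at each of them. *)

Definition ideal_in (W : comNzRingType) (I : W -> Prop) : W -> bool :=
  fun x => boolp.asbool (I x).

Section QuotientRing.
Variables (W : comNzRingType) (I : W -> Prop).
Hypotheses (I_ideal : is_ideal I) (I_proper : ~ I 1).

Lemma idealr_closed_in : idealr_closed (ideal_in I).
Proof.
have [I0 ID] := I_ideal.
split=> [||a x y /boolp.asboolP Ix /boolp.asboolP Iy].
- exact/boolp.asboolP.
- by apply/negP => /boolp.asboolP.
- exact/boolp.asboolP/ID.
Qed.

Lemma quot_ring : exists (Q : comNzRingType) (pi : {rmorphism W -> Q}),
  (forall w, pi w = 0 <-> I w) /\ forall z, exists w, pi w = z.
Proof.
pose cI := isIdealr.Build W (ideal_in I) idealr_closed_in.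
pose J : idealr W := HB.pack (ideal_in I) cI.
pose pi : {rmorphism W -> {ideal_quot J}} := (\pi_{ideal_quot J})%qT.
exists {ideal_quot J}, pi; split => [w|z].
  rewrite -(rmorph0 pi); split.
    by move=> /eqP; rewrite /pi /= -Quotient.idealrBE subr0 => /boolp.asboolP.
  by move=> Iw; apply/eqP; rewrite /pi /= -Quotient.idealrBE subr0; apply/boolp.asboolP.
by exists (repr z); exact: reprK.
Qed.
End QuotientRing.

Lemma quot_domain (W : comNzRingType) (I : W -> Prop) : is_prime I ->
  exists (D : idomainType) (pi : {rmorphism W -> D}),
    (forall w, pi w = 0 <-> I w) /\ forall z, exists w, pi w = z.
Proof.
case=> I_ideal I_proper I_prime.
have [Q [pi [piP pi_surj]]] := quot_ring I_ideal I_proper.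
have Q_domain : GRing.integral_domain_axiom Q.
  move=> x y; have [a <-] := pi_surj x; have [b <-] := pi_surj y.
  rewrite -rmorphM => /piP/I_prime[] /piP ->; by rewrite eqxx ?orbT.
pose unitQ : pred Q := fun x => boolp.asbool (exists y, y * x = 1).
(* The inverse required by the interface must fix every nonunit; it is chosen together with both of
   its properties. *)
have exinv (x : Q) : {y | unitQ x -> y * x = 1 & ~~ unitQ x -> y = x}.
  apply: boolp.cid2; case: (boolP (unitQ x)) => [/boolp.asboolP[y xy]|_].
    by exists y.
  by exists x.
pose invQ x := s2val (exinv x).
have mulVQ : {in unitQ, left_inverse 1 invQ *%R}.
  by move=> x ux; rewrite /invQ; case: (exinv x) => /= y /(_ ux).
have unitPQ (x y : Q) : y * x = 1 -> unitQ x.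
  by move=> yx; apply/boolp.asboolP; exists y.
have invQout : {in [predC unitQ], invQ =1 id}.
  by move=> x; rewrite inE /invQ; case: (exinv x) => /= y _ H /H.
pose cU := GRing.ComNzRing_hasMulInverse.Build Q mulVQ unitPQ invQout.
pose Qu : comUnitRingType := HB.pack Q cU.
pose cD := GRing.ComUnitRing_isIntegral.Build Qu Q_domain.
pose D : idomainType := HB.pack Qu cD.
pose piD : {rmorphism W -> D} := pi.
by exists D, piD.
Qed.

Lemma fraction_repr (D : idomainType) (z : {fraction D}) :
  exists a b : D, b != 0 /\ z = FracField.tofrac a / FracField.tofrac b.
Proof.
elim/quotW: z => r; exists (frac r).1, (frac r).2.
have d0 : (frac r).2 != 0 by exact: denom_ratioP.
split=> //; apply/(canRL (mulfK _)); first by rewrite tofrac_eq0.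
rewrite !piE; apply/eqP; rewrite piE /= /FracField.equivf /=.
rewrite /FracField.mulf !numden_Ratio ?oner_eq0 ?mulf_neq0 ?oner_neq0 //.
by rewrite !mulr1 mulrC.
Qed.

Lemma quot_field (W : comNzRingType) (I : W -> Prop) : is_prime I ->
  exists (F : fieldType) (rho : {rmorphism W -> F}),
    (forall w, rho w = 0 <-> I w) /\
    forall z : F, exists a b, rho b != 0 /\ z = rho a / rho b.
Proof.
move=> /quot_domain[D [pi [piP pi_surj]]].
exists {fraction D}, (@FracField.tofrac D \o pi); split=> [w|z] /=.
  rewrite -piP; split=> [/eqP|->]; last exact: tofrac0.
  by rewrite tofrac_eq0 => /eqP.
have [a [b [b0 ->]]] := fraction_repr z.
have [x xa] := pi_surj a; have [y yb] := pi_surj b.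
by exists x, y; rewrite /= xa yb tofrac_eq0.
Qed.

(** An ideal that is maximal among those avoiding all powers of [r] is prime. Zorn's lemma is
    applied to sets whose union with [J] is such an ideal; adding [J] afterwards makes the union of
    the empty chain harmless. *)
Lemma krull_prime (W : comNzRingType) (J : W -> Prop) (r : W) :
  is_ideal J -> (forall N, ~ J (r ^+ N)) ->
  exists q, [/\ is_prime q, forall x, J x -> q x & ~ q r].
Proof.
move=> [J0 JD] Jr.
pose ok (A : W -> Prop) := is_ideal A /\ forall N, ~ A (r ^+ N).
pose addJ (A : W -> Prop) x := A x \/ J x.
have [F FP Ftot|A [[[q0 qD] qr] Amax]] :=
  @classical_sets.Zorn_bigcup W (fun A => ok (addJ A)).
  set U := classical_sets.bigcup F id.
  have UP x : addJ U x -> (exists2 A, F A & A x) \/ J x.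
    by case=> [[A FA Ax]|]; [left; exists A | right].
  have UI A x : F A -> A x -> addJ U x by move=> FA Ax; left; exists A.
  split; last first.
    move=> N /UP[[A FA Ax]|]; last exact: Jr.
    by have [_ /(_ N)] := FP _ FA; apply; left.
  split; first by right.
  move=> a x y Ux Uy.
  have AU A z : F A -> addJ A z -> addJ U z.
    by move=> FA [/(UI _ _ FA) //|Jz]; right.
  have [[B [FB Bx By]]|Jx] : (exists B, [/\ F B, addJ B x & addJ B y]) \/ (J x /\ J y).
  - case: (UP _ Ux) (UP _ Uy) => [[A FA Ax]|Jx] [[B FB By]|Jy].
    + by case: (Ftot _ _ FA FB) => sAB; left; [exists B|exists A]; split=> //;
        left=> //; apply: sAB.
    + by left; exists A; split=> //; [left|right].
    + by left; exists B; split=> //; [right|left].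
    + by right.
  - by have [[_ H] _] := FP _ FB; apply: (AU B) => //; apply: H.
  - by right; apply: JD; case: Jx.
exists (addJ A); split; last 2 first.
- by move=> x; right.
- by rewrite -(expr1 r); apply: qr.
(* By maximality, adjoining any new element [x] produces a power of [r]. *)
have big x : ~ addJ A x -> exists N a b, r ^+ N = a * x + b /\ addJ A b.
  move=> nAx; pose A' z := exists a b, z = a * x + b /\ addJ A b.
  have qA' z : addJ A z -> A' z by exists 0, z; rewrite mul0r add0r.
  have A'x : A' x by exists 1, 0; rewrite mul1r addr0.
  have pA : classical_sets.proper A A'.
    by split=> [z Az|sA'A]; [apply: qA'; left | apply: nAx; left; apply: sA'A].
  apply: boolp.contrapT => noN; apply: (Amax _ pA).
  have A'J z : addJ A' z -> A' z by case=> // Jz; apply: qA'; right.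
  split; last by move=> N /A'J[a [b H]]; apply: noN; exists N, a, b.
  split; first by right.
  move=> c y z /A'J[a1 [b1 [-> q1]]] /A'J[a2 [b2 [-> q2]]]; left.
  exists (c * a1 + a2), (c * b1 + b2); split; last exact: qD.
  by rewrite mulrDr mulrDl addrACA !mulrA.
split=> //; first by rewrite -(expr0 r); apply: qr.
move=> x y qxy; apply: boolp.contrapT => /boolp.not_orP[nx ny].
have [N [a [b [rN qb]]]] := big _ nx; have [M [c [d [rM qd]]]] := big _ ny.
have qS u v : addJ A v -> addJ A (u * v).
  by move=> qv; rewrite -[u * v]addr0; apply: qD.
have qP u v : addJ A u -> addJ A v -> addJ A (u + v).
  by move=> qu qv; rewrite -[u]mul1r; apply: qD.
apply: (qr (N + M)%N); rewrite exprD rN rM mulrDl mulrDr mulrACA.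
apply: (qP); first by apply: (qP); apply: (qS).
by rewrite mulrC; apply: (qS).
Qed.

Section Divisibility.
Variable R : comNzRingType.
Implicit Types a x y p : R.

Lemma principal_ideal p : is_ideal (principal p).
Proof.
split=> [|a x y [c ->] [d ->]]; first by exists 0; rewrite mul0r.
by exists (a * c + d); rewrite mulrDl mulrA.
Qed.

Lemma principal_refl p : principal p p.
Proof. by exists 1; rewrite mul1r. Qed.

Lemma principal_mull p a x : principal p x -> principal p (a * x).
Proof. by case=> c ->; exists (a * c); rewrite mulrA. Qed.

Lemma principal_mulr p a x : principal p x -> principal p (x * a).
Proof. by rewrite mulrC; apply: principal_mull. Qed.

Lemma principal_add p x y : principal p x -> principal p y -> principal p (x + y).
Proof. by move=> px py; rewrite -[x]mul1r; apply: (principal_ideal p).2. Qed.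

Lemma principal_sum p (I : Type) (r : seq I) (P : pred I) (F : I -> R) :
  (forall i, P i -> principal p (F i)) -> principal p (\sum_(i <- r | P i) F i).
Proof.
move=> H; apply: (big_ind (principal p)) => //.
  exact: (principal_ideal p).1.
by move=> x y; apply: principal_add.
Qed.

Lemma principal_trans p x y : principal p x -> principal x y -> principal p y.
Proof. by move=> px [c ->]; apply: principal_mull. Qed.

End Divisibility.

Definition prime_elt (R : comNzRingType) (p : R) := p != 0 /\ is_prime (principal p).

Definition ufd (R : idomainType) := forall x : R, x != 0 -> exists u s,
  [/\ u \is a GRing.unit, forall p, p \in s -> prime_elt p
    & x = u * \prod_(p <- s) p].

Section PrimeElements.
Variable R : idomainType.
Implicit Types a x y p : R.

Lemma prime_eltM p x y : prime_elt p -> principal p (x * y) ->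
  principal p x \/ principal p y.
Proof. by case=> _ [_ _]; apply. Qed.

Lemma prime_elt_unit p u : prime_elt p -> u \is a GRing.unit -> ~ principal p u.
Proof.
case=> _ [_ p1 _] uu pu; apply: p1; rewrite -(mulVr uu); exact: principal_mull.
Qed.

Lemma prime_elt_prod p (s : seq R) : prime_elt p ->
  principal p (\prod_(q <- s) q) -> exists2 q, q \in s & principal p q.
Proof.
move=> pp; elim: s => [|q s IH]; first by rewrite big_nil => /(prime_elt_unit pp (unitr1 _)).
rewrite big_cons => /(prime_eltM pp)[pq|/IH[q' q's pq']]; first by exists q; rewrite ?mem_head.
by exists q'; rewrite // inE q's orbT.
Qed.

Lemma prime_elt_assoc p q : prime_elt p -> prime_elt q -> principal p q ->
  exists2 u, u \is a GRing.unit & q = u * p.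
Proof.
move=> pp qq [c qE]; exists c => //.
have : principal q (c * p) by rewrite -qE; apply: principal_refl.
case/(prime_eltM qq) => [[d cE]|[d pE]].
  case: pp => _ [_ p1 _]; case: p1; exists d.
  have q0 : q != 0 by case: qq.
  by apply: (mulIf q0); rewrite mul1r {1}qE cE mulrAC.
have p0 : p != 0 by case: pp.
suff dc : d * c = 1 by apply/unitrP; exists d; rewrite [c * d]mulrC.
by apply: (mulIf p0); rewrite mul1r -mulrA -qE -pE.
Qed.

(** The length of a factorization, kept as a relation. It decreases when a prime is divided out,
    which drives the inductions on primitive parts and on valuations. *)
Definition nfactors x n := exists u s,
  [/\ u \is a GRing.unit, forall p, p \in s -> prime_elt p, size s = n
    & x = u * \prod_(p <- s) p].

Lemma nfactors_div p x n : prime_elt p -> nfactors (x * p) n ->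
  exists2 m, (m < n)%N & nfactors x m.
Proof.
move=> pp [u [s [uu ps sn xE]]].
have : principal p (u * \prod_(q <- s) q) by rewrite -xE; apply/principal_mull/principal_refl.
case/(prime_eltM pp) => [pu|/(prime_elt_prod pp)[q qs pq]].
  by case: (prime_elt_unit pp uu).
have [a ua qE] := prime_elt_assoc pp (ps _ qs) pq.
exists (size (rem q s)).
  by rewrite size_rem // -sn prednK // lt0n size_eq0; case: (s) qs.
exists (u * a), (rem q s); split; rewrite ?unitrM ?uu //.
  by move=> p' /mem_rem /ps.
have p0 : p != 0 by case: pp.
apply: (mulIf p0); rewrite xE (perm_big _ (perm_to_rem qs)) big_cons /= qE.
by rewrite -!mulrA; congr (_ * (_ * _)); rewrite mulrC.
Qed.

(** Each [p] in [s] divides the product of [g] with its cofactor but not [g], hence it divides the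
    cofactor and can be cancelled. *)
Lemma ufd_mul_cancel (s : seq R) g h (u : R) : u \is a GRing.unit ->
  (forall p, p \in s -> prime_elt p /\ ~ principal p g) ->
  principal g (u * (\prod_(p <- s) p) * h) -> principal g h.
Proof.
move=> uu; elim: s => [|p s IH] ps; rewrite ?big_nil ?big_cons.
  by rewrite mulr1 => /(principal_mull u^-1); rewrite mulKr.
move=> [c cE]; have [pp png] := ps p (mem_head _ _).
apply: IH => [q qs|]; first by apply: ps; rewrite inE qs orbT.
have p0 : p != 0 by case: pp.
have : principal p (c * g).
  by rewrite -cE mulrAC mulrCA -mulrA; apply/principal_mulr/principal_refl.
case/(prime_eltM pp) => // -[d dE]; exists d; apply: (mulfI p0).
by rewrite [RHS]mulrA [p * d]mulrC -dE -cE !mulrA [p * u]mulrC.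
Qed.

End PrimeElements.

Section Gauss.
Variable D : idomainType.
Hypothesis D_ufd : ufd D.
Implicit Types f g h : {poly D}.

Lemma principal_polyC (p : D) f :
  principal p%:P f <-> forall i, principal p f`_i.
Proof.
split=> [[c ->] i|H]; first by exists c`_i; rewrite coefMC.
have [c cE] := boolp.choice H.
exists (\poly_(i < size f) c i); apply/polyP => i.
rewrite coefMC coef_poly; case: ltnP => [_|le]; first exact: cE.
by rewrite mul0r nth_default.
Qed.

Lemma prime_polyC (p : D) : prime_elt p -> prime_elt p%:P.
Proof.
case=> p0 pp; split; first by rewrite polyC_eq0.
split; first exact: principal_ideal.
  by case: pp => _ p1 _ /principal_polyC/(_ 0%N); rewrite coef1.
have [D' [pi [piP _]]] := quot_domain pp.
have piC f : map_poly pi f = 0 <-> principal p%:P f.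
  rewrite principal_polyC; split=> [/polyP H i|H].
    by apply/piP; rewrite -coef_map H coef0.
  by apply/polyP => i; rewrite coef_map coef0; apply/piP.
move=> f g /piC; rewrite rmorphM => /eqP; rewrite mulf_eq0 => /orP[] /eqP/piC; by [left|right].
Qed.

Definition primitive g := forall p : D, prime_elt p -> ~ principal p%:P g.

(** Gauss's lemma: divisibility over the fraction field costs a scalar [c], whose prime factors
    remain prime as constant polynomials and do not divide the primitive [g]. *)
Lemma primitive_dvdp g h : primitive g -> g %| h -> principal g h.
Proof.
move=> gp /Pdiv.Idomain.dvdpP[[c q] /= c0 E].
have [u [s [uu ps cE]]] := D_ufd c0.
apply: (@ufd_mul_cancel _ [seq p%:P | p : D <- s] g h u%:P).
- exact: (rmorph_unit (@polyC D)).
- move=> P /mapP[p /ps pp ->]; split; [exact: prime_polyC | exact: gp].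
- by exists q; rewrite -E big_map -rmorph_prod -polyCM -cE mul_polyC.
Qed.

Lemma primitive_part g : g != 0 ->
  exists c g', [/\ c != 0, g = c *: g' & primitive g'].
Proof.
move=> g0; have [n] : exists n, nfactors (lead_coef g) n.
  have [|u [s [uu ps E]]] := D_ufd (x := lead_coef g); first by rewrite lead_coef_eq0.
  by exists (size s), u, s.
elim/ltn_ind: n g g0 => n IH g g0 gn.
have [gp|/boolp.existsNP[p /boolp.not_implyP[pp /boolp.contrapT[g1 E]]]] := boolp.pselect (primitive g).
  by exists 1, g; rewrite scale1r oner_eq0.
have p0 : p != 0 by case: pp.
have g10 : g1 != 0 by apply: contraNneq g0 => z; rewrite E z mul0r.
move: gn; rewrite E lead_coefM lead_coefC => /(nfactors_div pp)[m mn g1m].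
have [c [g' [c0 E' gp']]] := IH m mn g1 g10 g1m.
exists (c * p), g'; split=> //; first by rewrite mulf_neq0.
by rewrite E' mulrC mul_polyC scalerA mulrC.
Qed.

(** Among the nonconstant divisors of [f] over the fraction field take one of least degree and make
    it primitive. Its gcd with any [a] is constant or associate to it, so it is prime; dividing by
    it lowers the degree. *)
Lemma ufd_poly : ufd {poly D}.
Proof.
move=> f; move: {2}(size f) (leqnn (size f)) => N.
elim: N f => [|N IH] f; first by rewrite leqn0 size_poly_eq0 => ->.
move=> fN f0; case: (leqP (size f) 1) => [f1|f1].
  have fC := size1_polyC f1; move: f0; rewrite fC polyC_eq0.
  move=> /D_ufd[u [s [uu ps ->]]].
  exists u%:P, [seq p%:P | p : D <- s]; split.
  - exact: (rmorph_unit (@polyC D)).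
  - by move=> P /mapP[p /ps pp ->]; apply: prime_polyC.
  - by rewrite big_map -rmorph_prod -polyCM.
pose good m := boolp.asbool (exists g, [/\ size g = m, (1 < size g)%N & g %| f]).
have exgood : exists m, good m by exists (size f); apply/boolp.asboolP; exists f; rewrite dvdpp.
case: (ex_minnP exgood) => m /boolp.asboolP[g [gm g1 gf]] mmin.
have g0 : g != 0 by rewrite -size_poly_gt0 (leq_trans _ g1).
have [c [h [c0 E hp]]] := primitive_part g0.
have hg : h %= g by rewrite E; apply/eqpP; exists (c, 1); rewrite ?c0 ?oner_eq0 //= scale1r.
have {}gf : h %| f by rewrite (eqp_dvdl _ hg).
have {}hm : size h = m by rewrite (eqp_size hg).
have h0 : h != 0 by rewrite -size_poly_gt0 hm -gm (leq_trans _ g1).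
have hprime : prime_elt h.
  split=> //; split; first exact: principal_ideal.
    case=> q E1; have : h %| 1 by rewrite E1 dvdp_mulIr.
    by rewrite dvdp1 hm -gm gtn_eqF.
  move=> a b [q hab]; have {q hab} hab : h %| a * b by rewrite hab dvdp_mulIr.
  case: (leqP (size (gcdp h a)) 1) => [g_le|g_gt]; last first.
    left; apply: primitive_dvdp => //.
    have /mmin : good (size (gcdp h a)).
      apply/boolp.asboolP; exists (gcdp h a); split=> //.
      exact: dvdp_trans (dvdp_gcdl _ _) gf.
    rewrite -hm => le; have := dvdp_gcdl h a.
    move=> gh; rewrite -(eqp_dvdl a (_ : gcdp h a %= h)) ?dvdp_gcdr //.
    by rewrite -(dvdp_size_eqp gh) eqn_leq le dvdp_leq.
  right; apply: primitive_dvdp => //.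
  rewrite -(Gauss_dvdpr b (_ : coprimep h a)) //.
  by rewrite /coprimep eqn_leq g_le size_poly_gt0 gcdp_eq0 (negPf h0).
have [q E'] := primitive_dvdp hp gf.
have q0 : q != 0 by apply: contra_neq f0 => q0; rewrite E' q0 mul0r.
have [|u [s [uu ps qE]]] := IH q _ q0.
  rewrite -ltnS; apply: leq_trans fN; rewrite E' size_mul // hm -gm.
  by move: g1; case: (size g) => [|[|k]] // _; rewrite !addnS /= ltnS leq_addr.
exists u, (h :: s); split=> //.
  by move=> p; rewrite inE => /orP[/eqP-> //|/ps].
by rewrite big_cons E' qE mulrAC mulrA.
Qed.
End Gauss.

Lemma mpoly_rmorph_ext (n : nat) (R S : nzRingType)
    (f g : {rmorphism {mpoly R[n]} -> S}) :
  (forall c, f c%:MP = g c%:MP) -> (forall i, f 'X_i = g 'X_i) -> f =1 g.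
Proof.
move=> fgC fgX p; rewrite (mpolyE p) !rmorph_sum /=; apply: eq_bigr => m _.
rewrite -mul_mpolyC !rmorphM fgC /=; congr (_ * _).
by rewrite mpolyXE_id !rmorph_prod /=; apply: eq_bigr => i _; rewrite !rmorphXn /= fgX.
Qed.

Section OneVariable.
Variables (R : comNzRingType) (n : nat) (v : 'I_n.+1).

(** [uni] and [multi] are the two directions of the isomorphism between the polynomial ring in n + 1
    variables and the ring of polynomials in [X_v] over the other n. They serve the induction for
    unique factorization and the control of the degree in a single variable. *)
Definition uni_var (i : 'I_n.+1) : {poly {mpoly R[n]}} :=
  if unlift v i is Some j then ('X_j)%:P else 'X.
Definition uni (p : {mpoly R[n.+1]}) : {poly {mpoly R[n]}} :=
  mmap (polyC \o @mpolyC n R) uni_var p.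
HB.instance Definition _ := GRing.RMorphism.copy uni (mmap (polyC \o @mpolyC n R) uni_var).

Definition lift_var (p : {mpoly R[n]}) : {mpoly R[n.+1]} :=
  mmap (@mpolyC n.+1 R) (fun j => 'X_(lift v j)) p.
HB.instance Definition _ := GRing.RMorphism.copy lift_var
  (mmap (@mpolyC n.+1 R) (fun j => 'X_(lift v j))).

Definition multi (q : {poly {mpoly R[n]}}) : {mpoly R[n.+1]} :=
  horner_eval 'X_v (map_poly lift_var q).
HB.instance Definition _ := GRing.RMorphism.copy multi
  (horner_eval ('X_v : {mpoly R[n.+1]}) \o map_poly lift_var).

Lemma uniC c : uni c%:MP = c%:MP%:P. Proof. exact: mmapC. Qed.
Lemma uniX i : uni 'X_i = uni_var i.
Proof. by rewrite /uni mmapX mmap1U. Qed.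
Lemma uniXv : uni 'X_v = 'X. Proof. by rewrite uniX /uni_var unlift_none. Qed.
Lemma uniXl j : uni 'X_(lift v j) = ('X_j)%:P.
Proof. by rewrite uniX /uni_var liftK. Qed.

Lemma lift_varC c : lift_var c%:MP = c%:MP. Proof. exact: mmapC. Qed.
Lemma lift_varX j : lift_var 'X_j = 'X_(lift v j).
Proof. by rewrite /lift_var mmapX mmap1U. Qed.

Lemma uni_lift p : uni (lift_var p) = p%:P.
Proof.
apply: (@mpoly_rmorph_ext _ _ _ (uni \o lift_var) (@polyC _)) => [c|i] /=.
  by rewrite lift_varC uniC.
by rewrite lift_varX uniXl.
Qed.

Lemma multiC p : multi p%:P = lift_var p.
Proof. by rewrite /multi map_polyC /horner_eval hornerC. Qed.

Lemma multiX : multi 'X = 'X_v.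
Proof. by rewrite /multi map_polyX /horner_eval hornerX. Qed.

Lemma uniK : cancel uni multi.
Proof.
move=> p; apply: (@mpoly_rmorph_ext _ _ _ (multi \o uni) idfun) => [c|i] /=.
  by rewrite uniC multiC lift_varC.
by case: (unliftP v i) => [j|] ->; rewrite ?uniXl ?uniXv ?multiC ?multiX ?lift_varX.
Qed.

Lemma multiK : cancel multi uni.
Proof.
move=> q; elim/poly_ind: q => [|q c IH]; first by rewrite !rmorph0.
by rewrite !(rmorphD, rmorphM) /= IH multiX multiC uniXv uni_lift.
Qed.

End OneVariable.

Lemma ufd_iso (R S : idomainType) (f : {rmorphism R -> S}) (g : {rmorphism S -> R}) :
  cancel f g -> cancel g f -> ufd S -> ufd R.
Proof.
move=> fK gK S_ufd x x0.
have fx0 : f x != 0 by apply: contra_neq x0 => fx; rewrite -(fK x) fx rmorph0.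
have [u [s [uu ps E]]] := S_ufd _ fx0.
exists (g u), [seq g p | p <- s]; split; first exact: rmorph_unit.
  move=> _ /mapP[p /ps[p0 [_ p1 pM]] ->].
  have prinP y : principal (g p) y <-> principal p (f y).
    split=> [[c ->]|[c E']]; first by exists (f c); rewrite rmorphM gK.
    by exists (g c); rewrite -rmorphM -E' fK.
  split; first by apply: contra_neq p0 => gp; rewrite -(gK p) gp rmorph0.
  split; first exact: principal_ideal.
    by move=> /prinP; rewrite rmorph1.
  by move=> y z /prinP; rewrite rmorphM => /pM[] /prinP; [left|right].
by rewrite big_map -rmorph_prod -rmorphM -E fK.
Qed.

Lemma ufd_mpoly (F : fieldType) (n : nat) : ufd {mpoly F[n]}.
Proof.
elim: n => [|n IH]; last first.
  exact: ufd_iso (@uniK F n ord0) (@multiK F n ord0) (ufd_poly IH).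
move=> p p0; exists p, [::]; rewrite big_nil mulr1; split=> //.
rewrite [p]nvar0_mpolyC; apply: rmorph_unit.
by rewrite unitfE -(mpolyC_eq0 0) -nvar0_mpolyC.
Qed.

(** Substituting 0 for the variables one after the other never changes [p], which has degree 0 in
    each of them; at the end only the constant term is left. *)
Lemma mpoly_const (R : comNzRingType) (n : nat) (p : {mpoly R[n.+1]}) :
  (forall v, (size (uni v p) <= 1)%N) -> p = (p@_0%MM)%:MP.
Proof.
move=> p1.
pose sg (s : seq 'I_n.+1) : {rmorphism {mpoly R[n.+1]} -> {mpoly R[n.+1]}} :=
  mmap (@mpolyC n.+1 R) (fun i => if i \in s then 0 else 'X_i).
have sgC s c : sg s c%:MP = c%:MP by exact: mmapC.
have sgX s i : sg s 'X_i = if i \in s then 0 else 'X_i.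
  by rewrite /sg /= mmapX mmap1U.
have sgp s : sg s p = p.
  elim: s => [|v s IH].
    by apply: (@mpoly_rmorph_ext _ _ _ (sg [::]) idfun) => [c|i]; rewrite ?sgC ?sgX.
  rewrite -{2}IH -(uniK v p) (size1_polyC (p1 v)) multiC.
  apply: (@mpoly_rmorph_ext _ _ _ (sg (v :: s) \o lift_var v) (sg s \o lift_var v)) => [c|i].
    by rewrite [LHS]/= [RHS]/= lift_varC !sgC.
  rewrite [LHS]/= [RHS]/= lift_varX !sgX inE eq_sym (negPf (neq_lift _ _)) //=.
rewrite -[LHS](sgp (enum 'I_n.+1)).
apply: (@mpoly_rmorph_ext _ _ _ (sg _) (@mpolyC n.+1 R \o mcoeff 0%MM)) => [c|i].
  by rewrite [RHS]/= mpolyCK sgC.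
by rewrite sgX mem_enum /= mcoeffX mnm1_eq0 mpolyC0.
Qed.

Lemma prime_elt_nonconst (F : fieldType) (n : nat) (p : {mpoly F[n.+1]}) :
  prime_elt p -> exists v, (1 < size (uni v p))%N.
Proof.
move=> pp; apply: boolp.contrapT => np.
have pC : p = (p@_0%MM)%:MP.
  by apply: mpoly_const => v; rewrite leqNgt; apply/negP => H; apply: np; exists v.
apply: (prime_elt_unit pp _ (principal_refl p)).
rewrite pC; apply: rmorph_unit; rewrite unitfE -(mpolyC_eq0 n.+1) -pC.
by case: pp.
Qed.

Section Ufd.
Variable R : idomainType.
Hypothesis R_ufd : ufd R.
Implicit Types a x y p g : R.

Definition coprime_family (J : Type) (L : J -> R) :=
  forall p, prime_elt p -> ~ forall j, principal p (L j).

Lemma coprime_family_dvd (J : Type) (L : J -> R) a x : coprime_family L -> a != 0 ->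
  (forall j, principal a (x * L j)) -> principal a x.
Proof.
move=> Lcop /R_ufd[u [s [uu ps ->]]] {a}.
elim: s ps x => [|p s IH] ps x H.
  by rewrite big_nil mulr1; exists (x * u^-1); rewrite mulrVK.
have pp : prime_elt p by apply: ps; rewrite mem_head.
have p0 : p != 0 by case: pp.
have [j pj] : exists j, ~ principal p (L j) by apply/boolp.existsNP/Lcop.
have : principal p (x * L j).
  apply: principal_trans (H j); rewrite big_cons mulrCA.
  exact/principal_mulr/principal_refl.
case/(prime_eltM pp) => // -[y xE].
have [||c yE] := IH _ y.
- by move=> q qs; apply: ps; rewrite inE qs orbT.
- move=> i; have [c cE] := H i; exists c; apply: (mulfI p0).
  rewrite mulrA [p * y]mulrC -xE cE big_cons.
  by rewrite !(mulrCA p).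
by exists c; rewrite xE yE big_cons -!mulrA; congr (_ * (_ * _)); rewrite mulrC.
Qed.

(** A vector proportional to a family without common prime factor is a multiple of it. This depth
    two argument replaces the exactness of a Koszul complex wherever the forms are only known to be
    coprime. *)
Lemma coprime_family_prop (J : Type) (L x : J -> R) : coprime_family L ->
  (exists j, L j != 0) -> (forall i j, x i * L j = x j * L i) ->
  exists g, forall j, x j = g * L j.
Proof.
move=> Lcop [i Li] H.
have [|g gE] := coprime_family_dvd (x := x i) Lcop Li.
  by move=> j; exists (x j); rewrite H.
by exists g => j; apply: (mulIf Li); rewrite -H gE mulrAC.
Qed.

(** A relation, so that no factorization has to be chosen; for prime [p] the element 0 has no
    valuation. *)
Definition has_val p x (e : nat) := exists2 y, x = y * p ^+ e & ~ principal p y.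

Lemma has_val0 p x : has_val p x 0 <-> ~ principal p x.
Proof.
split=> [[y ->]|px]; first by rewrite expr0 mulr1.
by exists x; rewrite // expr0 mulr1.
Qed.

Lemma has_val_ex p x : prime_elt p -> x != 0 -> exists e, has_val p x e.
Proof.
move=> pp x0; have [n] : exists n, nfactors x n.
  by have [u [s [uu ps E]]] := R_ufd x0; exists (size s), u, s.
elim/ltn_ind: n x x0 => n IH x x0 xn.
have [[y E]|px] := boolp.EM (principal p x); last by exists 0%N; apply/has_val0.
have y0 : y != 0 by apply: contra_neq x0 => y0; rewrite E y0 mul0r.
move: xn; rewrite E => /(nfactors_div pp)[m mn ym].
have [e [z -> pz]] := IH m mn y y0 ym.
by exists e.+1, z; rewrite // exprSr mulrA.
Qed.

Lemma has_val_neq0 p x e : prime_elt p -> has_val p x e -> x != 0.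
Proof.
case=> p0 _ [y -> py]; rewrite mulf_neq0 ?expf_neq0 //.
by apply/eqP => y0; apply: py; rewrite y0; exists 0; rewrite mul0r.
Qed.

Lemma has_valM p x y e f : prime_elt p -> has_val p x e -> has_val p y f ->
  has_val p (x * y) (e + f).
Proof.
move=> pp [a -> pa] [b -> pb]; exists (a * b); first by rewrite exprD mulrACA.
by case/(prime_eltM pp).
Qed.

Lemma has_val_inj p x e f : prime_elt p -> has_val p x e -> has_val p x f -> e = f.
Proof.
move=> pp; wlog lef : e f / (e <= f)%N => [W|].
  by move=> He Hf; case/orP: (leq_total e f) => /W; [apply | move=> ->].
case: (pp) => p0 _ [a -> pa] [b E _].
case: (ltngtP e f) lef => // ltef _; case: pa.
have pe0 : p ^+ e != 0 by rewrite expf_neq0.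
exists (b * p ^+ (f - e).-1); apply: (mulIf pe0).
rewrite E -!mulrA -exprS -exprD addnS -addSn prednK ?subn_gt0 // subnK //.
exact: ltnW.
Qed.

Lemma prime_ideal_prod (q : R -> Prop) (u : R) (s : seq R) : is_prime q ->
  u \is a GRing.unit -> q (u * \prod_(p <- s) p) -> exists2 p, p \in s & q p.
Proof.
move=> [[q0 qD] q1 qM] uu.
have qS b x : q x -> q (b * x) by move=> qx; rewrite -[b * x]addr0; apply: qD.
case/qM => [qu|]; first by case: q1; rewrite -(mulVr uu); apply: (qS).
elim: s => [|p s IH]; first by rewrite big_nil.
rewrite big_cons => /qM[qp|/IH[r rs qr]]; first by exists p; rewrite ?mem_head.
by exists r; rewrite // inE rs orbT.
Qed.

Lemma prime_ideal0 : is_prime (fun x : R => x = 0).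
Proof.
split; first by split=> // a x y -> ->; rewrite mulr0 addr0.
  by apply/eqP/oner_neq0.
by move=> x y /eqP; rewrite mulf_eq0 => /orP[]/eqP; [left|right].
Qed.

Lemma prime_ideal_prime_elt (q : R -> Prop) x : is_prime q -> q x -> x != 0 ->
  exists2 p, prime_elt p & q p.
Proof.
move=> qp qx /R_ufd[u [s [uu ps xE]]].
have [|p /ps pp qp'] := prime_ideal_prod (q := q) (s := s) qp uu; first by rewrite -xE.
by exists p.
Qed.

(** A nonzero prime ideal contains a prime element. If the ideal lies inside (p), that element is
    associate to [p], so nothing fits strictly between 0 and (p). *)
Lemma height_one_prime_elt p : prime_elt p -> height_one (principal p).
Proof.
move=> pp; have [p0 ppr] := pp; split=> //; split.
  exists (fun i => if i is 0%N then (fun x => x = 0) else principal p); split=> //.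
  split=> [[|i] _|[|i] //= _]; [exact: prime_ideal0 | by [] |].
  split=> [x ->|]; first by exists 0; rewrite mul0r.
  by exists p; split; [exact: principal_refl | apply/eqP].
case=> c [[cp cs] c2].
have [_ [x [c1x c0x]]] := cs 0%N isT.
have x0 : x != 0.
  by apply/eqP => x0; apply: c0x; rewrite x0; case: (cp 0%N isT) => [[]].
have [r rr c1r] := prime_ideal_prime_elt (cp 1%N isT) c1x x0.
have [c12 [y [c2y c1y]]] := cs 1%N isT.
have [u uu rE] := prime_elt_assoc pp rr ((c2 r).1 (c12 _ c1r)).
apply: c1y; have [z ->] := (c2 y).1 c2y.
have [[_ cD] _ _] := cp 1%N isT.
rewrite (_ : z * p = (z * u^-1) * r + 0); first by apply: cD => //; case: (cp 1%N isT) => [[]].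
by rewrite addr0 rE mulrA mulrVK.
Qed.

Lemma height_one_principal (q : R -> Prop) : height_one q ->
  exists2 p, prime_elt p & same_set q (principal p).
Proof.
case=> qp [[c [[cp cs] c1]] nq].
have [_ [x [c1x c0x]]] := cs 0%N isT.
have x0 : x != 0.
  by apply/eqP => x0; apply: c0x; rewrite x0; case: (cp 0%N isT) => [[]].
have [r rr qr] := prime_ideal_prime_elt qp ((c1 x).1 c1x) x0.
exists r => // y; split; last first.
  case=> z ->; have [[q0 qD] _ _] := qp; rewrite -[_ * r]addr0; exact: qD.
move=> qy; apply: boolp.contrapT => ry; apply: nq.
have [r0 rp] := rr.
exists (fun i => if i is 0%N then (fun x => x = 0) else if i is 1%N then principal r else q).
split=> //; split=> [[|[|i]] _ //|[|[|i]] //= _]; first exact: prime_ideal0.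
  split=> [z ->|]; first by exists 0; rewrite mul0r.
  by exists r; split; [exact: principal_refl | apply/eqP].
split; last by exists y.
by move=> z [a ->]; have [[q0 qD] _ _] := qp; rewrite -[_ * r]addr0; apply: qD.
Qed.

End Ufd.

(** * Lengths of localized modules *)

Section SaturatedSubmodules.
Variables (B : comNzRingType) (q : B -> Prop) (N : lmodType B).
Hypothesis q_prime : is_prime q.
Implicit Types (W V : N -> Prop) (C : nat -> N -> Prop).

(** Submodules of [N] stable under division by elements outside [q] correspond to submodules of the
    localization at [q]. *)
Definition sat_submod W :=
  [/\ W 0, forall a x y, W x -> W y -> W (a *: x + y)
    & forall s x, ~ q s -> W (s *: x) -> W x].

Lemma sat_submodZ W a x : sat_submod W -> W x -> W (a *: x).
Proof. by case=> W0 WD _ Wx; rewrite -[_ *: x]addr0; apply: WD. Qed.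

Lemma sat_submodD W x y : sat_submod W -> W x -> W y -> W (x + y).
Proof. by case=> W0 WD _ Wx Wy; rewrite -[x]scale1r; apply: WD. Qed.

Lemma sat_submodB W x y : sat_submod W -> W x -> W y -> W (x - y).
Proof.
by move=> sW Wx Wy; rewrite -scaleN1r; apply: sat_submodD => //; apply: sat_submodZ.
Qed.

Lemma sat_submodI W V : sat_submod W -> sat_submod V -> sat_submod (fun x => W x /\ V x).
Proof.
move=> [W0 WD Ws] [V0 VD Vs]; split=> // [a x y [Wx Vx] [Wy Vy]|s x qs [Wx Vx]].
  by split; [apply: WD | apply: VD].
by split; [apply: Ws Wx | apply: Vs Vx].
Qed.

Definition strict_incl W V := (forall x, W x -> V x) /\ exists x, V x /\ ~ W x.

Definition sat_chain r C :=
  (forall i, (i <= r)%N -> sat_submod (C i)) /\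
  (forall i, (i < r)%N -> strict_incl (C i) (C i.+1)).

Definition chain_over W r := exists C, sat_chain r C /\ forall x, W x -> C 0%N x.

Definition composition_series l C := sat_chain l C /\
  forall i, (i < l)%N -> forall W, sat_submod W ->
    (forall x, C i x -> W x) -> (forall x, W x -> C i.+1 x) ->
    (forall x, W x -> C i x) \/ (forall x, C i.+1 x -> W x).

Lemma sat_chain_incl r C i j : sat_chain r C -> (i <= j <= r)%N ->
  forall x, C i x -> C j x.
Proof.
case=> _ Cs /andP[]; elim: j => [|j IH]; first by rewrite leqn0 => /eqP->.
rewrite leq_eqVlt => /orP[/eqP-> //|]; rewrite ltnS => ij jr x Cx.
by have [+ _] := Cs _ jr; apply; apply: IH => //; apply: ltnW.
Qed.

(* If N i is not contained in the maximal submodule V of U, then N i + V = U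
   after saturation, and the modular law makes N i.+1 :&: V strictly larger
   than N i :&: V; dropping one index gives a chain inside V. *)
Lemma jordan_holder l C r D : composition_series l C -> sat_chain r D ->
  (forall x, C 0%N x -> D 0%N x) -> (forall x, D r x -> C l x) -> (r <= l)%N.
Proof.
elim: l C r D => [|l IH] C r D [[Csat Cs] Csimple] Dch CD DC.
  case: r Dch DC => // r Dch DC.
  have [_ [x [Dx nDx]]] := Dch.2 0%N (ltn0Sn r); case: nDx.
  by apply/CD/DC; apply: (sat_chain_incl Dch (i := 1) (j := r.+1)); rewrite ?leqnn.
case: r Dch DC => // r Dch DC; rewrite ltnS.
set V := C l; have sV : sat_submod V by apply: Csat.
have sD i : (i <= r.+1)%N -> sat_submod (D i) by move=> ir; apply: Dch.1.
have CV x : C 0%N x -> V x by apply: (sat_chain_incl (conj Csat Cs)); rewrite leq0n leqnSn.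
have CDi i x : (i <= r.+1)%N -> C 0%N x -> D i x.
  by move=> ir /CD; apply: (sat_chain_incl Dch); rewrite leq0n.
pose inV i := forall x, D i x -> V x.
have DCi i x : (i <= r.+1)%N -> D i x -> C l.+1 x.
  by move=> ir Dx; apply: DC; apply: (sat_chain_incl Dch) Dx; rewrite ir leqnn.
have full i x : (i <= r.+1)%N -> ~ inV i -> C l.+1 x ->
    exists s y c, [/\ ~ q s, s *: x = y + c, D i y & V c].
  move=> ir nV Cx.
  pose W x := exists s y c, [/\ ~ q s, s *: x = y + c, D i y & V c].
  have [D0 DD Dsat] := sD _ ir; have [V0 VD Vsat] := sV.
  have VW y : V y -> W y.
    by move=> Vy; exists 1, 0, y; rewrite scale1r add0r; split=> //; case: q_prime.
  have DW y : D i y -> W y.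
    by move=> Dy; exists 1, y, 0; rewrite scale1r addr0; split=> //; case: q_prime.
  have sW : sat_submod W.
    split; first exact: VW.
      move=> a z z' [s [y [c [qs E Dy Vc]]]] [s' [y' [c' [qs' E' Dy' Vc']]]].
      exists (s * s'), ((a * s') *: y + s *: y'), ((a * s') *: c + s *: c'); split.
      - by case: q_prime => _ _ qM /qM[].
      - rewrite scalerDr scalerA -mulrA (mulrC s) mulrAC -mulrA -!scalerA.
        by rewrite [s *: (a *: z)]scalerA mulrC -scalerA [s' *: (a *: _)]scalerA mulrC
           E E' !scalerDr addrACA !scalerA.
      - by apply: (DD); rewrite // -[s *: y']addr0; apply: (DD).
      - by apply: (VD); rewrite // -[s *: c']addr0; apply: (VD).
    move=> s z qs [s' [y [c [qs' E Dy Vc]]]]; exists (s' * s), y, c.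
    by rewrite -scalerA; split=> //; case: q_prime => _ _ qM /qM[].
  case: (Csimple l (ltnSn l) W sW).
  - by move=> y Vy; apply: VW.
  - move=> z [s [y [c [qs E Dy Vc]]]].
    have [_ _ Cs'] := Csat _ (leqnn l.+1); apply: (Cs' s) => //; rewrite E.
    apply: sat_submodD; [exact: Csat | exact: DCi Dy |].
    by apply: (sat_chain_incl (conj Csat Cs)) Vc; rewrite leqnSn leqnn.
  - by move=> WV; case: nV => y Dy; apply/WV/DW.
  - by apply.
have inVS i : (i <= r)%N -> inV i.+1 -> inV i.
  by move=> ir iV x Dx; apply: iV; have [+ _] := Dch.2 i ir; apply.
(* As long as [D i] lies in [V] it is kept; from then on [D i.+1] is cut down to [V]. The index lost
   is the one at which the chain leaves [V]. *)
pose E i x := (inV i /\ D i x) \/ (~ inV i /\ (D i.+1 x /\ V x)).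
have EV i x : inV i -> (E i x <-> D i x).
  by move=> iV; split=> [[[]|[]]|Dx] //; left.
have EN i x : ~ inV i -> (E i x <-> D i.+1 x /\ V x).
  by move=> iV; split=> [[[]|[]]|Dx] //; right.
apply: (IH C r E).
- split; last by move=> i il; apply: Csimple; apply: ltnW.
  split=> i il; [apply: Csat | apply: Cs]; apply: ltnW => //; exact: il.
- split=> i ir.
    have [iV|iV] := boolp.EM (inV i).
      have [D0 DD Dsat] := sD i (leq_trans ir (leqnSn r)).
      split=> [|a x y|s x qs]; rewrite ?EV //; [exact: DD | exact: Dsat].
    have [D0 DD Dsat] := sat_submodI (sD i.+1 ir) sV.
    split=> [|a x y|s x qs]; rewrite ?EN //; [exact: DD | exact: Dsat].
  have [sDD _] := Dch.2 i (ltnW ir).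
  have [sDD' [x [Dx nDx]]] := Dch.2 i.+1 ir.
  have [iV|iV] := boolp.EM (inV i); last first.
    have iV' : ~ inV i.+1 by move=> /inVS H; apply: iV; apply: H; apply: ltnW.
    split=> [y /(EN _ _ iV)[Dy Vy]|].
      by apply/(EN _ _ iV'); split=> //; apply: sDD'.
    have [s [y [c [qs xE Dy Vc]]]] : exists s y c, [/\ ~ q s, s *: x = y + c, D i y & V c].
      by apply: full => //; [apply: ltnW; apply: ltnW | apply: DCi Dx; rewrite ltnS].
    exists c; split.
      apply/(EN _ _ iV'); split=> //.
      rewrite (_ : c = s *: x - y); last by rewrite xE addrC addKr.
      apply: sat_submodB; [exact: sD | apply: sat_submodZ => //; exact: sD |].
      by apply/sDD'/sDD.
    move=> /(EN _ _ iV)[Dc _]; apply: nDx.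
    have [_ _ Dsat] := sD i.+1 (ltnW ir); apply: (Dsat s) => //; rewrite xE.
    by apply: sat_submodD => //; [apply: sD; apply: ltnW | apply: sDD].
  have [iV'|iV'] := boolp.EM (inV i.+1).
    split=> [y /(EV _ _ iV)/sDD Dy|]; first exact/(EV _ _ iV').
    have [_ [y [Dy nDy]]] := Dch.2 i (ltnW ir).
    by exists y; split; [apply/(EV _ _ iV') | move/(EV _ _ iV)].
  split=> [y /(EV _ _ iV) Dy|].
    by apply/(EN _ _ iV'); split; [apply/sDD'/sDD | apply: iV].
  have [s [y [c [qs xE Dy Vc]]]] : exists s y c, [/\ ~ q s, s *: x = y + c, D i.+1 y & V c].
    by apply: full => //; [apply: ltnW | apply: DCi Dx; rewrite ltnS].
  exists c; split.
    apply/(EN _ _ iV'); split=> //.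
    rewrite (_ : c = s *: x - y); last by rewrite xE addrC addKr.
    apply: sat_submodB; [exact: sD | apply: sat_submodZ => //; exact: sD |].
    exact/sDD'.
  move=> /(EV _ _ iV) Dc; apply: nDx.
  have [_ _ Dsat] := sD i.+1 (ltnW ir); apply: (Dsat s) => //; rewrite xE.
  by apply: sat_submodD => //; [apply: sD; apply: ltnW | apply: sDD].
- have [iV|iV] := boolp.EM (inV 0%N) => x Cx; first by apply/(EV _ _ iV); apply: CD.
  by apply/(EN _ _ iV); split; [apply: CDi | apply: CV].
- have [iV|iV] := boolp.EM (inV r) => x; first by move/(EV _ _ iV); apply: iV.
  by case/(EN _ _ iV).
Qed.

Lemma composition_length l C W : composition_series l C ->
  (forall x, W x -> C 0%N x) ->
  (forall V, sat_submod V -> (forall x, W x -> V x) -> forall x, C 0%N x -> V x) ->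
  (forall x, C l x) -> chain_over W l /\ ~ chain_over W l.+1.
Proof.
move=> Cser WC CW Cl; split; first by exists C; split=> //; case: Cser.
case=> D [Dch WD].
have := jordan_holder Cser Dch (CW _ (Dch.1 0%N isT) WD) (fun x _ => Cl x).
by rewrite ltnn.
Qed.

End SaturatedSubmodules.

Section LocalizedChains.
Variables (B : comNzRingType) (q : B -> Prop) (N M : lmodType B) (pi : N -> M).
Hypotheses (q_prime : is_prime q)
  (piP : forall a x y, pi (a *: x + y) = a *: pi x + pi y)
  (pi_surj : forall m, exists x, pi x = m).

Lemma pi_zero : pi 0 = 0.
Proof.
by have /esym/eqP := piP 1 0 0; rewrite !scale1r addr0 -subr_eq0 addrK => /eqP.
Qed.

Lemma pi_scale a x : pi (a *: x) = a *: pi x.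
Proof. by rewrite -[a *: x]addr0 piP pi_zero addr0. Qed.

(** A submodule of the localization is determined by its elements with denominator 1; pulled back
    along [pi] they form a saturated submodule containing the kernel. *)
Lemma has_loc_chainP r :
  has_loc_chain q M r <-> chain_over q (fun x : N => pi x = 0) r.
Proof.
have q1 : ~ q 1 by case: q_prime.
have qM s t : ~ q s -> ~ q t -> ~ q (s * t) by case: q_prime => _ _ H qs qt /H[].
split=> [[L [Lsub Llt]]|[C [[Csat Clt] C0]]].
  (* Denominators outside [q] are units, so membership depends on the numerator alone. *)
  have frac1 i m s : (i <= r)%N -> L i m s <-> ~ q s /\ L i m 1.
    move=> /Lsub[Lq Lf L0 LD LZ]; split=> [H|[qs H]]; last first.
      apply: (Lf (1 *: m) (s * 1)) => //; last exact: LZ.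
      by exists 1; split=> //; rewrite !scale1r mulr1 subrr.
    split; first exact: Lq H.
    apply: (Lf (s *: m) (1 * s)) => //; last exact: LZ.
    by exists 1; split=> //; rewrite mul1r !scale1r subrr.
  exists (fun i x => L i (pi x) 1); split; last first.
    by move=> x ->; case: (Lsub 0%N isT).
  split=> i ir.
    have [Lq Lf L0 LD LZ] := Lsub i ir; split.
    - by rewrite pi_zero.
    - move=> a x y Lx Ly; rewrite piP.
      have := LD _ _ _ _ (LZ a 1 _ _ q1 Lx) Ly.
      by rewrite !mulr1 !scale1r.
    - move=> s x qs; rewrite pi_scale => H.
      apply: (Lf (1 *: (s *: pi x)) (s * 1)) => //; last exact: LZ.
      by exists 1; split=> //; rewrite mulr1 !scale1r subrr.
  have [inc [m [s [Lm nLm]]]] := Llt i ir; split; first by move=> x; apply: inc.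
  have [x xm] := pi_surj m; exists x; rewrite xm.
  have [qs L1] := (frac1 _ m s ir).1 Lm; split=> // Li.
  by apply: nLm; apply/(frac1 _ _ _ (ltnW ir)).
have Ceq i x y : (i <= r)%N -> pi x = pi y -> C i x -> C i y.
  move=> ir xy Cx; have sC := Csat i ir.
  rewrite -[y](subrK x); apply: (sat_submodD sC) => //.
  have incl := sat_chain_incl (conj Csat Clt) (i := 0) (j := i).
  apply: incl => //; apply: C0; rewrite -scaleN1r addrC piP scaleN1r xy.
  by rewrite addrC subrr.
exists (fun i m s => ~ q s /\ exists2 x, pi x = m & C i x); split=> i ir.
  have sC := Csat i ir; split.
  - by move=> m s [].
  - move=> m s m' s' qs' [u [qu E]] [qs [x xm Cx]]; split=> //.
    have [y ym] := pi_surj m'; exists y => //.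
    have [_ _ Cs] := sC; apply: (Cs (u * s)); first exact: qM.
    apply: (Ceq _ ((u * s') *: x)) => //; last exact: (sat_submodZ _ sC).
    rewrite !pi_scale xm ym; apply/eqP; rewrite -subr_eq0 -!scalerA -scalerBr.
    exact/eqP.
  - by split=> //; exists 0; [exact: pi_zero | case: sC].
  - move=> m s m' s' [qs [x xm Cx]] [qs' [y ym Cy]]; split; first exact: qM.
    exists (s' *: x + s *: y); first by rewrite piP pi_scale xm ym.
    by apply: (sat_submodD sC) => //; apply: (sat_submodZ _ sC).
  - move=> a t m s qt [qs [x xm Cx]]; split; first exact: qM.
    by exists (a *: x); [rewrite pi_scale xm | apply: (sat_submodZ _ sC)].
have [inc [x [Cx nCx]]] := Clt i ir; split.
  by move=> m s [qs [y ym Cy]]; split=> //; exists y => //; apply: inc.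
exists (pi x), 1; split; first by split=> //; exists x.
by case=> _ [y yx Cy]; apply: nCx; apply: (Ceq i y) => //; apply: ltnW.
Qed.

End LocalizedChains.

Definition frac_map (B : comNzRingType) (F : fieldType) (rho : {rmorphism B -> F}) :=
  forall z : F, exists a b, rho b != 0 /\ z = rho a / rho b.

Lemma clear_denominators (B : comNzRingType) (F : fieldType)
    (rho : {rmorphism B -> F}) (I : finType) (f : I -> F) : frac_map rho ->
  exists b g, rho b != 0 /\ forall i, rho (g i) = rho b * f i.
Proof.
move=> rhoP.
have [a aP] := boolp.choice (fun i => rhoP (f i)).
have [b bP] := boolp.choice aP.
exists (\prod_i b i), (fun i => a i * \prod_(j | j != i) b j); split.
  by rewrite rmorph_prod; apply/prodf_neq0 => i _; case: (bP i).
move=> i; have [bi0 ->] := bP i; rewrite [\prod_j b j](bigD1 i) //= !rmorphM /=.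
by rewrite [RHS]mulrAC [rho (b i) * (_ / _)]mulrC divfK.
Qed.

Lemma clear_denominators_mx (B : comNzRingType) (F : fieldType)
    (rho : {rmorphism B -> F}) m n (v : 'M[F]_(m, n)) : frac_map rho ->
  exists b w, rho b != 0 /\ map_mx rho w = rho b *: v.
Proof.
move=> rhoP.
have [b [g [b0 gE]]] := clear_denominators (fun ij : 'I_m * 'I_n => v ij.1 ij.2) rhoP.
exists b, (\matrix_(i, j) g (i, j)); split=> //.
by apply/matrixP => i j; rewrite !mxE gE.
Qed.

Section RowSpans.
Variables (B : idomainType) (q : B -> Prop).
Hypothesis q_prime : is_prime q.

Definition row_span m n (A : 'M[B]_(m, n)) (x : 'rV[B]_n) := exists w, x = w *m A.
Definition sat_span m n (A : 'M[B]_(m, n)) (x : 'rV[B]_n) :=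
  exists s, ~ q s /\ row_span A (s *: x).

Lemma q_mul s t : ~ q s -> ~ q t -> ~ q (s * t).
Proof. by case: q_prime => _ _ H qs qt /H[]. Qed.

Lemma sat_span_sat m n (A : 'M[B]_(m, n)) : sat_submod q (sat_span A).
Proof.
split.
- by exists 1; split; [case: q_prime | exists 0; rewrite scaler0 mul0mx].
- move=> a x y [s [qs [w E]]] [t [qt [v E']]]; exists (s * t); split; first exact: q_mul.
  exists ((a * t) *: w + s *: v); rewrite mulmxDl -!scalemxAl -E -E' scalerDr !scalerA.
  by congr (_ *: _ + _); rewrite mulrC [s * t]mulrC mulrA.
- by move=> s x qs [t [qt H]]; exists (t * s); rewrite -scalerA; split=> //; apply: q_mul.
Qed.

Lemma row_span_sat_span m n (A : 'M[B]_(m, n)) x : row_span A x -> sat_span A x.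
Proof. by move=> H; exists 1; rewrite scale1r; split=> //; case: q_prime. Qed.

Lemma row_span_sub m n (A : 'M[B]_(m, n)) W : sat_submod q W ->
  (forall x, row_span A x -> W x) -> forall x, sat_span A x -> W x.
Proof. by case=> _ _ Ws AW x [s [qs /AW]]; apply: Ws. Qed.

End RowSpans.

Section SquareLength.
Variables (B : idomainType) (p : B).
Hypothesis pp : prime_elt p.
Local Notation q := (principal p).

Lemma has_val_cancel x e : has_val p (x * p) e.+1 -> has_val p x e.
Proof.
case=> y E py; exists y => //; have p0 : p != 0 by case: pp.
by apply: (mulIf p0); rewrite E exprSr mulrA.
Qed.

Lemma row_replace_mul h (A : 'M[B]_h) (i : 'I_h) (z u : 'rV[B]_h) :
  u *m (\matrix_(a, b) if a == i then z 0 b else A a b)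
  = u 0 i *: z + (u - u 0 i *: delta_mx 0 i) *m A.
Proof.
apply/rowP => b; rewrite !mxE (bigD1 i) //= !mxE eqxx; congr (_ + _).
rewrite [RHS](bigD1 i) //= !mxE !eqxx mulr1 subrr mul0r add0r.
apply: eq_bigr => a ai; rewrite !mxE (negPf ai).
by rewrite andbF mulr0 subr0.
Qed.

(** Cramer's rule: the cofactors along row [i] do not involve that row, so they are common to [A]
    and the modified matrix. *)
Lemma row_replace_det h (A : 'M[B]_h) (i : 'I_h) (z w : 'rV[B]_h) (c : B) :
  w *m A = c *: z ->
  c * \det (\matrix_(a, b) if a == i then z 0 b else A a b) = w 0 i * \det A.
Proof.
move=> E; set A' := \matrix_(_, _) _.
have cofE j : cofactor A' i j = cofactor A i j.
  rewrite /cofactor; congr (_ * \det _); apply/matrixP => a b.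
  by rewrite !mxE eq_sym (negPf (neq_lift _ _)).
rewrite (expand_det_row _ i) big_distrr /=.
transitivity (((c *: z) *m \adj A) 0 i).
  by rewrite mxE; apply: eq_bigr => j _; rewrite cofE !mxE eqxx mulrA.
by rewrite -E -mulmxA mul_mx_adj mul_mx_scalar mxE mulrC.
Qed.

(** Induction on the valuation of the determinant. If [p] divides it, some combination of rows, with
    a coefficient at row [i] that is a unit at [p], equals [p] times a vector [z]. Replacing row [i]
    by [z] divides the determinant by [p] up to that unit, and enlarges the row span by one simple
    step, since p z was already in it. *)
Lemma square_series h (A : 'M[B]_h) v : has_val p (\det A) v ->
  exists C, [/\ composition_series q v C, forall x, C 0%N x <-> sat_span q A x
    & forall x, C v x].
Proof.
have [p0 q_prime] := pp.
elim: v A => [|v IH] A Av.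
  exists (fun _ => sat_span q A); split=> //.
    by split=> //; split=> // i _; apply: sat_span_sat.
  move=> x; exists (\det A); split; first exact/has_val0.
  by exists (x *m \adj A); rewrite -mulmxA mul_adj_mx mul_mx_scalar.
have [F [rho [rhoP rho_frac]]] := quot_field q_prime.
have detA0 : \det A != 0 := has_val_neq0 pp Av.
(* The vector [w] lifts, after clearing denominators, an element of the left kernel of [A] over the
   residue field. *)
have [w [z [i [wi wA]]]] : exists (w z : 'rV[B]_h) i, ~ q (w 0 i) /\ w *m A = p *: z.
  have : kermx (map_mx rho A) != 0.
    rewrite kermx_eq0 row_free_unit unitmxE unitfE negbK det_map_mx.
    by apply/eqP/rhoP; case: Av => y -> _; exists (y * p ^+ v); rewrite exprSr mulrA.
  case/rowV0Pn => u; move=> /sub_kermxP uA u0.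
  have [b [w [b0 wE]]] := clear_denominators_mx u rho_frac.
  have [i ui] : exists i, u 0 i != 0.
    apply: boolp.contrapT => nu; case/negP: u0; apply/eqP/rowP => i; rewrite mxE.
    by apply: boolp.contrapT => /eqP ui; apply: nu; exists i.
  have /boolp.choice[c cE] j : exists c, (w *m A) 0 j = c * p.
    apply/rhoP; have /rowP/(_ j) : map_mx rho (w *m A) = 0.
      by rewrite map_mxM wE -scalemxAl uA scaler0.
    by rewrite !mxE.
  exists w, (\row_j c j), i; split.
    move=> /rhoP; have /rowP/(_ i) := wE; rewrite !mxE => ->.
    by apply/eqP; rewrite mulf_neq0.
  by apply/rowP => j; rewrite cE !mxE mulrC.
set A' := \matrix_(a, b) if a == i then z 0 b else A a b.
have A'v : has_val p (\det A') v.
  apply: has_val_cancel; rewrite mulrC (row_replace_det i wA).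
  by rewrite -[v.+1]add0n; apply: has_valM => //; apply/has_val0.
have [C' [[[C'sat C'lt] C'simple] C'0 C'v]] := IH A' A'v.
have A'E u : u *m A' = u 0 i *: z + (u - u 0 i *: delta_mx 0 i) *m A.
  exact: row_replace_mul.
have sAA' x : sat_span q A x -> sat_span q A' x.
  case=> s [qs [u sx]]; exists (w 0 i * s); split; first exact: q_mul.
  exists ((u 0 i * p) *: delta_mx 0 i + (w 0 i *: u - u 0 i *: w)).
  rewrite A'E !mxE !eqxx mulr1 [u 0 i * w 0 i]mulrC subrr addr0.
  rewrite [X in X *m A]addrAC subrr add0r.
  by rewrite mulmxBl -!scalemxAl wA -sx !scalerA addrC subrK.
have zA' : row_span A' z.
  exists (delta_mx 0 i); rewrite A'E !mxE !eqxx !scale1r.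
  by rewrite subrr mul0mx addr0.
have nzA : ~ sat_span q A z.
  case=> s [qs [u E]].
  have su : s *: w = p *: u.
    have : (s *: w) *m A *m \adj A = (p *: u) *m A *m \adj A.
      by congr (_ *m _); rewrite -!scalemxAl wA -E !scalerA mulrC.
    rewrite -!mulmxA mul_mx_adj !mul_mx_scalar => /rowP H.
    by apply/rowP => j; apply: (mulfI detA0); have := H j; rewrite ![in X in X -> _]mxE ![in X in _ -> X]mxE.
  have /rowP/(_ i) := su; rewrite !mxE => H.
  by case: (q_mul q_prime qs wi); exists (u 0 i); rewrite H mulrC.
have pzA : row_span A (p *: z) by exists w.
exists (fun i => if i is j.+1 then C' j else sat_span q A); split=> //.
split; first split.
- by case=> [|j] jl; [apply: sat_span_sat | apply: C'sat].
- case=> [|j] jl; last exact: C'lt.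
  split=> [x /sAA' /C'0 //|]; exists z; split=> //.
  exact/C'0/row_span_sat_span.
- case=> [|j] jl; last exact: C'simple.
  move=> W Wsat AW WC.
  (* Either [W] contains [z] and is everything, or the coefficient of [z] in each element of [W] is
     a multiple of [p], and p z already belongs to the span of [A]. *)
  have [Wz|nWz] := boolp.EM (W z).
    right=> x /C'0; apply: (row_span_sub Wsat) => y [u ->]; rewrite A'E.
    apply: (sat_submodD Wsat); first exact: (sat_submodZ _ Wsat).
    by apply/AW/row_span_sat_span => //; eexists.
  left=> x Wx; have [s [qs [u E]]] := (C'0 x).1 (WC _ Wx).
  exists s; split=> //; rewrite E A'E.
  have Wu : W (u 0 i *: z).
    have -> : u 0 i *: z = s *: x - (u - u 0 i *: delta_mx 0 i) *m A by rewrite E A'E addrK.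
    apply: (sat_submodB Wsat); first exact: (sat_submodZ _ Wsat).
    by apply/AW/row_span_sat_span => //; eexists.
  have [[c ->]|nu] := boolp.EM (q (u 0 i)); last first.
    by case: nWz; case: Wsat => _ _ Ws; apply: Ws nu Wu.
  by rewrite -scalerA -wA scalemxAl -mulmxDl; eexists.
Qed.

Lemma square_length h (A : 'M[B]_h) v : has_val p (\det A) v ->
  chain_over q (row_span A) v /\ ~ chain_over q (row_span A) v.+1.
Proof.
have [p0 q_prime] := pp.
case/square_series => C [Cs C0 Cv]; apply: composition_length Cs _ _ Cv => //.
  by move=> x Ax; apply/C0/row_span_sat_span.
by move=> V Vs AV x /C0; apply: row_span_sub.
Qed.

(** The combinations given by [K] are zero on the [A] part and, since det(K T) is a unit at [p],
    span the whole [T] part locally. Hence the added columns do not change the localized cokernel,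
    while the matrix becomes square. *)
Lemma chain_over_row_mx m s (A : 'M[B]_(m + s, m)) (T : 'M[B]_(m + s, s))
    (K : 'M[B]_(s, m + s)) r : K *m A = 0 -> ~ q (\det (K *m T)) ->
  chain_over q (row_span A) r <-> chain_over q (row_span (row_mx A T)) r.
Proof.
move=> KA KT.
have AT0 W z : sat_submod q W -> (forall x, row_span (row_mx A T) x -> W x) ->
    W (row_mx 0 z).
  move=> sW ATW; have [_ _ Ws] := sW; apply: (Ws _ _ KT); apply: ATW.
  exists (z *m \adj (K *m T) *m K); rewrite mul_mx_row -!mulmxA KA !mulmx0.
  by rewrite [\adj _ *m _]mul_adj_mx mul_mx_scalar scale_row_mx scaler0.
split=> -[C [[Csat Clt] C0]].
  exists (fun i x => C i (lsubmx x)); split; last first.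
    by move=> x [w ->]; apply: C0; rewrite mul_mx_row row_mxKl; eexists.
  split=> i ir.
    have [W0 WD Ws] := Csat i ir; split.
    - by rewrite linear0.
    - by move=> a x y Wx Wy; rewrite linearP; apply: WD.
    - by move=> t x qt; rewrite linearZ; apply: Ws.
  have [inc [x [Cx nCx]]] := Clt i ir; split=> [y|]; first exact: inc.
  by exists (row_mx x 0); rewrite row_mxKl.
have ATC i x : (i <= r)%N -> row_span (row_mx A T) x -> C i x.
  by move=> ir /C0; apply: (sat_chain_incl (conj Csat Clt)).
have Clsub i x : (i <= r)%N -> C i x <-> C i (row_mx (lsubmx x) 0).
  move=> ir; have sC := Csat i ir.
  have E : x = row_mx (lsubmx x) 0 + row_mx 0 (rsubmx x).
    by rewrite add_row_mx addr0 add0r hsubmxK.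
  have C0z := AT0 _ (rsubmx x) sC (fun y => ATC i y ir).
  split=> Cx; last by rewrite E; apply: (sat_submodD sC).
  have -> : row_mx (lsubmx x) 0 = x - row_mx 0 (rsubmx x) by rewrite {2}E addrK.
  exact: (sat_submodB sC).
exists (fun i y => C i (row_mx y 0)); split; last first.
  move=> x [w ->]; have : C 0%N (w *m row_mx A T) by apply: C0; eexists.
  by rewrite mul_mx_row => /(Clsub _ _ (leq0n r)); rewrite row_mxKl.
split=> i ir.
  have [W0 WD Ws] := Csat i ir; split.
  - by rewrite row_mx0.
  - move=> a x y Wx Wy; have := WD a _ _ Wx Wy.
    by rewrite scale_row_mx add_row_mx scaler0 addr0.
  - by move=> t x qt H; apply: (Ws t) => //; rewrite scale_row_mx scaler0.
have [inc [x [Cx nCx]]] := Clt i ir; split=> [y|]; first exact: inc.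
exists (lsubmx x); split; first exact/(Clsub i.+1 x ir).
by move=> H; apply: nCx; apply/(Clsub i x (ltnW ir)).
Qed.

(** When [p] kills the cokernel, its localization is a vector space over the residue field, so its
    length is a dimension. The composition series extends the row space modulo [p] by one unit
    vector at a time. *)
Lemma corank_length m h (A : 'M[B]_(m, h)) (F : fieldType) (rho : {rmorphism B -> F}) :
  (forall b, rho b = 0 <-> q b) -> frac_map rho ->
  (forall x : 'rV_h, row_span A (p *: x)) ->
  chain_over q (row_span A) (h - \rank (map_mx rho A)) /\
  ~ chain_over q (row_span A) (h - \rank (map_mx rho A)).+1.
Proof.
have [p0 q_prime] := pp.
move=> rhoP rho_frac pA.
pose S k (U : 'M[F]_(k, h)) (x : 'rV[B]_h) : Prop := (map_mx rho x <= U)%MS.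
have Ssat k (U : 'M[F]_(k, h)) : sat_submod q (S k U).
  split; rewrite /S.
  - by rewrite map_mx0 sub0mx.
  - by move=> a x y Sx Sy; rewrite map_mxD map_mxZ addmx_sub // scalemx_sub.
  - move=> s x qs; rewrite map_mxZ => H.
    have s0 : rho s != 0 by apply/eqP => /rhoP.
    by rewrite -[map_mx rho x]scale1r -(mulVf s0) -scalerA scalemx_sub.
suff series r k (U : 'M[F]_(k, h)) : (h - \rank U = r)%N ->
    exists C, [/\ composition_series q r C, forall x, C 0%N x <-> S k U x
      & forall x, C r x].
  have [C [Cs C0 Cr]] := series _ _ _ (erefl (h - \rank (map_mx rho A))%N).
  apply: composition_length Cs _ _ Cr => // [x [w ->]|V Vs AV x /C0 Sx].
    by apply/C0; rewrite /S map_mxM submxMl.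
  have /submxP[u uE] := Sx.
  have [b [w [b0 wE]]] := clear_denominators_mx u rho_frac.
  have qb : ~ q b by move=> /rhoP/eqP; rewrite (negPf b0).
  have [_ _ Vsat] := Vs; apply: (Vsat b) => //.
  have /boolp.choice[c cE] j : exists c, (b *: x - w *m A) 0 j = c * p.
    apply/rhoP; have /rowP/(_ j) : map_mx rho (b *: x - w *m A) = 0.
      by rewrite map_mxB map_mxZ map_mxM wE uE -scalemxAl subrr.
    by rewrite !mxE.
  have -> : b *: x = p *: (\row_j c j) + w *m A.
    rewrite -[LHS](subrK (w *m A)); congr (_ + _); apply/rowP => j.
    by rewrite cE !mxE mulrC.
  by apply: (sat_submodD Vs); apply: AV => //; eexists.
elim: r k U => [|r IH] k U Ur.
  have fU : row_full U by rewrite /row_full eqn_leq rank_leq_col /= -subn_eq0 Ur.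
  exists (fun _ => S k U); split=> [|//|x]; last by rewrite /S submx_full.
  by split=> [|i]; [split=> [i _|i]; [exact: Ssat | rewrite ltn0] | rewrite ltn0].
have /row_subPn[i yU] : ~~ (1%:M <= U)%MS.
  rewrite sub1mx; apply/negP => /eqP H; by rewrite H subnn in Ur.
move: yU; rewrite rowE mulmx1; set y := delta_mx 0 i => yU.
pose y0 : 'rV[B]_h := delta_mx 0 i.
have y0E : map_mx rho y0 = y.
  by apply/rowP => j; rewrite !mxE; case: (_ && _); rewrite ?rmorph1 ?rmorph0.
have rUy : \rank (U + y)%MS = (\rank U).+1.
  apply/eqP; rewrite eqn_leq; apply/andP; split.
    apply: leq_trans (mxrank_adds_leqif _ _) _; rewrite -[leqRHS]addn1 leq_add2l.
    exact: rank_leq_row.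
  by rewrite ltn_neqAle mxrankS ?addsmxSl // andbT (mxrank_leqif_sup (addsmxSl _ _)) addsmx_sub submx_refl.
have hr : (h - \rank (U + y)%MS)%N = r by rewrite rUy subnS Ur.
have [C [[[Csat Clt] Csimple] C0 Cr]] := IH _ _ hr.
exists (fun i => if i is j.+1 then C j else S k U); split=> //.
split; first split.
- by case=> [|j] jl; [apply: Ssat | apply: Csat].
- case=> [|j] jl; last exact: Clt.
  split=> [x Sx|]; first by apply/C0/(submx_trans Sx)/addsmxSl.
  by exists y0; split; [apply/C0; rewrite /S y0E addsmxSr | rewrite /S y0E; apply/negP].
- case=> [|j] jl; last exact: Csimple.
  move=> W Wsat UW WC.
  have dec x : S _ (U + y)%MS x -> exists b a u, [/\ ~ q b, S k U u & b *: x = a *: y0 + u].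
    case/sub_addsmxP => -[u1 u2] /= E.
    have [b [a0 [b0 aE]]] := clear_denominators_mx u2 rho_frac.
    exists b, (a0 0 0), (b *: x - a0 0 0 *: y0); split.
    - by move=> /rhoP/eqP; rewrite (negPf b0).
    - rewrite /S map_mxB !map_mxZ y0E E scalerDr.
      rewrite scalemxAl [_ *: (u2 *m y)]scalemxAl -aE.
      rewrite [map_mx rho a0]mx11_scalar mul_scalar_mx mxE addrK.
      exact: submxMl.
    - by rewrite addrC subrK.
  have [Wy|nWy] := boolp.EM (W y0).
    right=> x /C0/dec[b [a [u [qb Su E]]]]; have [_ _ Ws] := Wsat.
    apply: (Ws b) => //; rewrite E; apply: (sat_submodD Wsat); last exact: UW.
    exact: (sat_submodZ _ Wsat).
  left=> x Wx; have /C0/dec[b [a [u [qb Su E]]]] := WC _ Wx.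
  have Wa : W (a *: y0).
    have -> : a *: y0 = b *: x - u by rewrite E addrK.
    by apply: (sat_submodB Wsat); [apply: (sat_submodZ _ Wsat) | apply: UW].
  have qa : q a by apply: boolp.contrapT => qa; case: nWy; case: Wsat => _ _ Ws; apply: Ws qa Wa.
  have [_ _ Ss] := Ssat k U; apply: (Ss b) => //; rewrite E /S map_mxD map_mxZ.
  by move/rhoP: qa => ->; rewrite scale0r add0r.
Qed.

End SquareLength.

(** * The Koszul complex in a fixed degree *)

Section GradedPieces.
Variables (n nu : nat).

(** The monomial basis of the degree [nu] part of the direct sum of the twists by -a_j. The bound on
    the monomials only makes this index type finite. *)
Definition piece (J : finType) (a : J -> nat) :=
  {x : J * 'X_{1..n < nu.+1} | (mdeg x.2 + a x.1 == nu)%N}.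

Section Vectors.
Variables (J : finType) (a : J -> nat) (R : comNzRingType).
Local Notation K := (piece a).

(** The homogeneous component of degree nu - b. The additive condition makes it 0 when b > nu, where
    truncated subtraction would give the constant term. *)
Definition pr (b : nat) (p : {mpoly R[n]}) : {mpoly R[n]} :=
  \sum_(m <- msupp p | (mdeg m + b == nu)%N) p@_m *: 'X_[m].

Lemma mcoeff_pr b p m : (pr b p)@_m = if (mdeg m + b == nu)%N then p@_m else 0.
Proof.
rewrite /pr raddf_sum /= -big_filter.
have [mp|mp] := boolP (m \in [seq m <- msupp p | (mdeg m + b == nu)%N]).
  rewrite (bigD1_seq m) ?filter_uniq ?msupp_uniq //= mcoeffZ mcoeffX eqxx mulr1.
  rewrite big1 ?addr0 => [|m' mm']; last by rewrite mcoeffZ mcoeffX (negPf mm') mulr0.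
  by move: mp; rewrite mem_filter => /andP[->].
rewrite big1_seq => [|m' /andP[_ m'p]]; last first.
  rewrite mcoeffZ mcoeffX; case: eqP => [E|]; last by rewrite mulr0.
  by rewrite -E m'p in mp.
move: mp; rewrite mem_filter negb_and; case: ifP => //= _.
by rewrite -mcoeff_eq0 => /eqP.
Qed.

Definition shomog b (p : {mpoly R[n]}) := forall m, m \in msupp p -> (mdeg m + b = nu)%N.

Lemma pr_id b p : shomog b p -> pr b p = p.
Proof.
move=> pb; apply/mpolyP => m; rewrite mcoeff_pr; case: eqP => // E.
by apply/esym/eqP; rewrite mcoeff_eq0; apply/negP => /pb.
Qed.

Lemma pr_is_additive b : additive (pr b).
Proof.
move=> p q; apply/mpolyP => m; rewrite mcoeffB !mcoeff_pr mcoeffB.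
by case: ifP; rewrite ?subr0.
Qed.
HB.instance Definition _ b := GRing.isAdditive.Build _ _ (pr b) (@pr_is_additive b).

Lemma pr_mul b c p q : (forall m, m \in msupp q -> (mdeg m + b = c)%N) ->
  pr b (p * q) = pr c p * q.
Proof.
move=> qd; apply/mpolyP => m; rewrite mcoeff_pr !mcoeffM.
have qE (k : 'X_{1..n < (mdeg m).+1, (mdeg m).+1}) :
    m == (k.1 + k.2)%MM -> q@_k.2 != 0 -> (mdeg k.1 + c = mdeg m + b)%N.
  move=> /eqP/(congr1 (@mdeg n)) Em; rewrite -mcoeff_msupp => /qd <-.
  by rewrite mdegD in Em; rewrite addnA -Em.
case: ifP => mb; first apply: eq_bigr => k Ek.
  rewrite mcoeff_pr; have [->|q0] := eqVneq q@_k.2 0; first by rewrite !mulr0.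
  by rewrite (qE k) // mb.
symmetry; apply: big1 => k Ek.
rewrite mcoeff_pr; have [->|q0] := eqVneq q@_k.2 0; first by rewrite !mulr0.
by rewrite (qE k) // mb mul0r.
Qed.

Definition pol (v : 'rV[R]_#|{: K}|) (j : J) : {mpoly R[n]} :=
  \sum_(x : K | (val x).1 == j) v 0 (enum_rank x) *: 'X_[(val x).2].

Definition vec (c : J -> {mpoly R[n]}) : 'rV[R]_#|{: K}| :=
  \row_(i < #|{: K}|) (c (val (enum_val i)).1)@_((val (enum_val i)).2).

Lemma vecE c (x : K) : vec c 0 (enum_rank x) = (c (val x).1)@_((val x).2).
Proof. by rewrite mxE enum_rankK. Qed.

Lemma mcoeff_pol v (x : K) : (pol v (val x).1)@_((val x).2) = v 0 (enum_rank x).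
Proof.
rewrite /pol raddf_sum /= (bigD1 x) //= mcoeffZ mcoeffX eqxx mulr1.
rewrite big1 ?addr0 // => y /andP[/eqP yx yNx]; rewrite mcoeffZ mcoeffX.
case: eqP => [E|]; last by rewrite mulr0.
case/eqP: yNx; apply: val_inj.
by rewrite [val y]surjective_pairing [val x]surjective_pairing yx; congr (_, _); apply: val_inj.
Qed.

Lemma polK v : vec (pol v) = v.
Proof.
by apply/rowP => i; rewrite -(enum_valK i) vecE mcoeff_pol.
Qed.

Lemma pol_shomog v j : shomog (a j) (pol v j).
Proof.
move=> m /msupp_sum_le /=; case/flattenP => /= s /mapP[x].
rewrite mem_filter => /andP[/eqP xj _] -> /msuppZ_le.
by rewrite msuppX inE => /eqP ->; rewrite -xj; apply/eqP; exact: (valP x).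
Qed.

Lemma vecK c j : pol (vec c) j = pr (a j) (c j).
Proof.
apply/mpolyP => m; rewrite mcoeff_pr; case: eqP => E; last first.
  by apply/eqP; rewrite mcoeff_eq0; apply/negP => /pol_shomog.
have mnu : (mdeg m < nu.+1)%N by rewrite ltnS -E leq_addr.
have xP : (mdeg (j, BMultinom mnu).2 + a (j, BMultinom mnu).1 == nu)%N by apply/eqP.
pose x : K := exist _ (j, BMultinom mnu) xP.
by have := mcoeff_pol (vec c) x; rewrite vecE.
Qed.

Lemma pol_is_additive v w j : pol (v - w) j = pol v j - pol w j.
Proof.
by rewrite /pol -sumrB; apply: eq_bigr => x _; rewrite !mxE scalerBl.
Qed.

Lemma polD v w j : pol (v + w) j = pol v j + pol w j.
Proof.
by rewrite /pol -big_split /=; apply: eq_bigr => x _; rewrite !mxE scalerDl.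
Qed.

Lemma polZ c v j : pol (c *: v) j = c *: pol v j.
Proof.
by rewrite /pol scaler_sumr; apply: eq_bigr => x _; rewrite !mxE scalerA.
Qed.

Lemma pol_inj v w : pol v =1 pol w -> v = w.
Proof. by move=> E; rewrite -[v]polK -[w]polK; apply/rowP => i; rewrite !mxE E. Qed.

Lemma pol0 j : pol 0 j = 0.
Proof. by rewrite -(subrr 0) pol_is_additive subrr. Qed.

Lemma pol_delta (x : K) j : pol (delta_mx 0 (enum_rank x)) j = ((val x).1 == j)%:R *: 'X_[(val x).2].
Proof.
rewrite /pol; case: eqP => [E|E]; last first.
  rewrite scale0r big1 // => y /eqP yj; rewrite !mxE eqxx (inj_eq enum_rank_inj).
  by case: eqP => [yx|]; [case: E; rewrite -yj yx | rewrite scale0r].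
rewrite (bigD1 x) ?E //= !mxE !eqxx big1 ?addr0 // => y /andP[_ /negPf yx].
by rewrite !mxE eqxx (inj_eq enum_rank_inj) yx scale0r.
Qed.

End Vectors.

Section Maps.
Variables (J1 J2 : finType) (a1 : J1 -> nat) (a2 : J2 -> nat) (R : comNzRingType).

(** Entry (i, j) has degree a1_i - a2_j, so that [G] is a map of degree 0 between sums of twists,
    acting on row vectors. *)
Definition graded (G : J1 -> J2 -> {mpoly R[n]}) :=
  forall i j m, m \in msupp (G i j) -> (mdeg m + a2 j = a1 i)%N.

Definition gmx (G : J1 -> J2 -> {mpoly R[n]}) :
    'M[R]_(#|{: piece a1}|, #|{: piece a2}|) :=
  \matrix_(x < #|{: piece a1}|, y < #|{: piece a2}|) ('X_[(val (enum_val x)).2] * G (val (enum_val x)).1 (val (enum_val y)).1)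
    @_((val (enum_val y)).2).

Lemma gmxE G v j : graded G ->
  pol (v *m gmx G) j = \sum_i pol v i * G i j.
Proof.
move=> Gh.
have -> : v *m gmx G = vec a2 (fun j => \sum_i pol v i * G i j).
  apply/rowP => y; rewrite !mxE raddf_sum /=.
  have E i : pol v i * G i (val (enum_val y)).1 =
    \sum_(x : piece a1 | (val x).1 == i) v 0 (enum_rank x) *: ('X_[(val x).2] * G (val x).1 (val (enum_val y)).1).
    by rewrite mulr_suml; apply: eq_bigr => x /eqP <-; rewrite -scalerAl.
  under [RHS]eq_bigr => i _ do rewrite E raddf_sum /=.
  rewrite (exchange_big_dep predT) //= [RHS](reindex (fun x : 'I_#|{: piece a1}| => enum_val x)) /=; last first.
    exact/onW_bij/enum_val_bij.
  apply: eq_bigr => x _; rewrite (big_pred1 (val (enum_val x)).1); last by move=> i; rewrite eq_sym.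
  by rewrite mcoeffZ enum_valK mxE.
rewrite vecK pr_id // => m; rewrite mcoeff_msupp raddf_sum /= => /eqP nz.
have [i Ei] : exists i, (pol v i * G i j)@_m != 0.
  apply: boolp.contrapT => H; apply: nz; apply: big1 => i _.
  by apply: boolp.contrapT => /eqP Hi; apply: H; exists i.
move: Ei; rewrite -mcoeff_msupp => /msuppM_le/allpairsP[[m1 m2] /= [/pol_shomog h1 /Gh h2 ->]].
by rewrite mdegD -addnA h2.
Qed.

End Maps.

Lemma gmx_mul0 (J1 J2 J3 : finType) (a1 : J1 -> nat) (a2 : J2 -> nat) (a3 : J3 -> nat)
    (R : comNzRingType) (G : J1 -> J2 -> {mpoly R[n]}) (H : J2 -> J3 -> {mpoly R[n]}) :
  graded a1 a2 G -> graded a2 a3 H ->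
  (forall i l, \sum_j G i j * H j l = 0) -> gmx a1 a2 G *m gmx a2 a3 H = 0.
Proof.
move=> Gg Hg GH; apply/row_matrixP => x; rewrite row0 row_mul rowE.
apply: pol_inj => l; rewrite pol0 gmxE //.
under eq_bigr => j _ do rewrite gmxE // mulr_suml.
rewrite exchange_big big1 //= => i _.
by under eq_bigr => j _ do rewrite -mulrA; rewrite -mulr_sumr GH mulr0.
Qed.

Lemma map_gmx (J1 J2 : finType) (a1 : J1 -> nat) (a2 : J2 -> nat) (R R' : comNzRingType)
    (f : {rmorphism R -> R'}) (G : J1 -> J2 -> {mpoly R[n]}) :
  map_mx f (gmx a1 a2 G) = gmx a1 a2 (fun i j => map_mpoly f (G i j)).
Proof.
apply/matrixP => x y; rewrite !mxE -(mcoeff_map_mpoly f); congr (_@__).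
by rewrite rmorphM /= map_mpolyX.
Qed.

End GradedPieces.

Lemma dhomog_supp (n : nat) (R : nzRingType) d (p : {mpoly R[n]}) m :
  p \is d.-homog -> m \in msupp p -> mdeg m = d.
Proof. by move/dhomogP; apply. Qed.

Section Counting.
Variables (n nu : nat).

Definition nmon (b : nat) := #|[pred m : 'X_{1..n < nu.+1} | (mdeg m + b == nu)%N]|.

Lemma card_piece (J : finType) (a : J -> nat) :
  #|{: piece n nu a}| = (\sum_j nmon (a j))%N.
Proof.
rewrite card_sub -sum1_card.
transitivity (\sum_(x : J * 'X_{1..n < nu.+1} | predT x.1 && (mdeg x.2 + a x.1 == nu)%N) 1)%N.
  exact: eq_bigl.
rewrite -(pair_big_dep predT (fun j (m : 'X_{1..n < nu.+1}) => (mdeg m + a j == nu)%N) (fun _ _ => 1%N)) /=.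
by apply: eq_bigr => j _; rewrite sum1_card.
Qed.

Lemma nmon_gt b : (nu < b)%N -> nmon b = 0%N.
Proof.
move=> nub; apply/eqP; rewrite -leqn0 -ltnS ltnS leqn0; apply/eqP/eq_card0 => m.
by rewrite !inE; apply/negP => /eqP E; move: nub; rewrite -E ltnNge leq_addl.
Qed.

End Counting.

Lemma nmon_le n nu b : (b <= nu)%N -> nmon n.+1 nu b = 'C(nu - b + n, n).
Proof.
move=> bnu; rewrite -bin_sub ?leq_addl // addnK -size_basis /nmon cardE -(size_map val).
apply/perm_size/uniq_perm.
- by rewrite map_inj_uniq ?enum_uniq //; exact: val_inj.
- exact: uniq_basis.
move=> m; rewrite -basis_cover; apply/mapP/eqP => [[m' + ->]|E].
  by rewrite mem_enum inE => /eqP E; rewrite -[LHS](addnK b); congr (_ - b)%N.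
have mnu : (mdeg m < nu.+1)%N by rewrite ltnS E leq_subr.
by exists (BMultinom mnu) => //; rewrite mem_enum inE /= E subnK.
Qed.

Lemma nmon2 nu b : (b <= nu.+1)%N -> nmon 2 nu b = (nu.+1 - b)%N.
Proof.
rewrite leq_eqVlt => /orP[/eqP->|]; first by rewrite nmon_gt ?subnn.
by rewrite ltnS => bnu; rewrite nmon_le // bin1 addn1 subSn.
Qed.

(** The binomial formula persists for b = nu + 1 and b = nu + 2, where both sides vanish, as [nmon2]
    does for b = nu + 1. The Euler characteristics below use this slack in full. *)
Lemma nmon3 nu b : (b <= nu.+2)%N -> nmon 3 nu b = 'C(nu.+2 - b, 2).
Proof.
case: (leqP b nu) => [bnu _|nub b2]; first by rewrite nmon_le // addn2 !subSn // ltnW.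
by rewrite nmon_gt // bin_small //; lia.
Qed.

Lemma bin2D x y : 'C(x + y, 2) = ('C(x, 2) + 'C(y, 2) + x * y)%N.
Proof.
elim: x => [|x IH]; first by rewrite add0n mul0n addn0.
by rewrite addSn !binS !bin1 IH mulSn; lia.
Qed.

Section Koszul.
Variables (n : nat) (mu : 'I_n -> nat).

Definition pairs := {ij : 'I_n * 'I_n | (ij.1 < ij.2)%N}.
Definition shift0 (_ : unit) := 0%N.
Definition shift2 (x : pairs) := (mu (val x).1 + mu (val x).2)%N.
Definition shift3 (_ : unit) := (\sum_i mu i)%N.

Variable R : comNzRingType.
Implicit Types L : 'I_n -> {mpoly R[n]}.

Definition koszul1 L (i : 'I_n) (_ : unit) : {mpoly R[n]} := L i.
Definition koszul2 L (x : pairs) (l : 'I_n) : {mpoly R[n]} :=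
  (l == (val x).1)%:R * L (val x).2 - (l == (val x).2)%:R * L (val x).1.

Definition homog_family L := forall i, L i \is (mu i).-homog.

Lemma graded_koszul1 L : homog_family L -> graded mu shift0 (koszul1 L).
Proof. by move=> Lh i [] m mL; rewrite /shift0 addn0; apply: (dhomog_supp (Lh i)). Qed.

Lemma graded_koszul2 L : homog_family L -> graded shift2 mu (koszul2 L).
Proof.
move=> Lh [[i j] /= ij] l m; rewrite /koszul2 /shift2 /=.
have ji : (i == j) = false by rewrite -val_eqE /= ltn_eqF.
have [->|li] := eqVneq l i.
  by rewrite ji mul1r mul0r subr0 => /(dhomog_supp (Lh j)) /= ->; rewrite addnC.
have [->|lj] := eqVneq l j; last by rewrite !mul0r subr0 msupp0.
by rewrite mul0r mul1r sub0r (perm_mem (msuppN _)); move/(dhomog_supp (Lh i)) => /= ->.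
Qed.

Lemma koszul21 L x : \sum_l koszul2 L x l * koszul1 L l tt = 0.
Proof.
rewrite /koszul2 /koszul1; under eq_bigr => l _ do rewrite mulrBl -!mulrA.
rewrite sumrB (bigD1 (val x).1) //= [X in _ - X](bigD1 (val x).2) //= !eqxx !mul1r.
rewrite !big1 ?addr0 1?[X in _ - X]mulrC ?subrr // => l /negPf ->; by rewrite mul0r.
Qed.

Variable nu : nat.
Definition Phi L := gmx nu mu shift0 (koszul1 L).
Definition Psi L := gmx nu shift2 mu (koszul2 L).

Lemma Psi_Phi L : homog_family L -> Psi L *m Phi L = 0.
Proof.
move=> Lh; apply: gmx_mul0; [exact: graded_koszul2|exact: graded_koszul1|].
by move=> x []; apply: koszul21.
Qed.

Lemma pol_Phi L v : homog_family L ->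
  pol (v *m Phi L) tt = \sum_i pol v i * L i.
Proof. by move=> Lh; rewrite gmxE //; apply: graded_koszul1. Qed.

End Koszul.

(** * Ranks of graded maps and Koszul complexes over a field *)

Section FieldExactness.
Variables (n nu : nat) (F : fieldType).

Section Exact.
Variables (J0 J1 J2 : finType) (a0 : J0 -> nat) (a1 : J1 -> nat) (a2 : J2 -> nat).
Variables (H : J0 -> J1 -> {mpoly F[n]}) (G : J1 -> J2 -> {mpoly F[n]}).
Hypotheses (Hg : graded a0 a1 H) (Gg : graded a1 a2 G).

Lemma gmx_inj :
  (forall g : J0 -> {mpoly F[n]}, (forall i, \sum_k g k * H k i = 0) -> forall k, g k = 0) ->
  \rank (gmx nu a0 a1 H) = #|{: piece n nu a0}|.
Proof.
move=> Hinj; apply/eqP; rewrite -/(row_free _) -kermx_eq0.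
apply/eqP/row_matrixP => r; rewrite row0.
have /sub_kermxP E := row_sub r (kermx (gmx nu a0 a1 H)).
apply: pol_inj => k; rewrite pol0; apply: Hinj => i.
by rewrite -(gmxE _ i Hg) E pol0.
Qed.

(** A preimage in the polynomial ring may be inhomogeneous; its components of the right degrees
    still give a preimage. Exactness thus descends to degree [nu], and rank plus nullity gives the
    formula. *)
Lemma gmx_exact :
  (forall k j, \sum_i H k i * G i j = 0) ->
  (forall c : J1 -> {mpoly F[n]}, (forall j, \sum_i c i * G i j = 0) ->
     exists g : J0 -> {mpoly F[n]}, forall i, c i = \sum_k g k * H k i) ->
  (\rank (gmx nu a1 a2 G) + \rank (gmx nu a0 a1 H) = #|{: piece n nu a1}|)%N.
Proof.
move=> HG ex; set A := gmx nu a1 a2 G; set C := gmx nu a0 a1 H.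
suff -> : \rank C = \rank (kermx A) by rewrite mxrank_ker subnKC ?rank_leq_row.
apply/eqmx_rank/andP; split.
  by apply/sub_kermxP; apply: gmx_mul0.
apply/row_subP => r; have /sub_kermxP E := row_sub r (kermx A).
set v := row r _ in E *.
have [|g gE] := ex (pol v); first by move=> j; rewrite -(gmxE _ j Gg) -/A E pol0.
apply/submxP; exists (vec nu a0 g); apply: pol_inj => i.
rewrite gmxE // -[LHS](pr_id (@pol_shomog _ _ _ _ _ v i)) gE raddf_sum /=.
by apply: eq_bigr => k _; rewrite vecK (@pr_mul n nu F (a1 i) (a0 k)) // => m; apply: Hg.
Qed.

End Exact.
End FieldExactness.

Definition o20 : 'I_2 := Ordinal (isT : (0 < 2)%N).
Definition o21 : 'I_2 := Ordinal (isT : (1 < 2)%N).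
Definition o30 : 'I_3 := Ordinal (isT : (0 < 3)%N).
Definition o31 : 'I_3 := Ordinal (isT : (1 < 3)%N).
Definition o32 : 'I_3 := Ordinal (isT : (2 < 3)%N).
Definition p2 : pairs 2 := exist (fun ij : 'I_2 * 'I_2 => (ij.1 < ij.2)%N) (o20, o21) isT.
Definition p01 : pairs 3 := exist (fun ij : 'I_3 * 'I_3 => (ij.1 < ij.2)%N) (o30, o31) isT.
Definition p02 : pairs 3 := exist (fun ij : 'I_3 * 'I_3 => (ij.1 < ij.2)%N) (o30, o32) isT.
Definition p12 : pairs 3 := exist (fun ij : 'I_3 * 'I_3 => (ij.1 < ij.2)%N) (o31, o32) isT.

Lemma ord2E (i : 'I_2) : i = o20 \/ i = o21.
Proof. by case: i => [[|[|//]] ?]; [left|right]; apply: val_inj. Qed.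

Lemma ord3E (i : 'I_3) : [\/ i = o30, i = o31 | i = o32].
Proof. by case: i => [[|[|[|//]]] ?]; [apply: Or31|apply: Or32|apply: Or33]; apply: val_inj. Qed.

Lemma pairs2E (x : pairs 2) : x = p2.
Proof.
apply: val_inj; case: x => [[i j] /=].
by case: (ord2E i) => ->; case: (ord2E j) => ->.
Qed.

Lemma pairs3E (x : pairs 3) : [\/ x = p01, x = p02 | x = p12].
Proof.
suff [E|E|E] : [\/ val x = val p01, val x = val p02 | val x = val p12].
- by apply: Or31; apply: val_inj.
- by apply: Or32; apply: val_inj.
- by apply: Or33; apply: val_inj.
case: x => [[i j] /=].
case: (ord3E i) => ->; case: (ord3E j) => -> //= _; by [apply: Or31|apply: Or32|apply: Or33].
Qed.

Section SmallBigops.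
Variables (V : Type) (idx : V) (op : Monoid.com_law idx).

Lemma big_ord2 (f : 'I_2 -> V) : \big[op/idx]_i f i = op (f o20) (f o21).
Proof.
rewrite (bigD1 o20) //= (bigD1 o21) //= big1 ?Monoid.mulm1 // => i.
by case: (ord2E i) => ->.
Qed.

Lemma big_ord3 (f : 'I_3 -> V) :
  \big[op/idx]_i f i = op (f o30) (op (f o31) (f o32)).
Proof.
rewrite (bigD1 o30) //= (bigD1 o31) //= (bigD1 o32) //= big1 ?Monoid.mulm1 // => i.
by case: (ord3E i) => ->.
Qed.

Lemma big_unit1 (f : unit -> V) : \big[op/idx]_i f i = f tt.
Proof. by rewrite (bigD1 tt) //= big1 ?Monoid.mulm1 // => -[]. Qed.

Lemma big_pairs2 (f : pairs 2 -> V) : \big[op/idx]_x f x = f p2.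
Proof.
by rewrite (bigD1 p2) //= big1 ?Monoid.mulm1 // => x; rewrite (pairs2E x).
Qed.

Lemma big_pairs3 (f : pairs 3 -> V) :
  \big[op/idx]_x f x = op (f p01) (op (f p02) (f p12)).
Proof.
rewrite (bigD1 p01) //= (bigD1 p02) //= (bigD1 p12) //= big1 ?Monoid.mulm1 // => x.
by case: (pairs3E x) => ->.
Qed.
End SmallBigops.

(** The Euler characteristic of the Koszul complex in degree [nu] is the Hilbert function of a
    complete intersection, which vanishes above the socle degree, the sum of the mu_i minus n. This
    is the origin of the bound on [nu]; [card_koszul3] is the same count in three variables. *)
Lemma card_koszul2 (mu : 'I_2 -> nat) nu : (\sum_i mu i < nu + 2)%N ->
  (#|{: piece 2 nu shift0}| + #|{: piece 2 nu (shift2 mu)}| = #|{: piece 2 nu mu}|)%N.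
Proof.
rewrite !card_piece => H; rewrite big_ord2 /= in H.
rewrite !(big_ord2, big_pairs2, big_unit1) /= /shift0 /shift2 /= !nmon2; lia.
Qed.

Lemma card_koszul3 (mu : 'I_3 -> nat) nu : (\sum_i mu i < nu + 3)%N ->
  (#|{: piece 3 nu shift0}| + #|{: piece 3 nu (shift2 mu)}| =
   #|{: piece 3 nu mu}| + #|{: piece 3 nu (shift3 mu)}|)%N.
Proof.
rewrite !card_piece => H; rewrite big_ord3 /= in H.
rewrite !(big_ord3, big_pairs3, big_unit1) /= /shift0 /shift2 /shift3 /= !big_ord3 /=.
move: (mu o30) (mu o31) (mu o32) H => a b c H.
rewrite !nmon3; try lia.
have [N EN] : exists N, nu.+2 = (N + a + b + c)%N by exists (nu.+2 - (a + b + c))%N; lia.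
rewrite EN.
have -> : (N + a + b + c - 0 = N + a + b + c)%N by lia.
have -> : (N + a + b + c - (a + b) = N + c)%N by lia.
have -> : (N + a + b + c - (a + c) = N + b)%N by lia.
have -> : (N + a + b + c - (b + c) = N + a)%N by lia.
have -> : (N + a + b + c - a = N + b + c)%N by lia.
have -> : (N + a + b + c - b = N + a + c)%N by lia.
have -> : (N + a + b + c - c = N + a + b)%N by lia.
have -> : (N + a + b + c - (a + (b + c)) = N)%N by lia.
rewrite !bin2D; lia.
Qed.

Lemma prime_X (F : fieldType) (n : nat) (v : 'I_n.+1) (p : {mpoly F[n.+1]}) :
  principal 'X_v p <-> (uni v p)`_0 = 0.
Proof.
split=> [[c ->]|p0]; first by rewrite rmorphM /= uniXv coefMX.
exists (multi v (drop_poly 1 (uni v p))).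
rewrite -[LHS](uniK v) -[X in multi v X](poly_take_drop 1) rmorphD rmorphM /= multiX.
rewrite (_ : take_poly 1 _ = 0) ?rmorph0 ?add0r //.
by apply/polyP => i; rewrite coef_take_poly coef0; case: i.
Qed.

Lemma prime_elt_X (F : fieldType) (n : nat) (v : 'I_n.+1) : prime_elt ('X_v : {mpoly F[n.+1]}).
Proof.
split; first by apply/eqP => /(congr1 (mcoeff U_(v)%MM))/eqP; rewrite mcoeff0 mcoeffXU eqxx oner_eq0.
split; first exact: principal_ideal.
  by move=> /prime_X; rewrite rmorph1 coefC /= => /eqP; rewrite oner_eq0.
move=> p q /prime_X; rewrite rmorphM /= coef0M => /eqP; rewrite mulf_eq0.
by case/orP => /eqP/prime_X; [left|right].
Qed.

Lemma prime_X_neq (F : fieldType) (n : nat) (v w : 'I_n.+1) : v != w ->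
  ~ principal ('X_v : {mpoly F[n.+1]}) 'X_w.
Proof.
move=> vw /prime_X; case: (unliftP v w) vw => [j -> _|->]; last by rewrite eqxx.
rewrite uniXl coefC /= => /(congr1 (mcoeff U_(j)%MM))/eqP.
by rewrite mcoeff0 mcoeffXU eqxx oner_eq0.
Qed.

Lemma prime_elt_dvdX (R : idomainType) (p x : R) N : prime_elt p ->
  principal p (x ^+ N) -> principal p x.
Proof.
move=> pp; elim: N => [|N IH]; first by rewrite expr0; case: pp => _ [_ + _] => H /H.
by rewrite exprS => /(prime_eltM pp)[].
Qed.

Lemma prime_eltX_cancel (R : idomainType) (p b y : R) N : prime_elt p -> ~ principal p b ->
  principal (p ^+ N) (b * y) -> principal (p ^+ N) y.
Proof.
move=> pp pb; elim: N y => [|N IH] y; first by exists y; rewrite expr0 mulr1.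
have p0 : p != 0 by case: pp.
move=> [c E]; have : principal p (b * y).
  by rewrite E exprSr; apply/principal_mull/principal_mull/principal_refl.
case/(prime_eltM pp) => // -[y' yE].
have [|d dE] := IH y'; last by exists d; rewrite yE dE -mulrA -exprSr.
by exists c; apply: (mulIf p0); rewrite -!mulrA -yE E exprSr.
Qed.

Lemma X_primary_coprime (F : fieldType) (n : nat) (J : Type) (L : J -> {mpoly F[n.+2]}) N :
  (forall p i, (forall j, principal p (L j)) -> principal p ('X_i ^+ N)) ->
  coprime_family L.
Proof.
move=> LX p pp pL.
have pX i : principal p 'X_i by apply: (prime_elt_dvdX (N := N) pp); apply: LX.
have [u uu E] := prime_elt_assoc pp (prime_elt_X _ ord0) (pX ord0).
apply: (@prime_X_neq F n.+1 ord0 (lift ord0 ord0)); first exact: neq_lift.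
apply: principal_trans (pX _); exists u^-1; by rewrite E mulKr.
Qed.

Section KoszulRanks.
Variable F : fieldType.

(** Weaker than [X_primary]: for n = 3 the forms may have common zeros, but no common curve. It is
    just enough to fix the rank of [Psi]. *)
Definition koszul_generic n (L : 'I_n -> {mpoly F[n]}) :=
  (exists i, L i != 0) /\ (n = 3%N -> coprime_family L).

Definition X_primary n (L : 'I_n -> {mpoly F[n]}) :=
  exists N, forall i, ideal_gen L ('X_i ^+ N).

Lemma X_primary_generic n (L : 'I_n.+2 -> {mpoly F[n.+2]}) : X_primary L ->
  (exists i, L i != 0) /\ coprime_family L.
Proof.
case=> N LN; split; last first.
  apply: (@X_primary_coprime F n _ L N) => p i pL; have [c ->] := LN i.
  by apply: principal_sum => j _; apply/principal_mull/pL.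
apply: boolp.contrapT => L0; have [c] := LN ord0; rewrite big1 => [|i _].
  have [X0 _] := prime_elt_X F (ord0 : 'I_n.+2).
  by move/eqP; rewrite expf_eq0 (negPf X0) andbF.
rewrite (_ : L i = 0) ?mulr0 //; apply: boolp.contrapT => Li.
by apply: L0; exists i; apply/eqP.
Qed.

Section Two.
Variables (mu : 'I_2 -> nat) (nu : nat) (L : 'I_2 -> {mpoly F[2]}).
Hypothesis Lh : homog_family mu L.

Lemma rank_Psi2 : (exists i, L i != 0) ->
  \rank (Psi mu nu L) = #|{: piece 2 nu (shift2 mu)}|.
Proof.
move=> [i Li]; apply: gmx_inj; first exact: graded_koszul2.
move=> g gL x; rewrite (pairs2E x).
have := gL o20; have := gL o21; rewrite !big_pairs2 /koszul2 /=.
rewrite !mul0r !mul1r sub0r subr0 mulrN => /eqP; rewrite oppr_eq0 => h1 /eqP h0.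
move: Li h0 h1; rewrite !mulf_eq0; case: (ord2E i) => -> /negPf ->; rewrite orbF.
  by move=> _ /eqP.
by move=> /eqP.
Qed.

Lemma koszul2_exact2 (c : 'I_2 -> {mpoly F[2]}) : X_primary L ->
  \sum_i c i * L i = 0 -> exists g, forall l, c l = g * koszul2 L p2 l.
Proof.
move=> /X_primary_generic[L0 Lcop]; rewrite big_ord2 /= => cL.
pose u (i : 'I_2) := if i == o20 then - c o21 else c o20.
have [|g gE] := coprime_family_prop (@ufd_mpoly F 2) (x := u) Lcop L0.
  move=> i j; case: (ord2E i) => ->; case: (ord2E j) => -> //; rewrite /u /= mulNr.
    by apply/eqP; rewrite eq_sym -addr_eq0 cL.
  by apply/eqP; rewrite -addr_eq0 cL.
exists g => l; case: (ord2E l) => ->; rewrite /koszul2 /= ?mul1r ?mul0r ?subr0 ?sub0r.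
  by rewrite -gE.
by rewrite mulrN -gE /u /= opprK.
Qed.

End Two.

Section Three.
Variables (mu : 'I_3 -> nat) (nu : nat) (L : 'I_3 -> {mpoly F[3]}).
Hypothesis Lh : homog_family mu L.

Definition koszul3 (_ : unit) (x : pairs 3) : {mpoly F[3]} :=
  if x == p01 then L o32 else if x == p02 then - L o31 else L o30.

Lemma graded_koszul3 : graded (shift3 mu) (shift2 mu) koszul3.
Proof.
move=> [] x m; rewrite /koszul3 /shift3 /shift2 big_ord3 /=.
by case: (pairs3E x) => -> /=; rewrite ?(perm_mem (msuppN _)) => /(dhomog_supp (Lh _)) ->; lia.
Qed.

Lemma koszul2_kernel (u : pairs 3 -> {mpoly F[3]}) : coprime_family L ->
  (exists i, L i != 0) -> (forall l, \sum_x u x * koszul2 L x l = 0) ->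
  exists g, [/\ u p01 = g * L o32, u p02 = - (g * L o31) & u p12 = g * L o30].
Proof.
move=> Lcop L0 uL.
have := uL o30; have := uL o31; have := uL o32; rewrite !big_pairs3 /koszul2 /=.
rewrite !(mul0r, mul1r, sub0r, subr0, subrr, mulr0, add0r, addr0) => e2 e1 e0.
pose U (i : 'I_3) := if i == o30 then u p12 else if i == o31 then - u p02 else u p01.
have [|g gE] := coprime_family_prop (@ufd_mpoly F 3) (x := U) Lcop L0.
  have E01 : u p12 * L o31 = - u p02 * L o30.
    by apply/eqP; rewrite -subr_eq0 -oppr_eq0 -e2; apply/eqP; ring.
  have E02 : u p12 * L o32 = u p01 * L o30.
    by apply/eqP; rewrite -subr_eq0 -e1; apply/eqP; ring.
  have E12 : - u p02 * L o32 = u p01 * L o31.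
    by apply/eqP; rewrite -subr_eq0 -oppr_eq0 -e0; apply/eqP; ring.
  by move=> i j; case: (ord3E i) => ->; case: (ord3E j) => ->; rewrite /U /=.
exists g; have g0 := gE o30; have g1 := gE o31; have g2 := gE o32.
by rewrite /U /= in g0 g1 g2; rewrite g0 g2 -g1 opprK.
Qed.

Lemma rank_Psi3 : coprime_family L -> (exists i, L i != 0) ->
  (\rank (Psi mu nu L) + #|{: piece 3 nu (shift3 mu)}| = #|{: piece 3 nu (shift2 mu)}|)%N.
Proof.
move=> Lcop L0.
rewrite -(@gmx_inj 3 nu F unit (pairs 3) (shift3 mu) (shift2 mu) koszul3 graded_koszul3).
  apply: gmx_exact; [exact: graded_koszul3|exact: graded_koszul2| |].
    move=> [] l; rewrite big_pairs3 /koszul3 /koszul2 /=.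
    by case: (ord3E l) => -> /=; ring.
  move=> c /(koszul2_kernel Lcop L0)[g [c01 c02 c12]].
  exists (fun=> g) => x; rewrite big_unit1 /koszul3.
  by case: (pairs3E x) => -> /=; rewrite ?mulrN.
move=> g gE []; have [i Li] := L0.
have := gE p01; have := gE p02; have := gE p12; rewrite !big_unit1 /koszul3 /=.
rewrite mulrN => /eqP + /eqP + /eqP; rewrite oppr_eq0 !mulf_eq0.
by case: (ord3E i) Li => -> /negPf ->; rewrite orbF => h1 h2 h3; apply/eqP.
Qed.

(** The operator [D] divides by the N-th power of the last variable and forgets the lower terms. It
    is additive and commutes with multiplication by the other two variables, so it can be applied to
    the relation. *)
Lemma X_power_regular N (w a b : {mpoly F[3]}) :
  w * 'X_o32 ^+ N = a * 'X_o30 ^+ N + b * 'X_o31 ^+ N ->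
  exists a' b', w = a' * 'X_o30 ^+ N + b' * 'X_o31 ^+ N.
Proof.
pose D (p : {mpoly F[3]}) := multi o32 (drop_poly N (uni o32 p)).
have o30E : o30 = lift o32 (Ordinal (isT : (0 < 2)%N)) by apply: val_inj.
have o31E : o31 = lift o32 (Ordinal (isT : (1 < 2)%N)) by apply: val_inj.
have DC p j : D (p * 'X_(lift o32 j) ^+ N) = D p * 'X_(lift o32 j) ^+ N.
  rewrite /D rmorphM rmorphXn /= uniXl -rmorphXn /=.
  have -> : drop_poly N (uni o32 p * ('X_j ^+ N)%:P) = drop_poly N (uni o32 p) * ('X_j ^+ N)%:P.
    by apply/polyP => i; rewrite coef_drop_poly !coefMC coef_drop_poly.
  by rewrite rmorphM /= multiC rmorphXn /= lift_varX.
have DD p q : D (p + q) = D p + D q.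
  by rewrite /D rmorphD /= raddfD /= rmorphD.
have DX p : D (p * 'X_o32 ^+ N) = p.
  by rewrite /D rmorphM rmorphXn /= uniXv drop_polyMXn_id uniK.
move=> /(congr1 D); rewrite DX DD o30E o31E !DC => ->.
by exists (D a), (D b).
Qed.

(** Powers of the variables lie in the ideal of the L_i, hence multiples of [c] by X_0^N and X_1^N
    are boundaries of some y_0 and y_1. Changing y_0 by a multiple of the last Koszul vector makes
    it divisible by X_0^N, and dividing gives a preimage of [c]. *)
Lemma koszul2_exact3 (c : 'I_3 -> {mpoly F[3]}) : X_primary L ->
  \sum_i c i * L i = 0 -> exists u : pairs 3 -> {mpoly F[3]},
    forall l, c l = \sum_x u x * koszul2 L x l.
Proof.
move=> LX; have [L0 Lcop] := X_primary_generic LX; case: LX => N LN.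
rewrite big_ord3 /= => cL.
pose B (y : pairs 3 -> {mpoly F[3]}) l := \sum_x y x * koszul2 L x l.
have BE y : [/\ B y o30 = y p01 * L o31 + y p02 * L o32,
    B y o31 = - (y p01 * L o30) + y p12 * L o32
  & B y o32 = - (y p02 * L o30) - y p12 * L o31].
  by rewrite /B !big_pairs3 /koszul2 /=; split; ring.
pose mk (a b d : {mpoly F[3]}) (x : pairs 3) := if x == p01 then a else if x == p02 then b else d.
(* Contraction with the coefficients of X_i^N in terms of the forms is a homotopy for multiplication
   by X_i^N. *)
have BX i : exists y, forall l, 'X_i ^+ N * c l = B y l.
  have [h hE] := LN i.
  exists (mk (- h o30 * c o31 + h o31 * c o30) (- h o30 * c o32 + h o32 * c o30)
             (- h o31 * c o32 + h o32 * c o31)) => l.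
  rewrite hE big_ord3 /=; set y := mk _ _ _; have [B0 B1 B2] := BE y.
  have cL0 : c o30 * L o30 = - (c o31 * L o31 + c o32 * L o32).
    by apply/eqP; rewrite -addr_eq0 cL.
  have z a : a * (c o30 * L o30 + (c o31 * L o31 + c o32 * L o32)) = 0 by rewrite cL mulr0.
  case: (ord3E l) => ->; rewrite ?B0 ?B1 ?B2 /y /mk /=; apply/eqP; rewrite -subr_eq0.
  - by rewrite -(z (h o30)); apply/eqP; ring.
  - by rewrite -(z (h o31)); apply/eqP; ring.
  - by rewrite -(z (h o32)); apply/eqP; ring.
have [y0 y0E] := BX o30; have [y1 y1E] := BX o31.
(* The cross difference of the two preimages is a cycle, hence [w] times the last Koszul vector. *)
have [|w [w01 w02 w12]] := koszul2_kernel (u := fun x => 'X_o31 ^+ N * y0 x - 'X_o30 ^+ N * y1 x) Lcop L0.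
  move=> l; under eq_bigr => x _ do rewrite mulrBl -!mulrA.
  by rewrite sumrB -!mulr_sumr -/(B y0 l) -/(B y1 l) -y0E -y1E mulrCA subrr.
have [h hE] := LN o32.
(* Expanding X_2^N in the forms puts w X_2^N in the ideal of X_0^N and X_1^N; regularity then does
   the same for [w]. *)
have [|e1 [e0 wE]] := @X_power_regular N w
   (- (h o30 * y1 p12) + h o31 * y1 p02 - h o32 * y1 p01)
   (h o30 * y0 p12 - h o31 * y0 p02 + h o32 * y0 p01).
  rewrite hE big_ord3 /= !mulrDr.
  rewrite !(mulrCA w) -w12 -w01 -[w * L o31]opprK -w02; ring.
pose ez (x : pairs 3) := mk (L o32) (- L o31) (L o30) x.
have ezB l : B ez l = 0.
  by have [B0 B1 B2] := BE ez; case: (ord3E l) => ->; rewrite ?B0 ?B1 ?B2 /ez /mk /=; ring.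
have X0pp := prime_elt_X F o30.
have X01 : ~ principal ('X_o30 : {mpoly F[3]}) ('X_o31 ^+ N).
  by move/(prime_elt_dvdX X0pp)/prime_X_neq; apply.
(* After multiplication by X_1^N the corrected vector is divisible by X_0^N, and X_1^N is prime to
   X_0. *)
have /boolp.choice[u uE] x : principal ('X_o30 ^+ N) (y0 x - e0 * ez x).
  apply: (prime_eltX_cancel X0pp X01).
  exists (y1 x + e1 * ez x); have Ex : 'X_o31 ^+ N * y0 x - 'X_o30 ^+ N * y1 x = w * ez x.
    by case: (pairs3E x) => ->; rewrite ?w01 ?w02 ?w12 /ez /mk /= ?mulrN.
  rewrite mulrBr; apply/eqP; rewrite -subr_eq0; apply/eqP.
  have -> : 'X_o31 ^+ N * y0 x = w * ez x + 'X_o30 ^+ N * y1 x by rewrite -Ex subrK.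
  by rewrite wE; ring.
exists u => l; have X0 : ('X_o30 : {mpoly F[3]}) ^+ N != 0 by rewrite expf_neq0 //; case: X0pp.
apply: (mulfI X0); rewrite y0E.
transitivity (B y0 l - e0 * B ez l); first by rewrite ezB mulr0 subr0.
rewrite /B !mulr_sumr -sumrB; apply: eq_bigr => x _.
by rewrite mulrA -mulrBl uE [_ * 'X_o30 ^+ N]mulrC mulrA.
Qed.

End Three.

Section TwoThree.
Variables (n : nat) (mu : 'I_n -> nat) (nu : nat) (L : 'I_n -> {mpoly F[n]}).
Hypotheses (n23 : n = 2%N \/ n = 3%N) (Lh : homog_family mu L).
Hypothesis nu_large : (\sum_i mu i < nu + n)%N.

Lemma rank_Psi : koszul_generic L ->
  (\rank (Psi mu nu L) + #|{: piece n nu shift0}| = #|{: piece n nu mu}|)%N.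
Proof.
case: n23 => E; subst n => -[L0 Lcop].
  by rewrite rank_Psi2 // addnC card_koszul2.
by have := card_koszul3 nu_large; have := rank_Psi3 nu Lh (Lcop erefl) L0; lia.
Qed.

Lemma rank_Phi : X_primary L ->
  \rank (Phi mu nu L) = #|{: piece n nu shift0}|.
Proof.
move=> LX.
suff E : (\rank (Phi mu nu L) + \rank (Psi mu nu L) = #|{: piece n nu mu}|)%N.
  have Lg : koszul_generic L.
    by case: (n23) => En; subst n; have [] := X_primary_generic LX.
  by have := rank_Psi Lg; lia.
apply: gmx_exact; [exact: graded_koszul2|exact: graded_koszul1|by move=> x []; apply: koszul21|].
case: n23 => En; subst n => c /(_ tt); last exact: koszul2_exact3.
by move=> /(koszul2_exact2 LX)[g gE]; exists (fun=> g) => l; rewrite big_pairs2.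
Qed.

End TwoThree.
End KoszulRanks.

(** * Complementary minors and the transfer of valuations *)

Definition row_det (R : comNzRingType) h0 s h1 (E : h1 = (h0 + s)%N)
  (A : 'M[R]_(h1, h0)) (S : 'M[R]_(h1, s)) := \det (castmx (E, erefl) (row_mx A S)).
Definition col_det (R : comNzRingType) h0 s h1 (E : h1 = (h0 + s)%N)
  (K : 'M[R]_(s, h1)) (T : 'M[R]_(h0, h1)) := \det (castmx (erefl, E) (col_mx T K)).

(** Stacking [T] over [K] and multiplying by [A] next to [S] gives a block triangular matrix,
    because K A = 0. When [S] selects columns of [K], [row_det] is up to sign the minor of [A] on
    the complementary rows. *)
Lemma det_complement (R : comNzRingType) h0 s h1 (E : h1 = (h0 + s)%N)
    (A : 'M[R]_(h1, h0)) (K : 'M[R]_(s, h1)) S T : K *m A = 0 ->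
  \det (T *m A) * \det (K *m S) = row_det E A S * col_det E K T.
Proof.
rewrite /row_det /col_det => KA; subst h1; rewrite !castmx_id.
by rewrite [RHS]mulrC -det_mulmx mul_col_row KA det_ublock.
Qed.

(** [T] is the upper block of the adjugate. The identity shows that the minor kills the cokernel of
    [A], hence that the resultant divides it. *)
Lemma row_det_mul (R : comNzRingType) h0 s h1 (E : h1 = (h0 + s)%N)
    (A : 'M[R]_(h1, h0)) (S : 'M[R]_(h1, s)) :
  exists T : 'M[R]_(h0, h1), T *m A = (row_det E A S)%:M.
Proof.
rewrite /row_det; subst h1; rewrite castmx_id.
have := mul_adj_mx (row_mx A S); rewrite -[\adj _]vsubmxK mul_col_mx mul_mx_row.
rewrite mul_mx_row scalar_mx_block /block_mx => /eq_col_mx[/eq_row_mx[TA _] _].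
by exists (usubmx (\adj (row_mx A S))).
Qed.

Lemma map_row_det (R R' : comNzRingType) (f : {rmorphism R -> R'}) h0 s h1
    (E : h1 = (h0 + s)%N) (A : 'M[R]_(h1, h0)) (S : 'M[R]_(h1, s)) :
  f (row_det E A S) = row_det E (map_mx f A) (map_mx f S).
Proof. by rewrite /row_det -det_map_mx map_castmx map_row_mx. Qed.

Lemma minor_ex (F : fieldType) m n (A : 'M[F]_(m, n)) :
  exists (f : 'I_(\rank A) -> 'I_m) (g : 'I_(\rank A) -> 'I_n),
    \det (mxsub f g A) != 0.
Proof.
pose A1 := rowsub (maxrankfun A) A.
have fA1 : row_full A1^T by rewrite /row_full mxrank_tr; apply: maxrowsub_free.
exists (maxrankfun A), (fullrankfun fA1).
rewrite -unitfE -unitmxE -unitmx_tr.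
suff <- : rowsub (fullrankfun fA1) A1^T = (mxsub (maxrankfun A) (fullrankfun fA1) A)^T.
  exact: fullrowsub_unit.
by apply/matrixP => a b; rewrite !mxE.
Qed.

Lemma chain_over_row_det (B : idomainType) (p : B) h0 s h1 (E : h1 = (h0 + s)%N)
    (A : 'M[B]_(h1, h0)) (S : 'M[B]_(h1, s)) (K : 'M[B]_(s, h1)) v :
  prime_elt p -> K *m A = 0 -> ~ principal p (\det (K *m S)) ->
  has_val p (row_det E A S) v ->
  chain_over (principal p) (row_span A) v /\ ~ chain_over (principal p) (row_span A) v.+1.
Proof.
move=> pp; rewrite /row_det => KA KS; subst h1.
rewrite castmx_id => /(square_length pp)[c nc].
by split; [apply/(chain_over_row_mx _ KA KS) | move/(chain_over_row_mx _ KA KS)].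
Qed.

(* By det_complement, row_det S and R divide each other up to factors that
   become units at p: the primality of R in C turns the two relations
   R^M det(K S) = row_det S * w and R c det(K S) = row_det S * w'
   into row_det S = R b with b dividing det(K S). *)
Lemma val_transfer (C B : idomainType) (phi : {rmorphism C -> B}) (r : C) (p : B)
    h0 s h1 (E : h1 = (h0 + s)%N) (A : 'M[C]_(h1, h0)) (K : 'M[C]_(s, h1))
    (S : 'M[C]_(h1, s)) v :
  prime_elt r -> prime_elt p -> K *m A = 0 ->
  (forall a (T : 'M_(h0, h1)), T *m A = a%:M -> principal r a) ->
  (exists (T : 'M_(h0, h1)) c, \det (T *m A) = c * r /\ ~ principal r c) ->
  (exists (I : finType) (T : I -> 'M_(h0, h1)) (c : I -> C) M,
     r ^+ M = \sum_i c i * \det (T i *m A)) ->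
  ~ principal p (phi (\det (K *m S))) ->
  has_val p (phi r) v -> has_val p (phi (row_det E A S)) v.
Proof.
move=> rp pp KA Aann [T2 [c [T2E rc]]] [I [T [d [M rM]]]] pKS rv.
have r0 : r != 0 by case: rp.
set a' := \det (K *m S) in pKS; set b' := row_det E A S.
have [b bE] : principal r b' by have [U /Aann] := row_det_mul E A S.
have phiP x y : principal x y -> principal (phi x) (phi y).
  by case=> z ->; exists (phi z); rewrite rmorphM.
have e1 : r ^+ M * a' = b' * \sum_i d i * col_det E K (T i).
  rewrite rM mulr_suml mulr_sumr; apply: eq_bigr => i _.
  by rewrite -mulrA (det_complement E _ _ KA) mulrCA.
(* If [r] divides det(K S), then its image is a unit at [p], and so is that of [row_det], which
   divides a power of [r] times det(K S). *)
have [ra'|ra'] := boolp.EM (principal r a').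
  have pr : ~ principal p (phi r) by move=> H; apply/pKS/(principal_trans H)/phiP.
  have v0 : v = 0%N by apply: (has_val_inj pp rv); apply/has_val0.
  rewrite v0; apply/has_val0 => pb'; have : principal p (phi (r ^+ M * a')).
    by rewrite e1 rmorphM; apply: principal_mulr.
  rewrite rmorphM rmorphXn => /(prime_eltM pp)[|//].
  by move/(prime_elt_dvdX pp).
have e2 : c * a' = b * col_det E K T2.
  apply: (mulIf r0); rewrite mulrAC -T2E (det_complement E _ _ KA) -/b' bE.
  by rewrite mulrAC.
have rb : ~ principal r b.
  move=> H; have : principal r (c * a') by rewrite e2; apply: principal_mulr.
  by case/(prime_eltM rp).
rewrite bE rmorphM mulrC -[v]addn0; apply: has_valM => //; apply/has_val0.
move=> pb; apply: pKS; apply: (principal_trans pb); apply: phiP.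
case: M e1 {rM} => [|M] e1.
  by case: ra'; rewrite -[a']mul1r -(expr0 r) e1 bE; apply/principal_mulr/principal_mull/principal_refl.
set w := \sum_i _ in e1.
have e3 : r ^+ M * a' = b * w.
  by apply: (mulIf r0); rewrite mulrAC -exprSr e1 bE mulrAC.
have [|w' wE] := prime_eltX_cancel (N := M) (y := w) rp rb.
  by rewrite -e3; apply/principal_mulr/principal_refl.
exists w'; have rM0 : r ^+ M != 0 by rewrite expf_neq0.
by apply: (mulfI rM0); rewrite e3 wE mulrA mulrC [b * w']mulrC.
Qed.

(** * Saturation by the irrelevant ideal *)

Section Saturation.
Variables (n : nat) (R : comNzRingType).
Implicit Types I : {mpoly R[n]} -> Prop.

Lemma ideal_gen_ideal r (g : 'I_r -> {mpoly R[n]}) : is_ideal (ideal_gen g).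
Proof.
split=> [|a x y [c ->] [d ->]].
  by exists (fun=> 0); rewrite big1 // => i _; rewrite mul0r.
exists (fun i => a * c i + d i); rewrite mulr_sumr -big_split /=.
by apply: eq_bigr => i _; rewrite mulrDl mulrA.
Qed.

Lemma ideal_gen_gen r (g : 'I_r -> {mpoly R[n]}) i : ideal_gen g (g i).
Proof.
exists (fun k => (k == i)%:R); rewrite (bigD1 i) //= eqxx mul1r.
by rewrite big1 ?addr0 // => k /negPf ->; rewrite mul0r.
Qed.

Lemma ideal_sum (W : comNzRingType) (I : W -> Prop) (J : Type) (s : seq J) (P : pred J) (F : J -> W) :
  is_ideal I -> (forall i, P i -> I (F i)) -> I (\sum_(i <- s | P i) F i).
Proof.
move=> [I0 ID] H; apply: (big_ind I) => // x y Ix Iy.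
by rewrite -[x]mul1r; apply: ID.
Qed.

Lemma ideal_mull (W : comNzRingType) (I : W -> Prop) a x : is_ideal I -> I x -> I (a * x).
Proof. by case=> I0 ID Ix; rewrite -[_ * _]addr0; apply: ID. Qed.

Lemma ideal_exp_monomial (m : 'X_{1..n}) : ideal_exp (@irrelevant n R) (mdeg m) 'X_[m].
Proof.
move Ed : (mdeg m) => d; elim: d m Ed => [//|d IH] m Ed.
have [i mi] : exists i, m i != 0%N.
  apply: boolp.contrapT => H; have : mdeg m = 0%N; last by rewrite Ed.
  by rewrite mdegE big1 // => i _; apply: boolp.contrapT => /eqP mi; apply: H; exists i.
have mE : m = (U_(i) + (m - U_(i)))%MM by rewrite addmC submK // lep1mP.
exists 1%N, (fun=> 'X_i), (fun=> 'X_[m - U_(i)]); split=> [j|]; last first.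
  by rewrite big_ord1 -mpolyXD -mE.
split; last by apply: IH; have := congr1 (@mdeg n) mE; rewrite mdegD mdeg1 Ed => -[].
exists (fun k => (k == i)%:R); rewrite (bigD1 i) //= eqxx mul1r big1 ?addr0 // => k /negPf ->.
by rewrite mul0r.
Qed.

Lemma ideal_exp_sub I N x : is_ideal I ->
  (forall m, mdeg m = N -> I 'X_[m]) -> ideal_exp (@irrelevant n R) N x -> I x.
Proof.
elim: N I x => [|N IH] I x Iid IX.
  move=> _; rewrite -[x]mulr1 -mpolyX0; apply: ideal_mull => //.
  by apply: IX; rewrite mdeg0.
case=> r [a [b [ab ->]]]; apply: ideal_sum => // i _; have [[c ->] bi] := ab i.
rewrite mulr_suml; apply: ideal_sum => // j _; rewrite -mulrA; apply: ideal_mull => //.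
apply: (IH (fun y => I ('X_j * y))) bi => [|m Nm].
  split; first by rewrite mulr0; case: Iid.
  by move=> u y z Iy Iz; rewrite mulrDr mulrCA; case: Iid => _; apply.
by rewrite -mpolyXD; apply: IX; rewrite mdegD mdeg1 Nm.
Qed.

Lemma saturationP I a : is_ideal I ->
  saturation I a <-> exists N, forall m, mdeg m = N -> I (a * 'X_[m]).
Proof.
move=> Iid; split=> -[N H]; exists N; first by move=> m mN; apply/H; rewrite -mN; apply: ideal_exp_monomial.
move=> x; apply: (ideal_exp_sub (I := fun y => I (a * y))) => //.
split; first by rewrite mulr0; case: Iid.
by move=> u y z Iy Iz; rewrite mulrDr mulrCA; case: Iid => _; apply.
Qed.

(** A monomial whose degree exceeds the sum of the exponents N_i is divisible by some X_i^N_i. *)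
Lemma saturation_X I a : is_ideal I -> (forall i, exists N, I ('X_i ^+ N * a)) ->
  saturation I a.
Proof.
move=> Iid /boolp.choice[N NX]; apply/saturationP => //.
exists (\sum_i N i).+1 => m mE.
have [i Ni] : exists i, (N i <= m i)%N.
  apply: boolp.contrapT => H; have : (mdeg m <= \sum_i N i)%N.
    rewrite mdegE; apply: leq_sum => i _; rewrite leqNgt; apply/negP => /ltnW Nm.
    by apply: H; exists i.
  by rewrite mE ltnn.
have -> : m = ((m - U_(i) *+ N i) + U_(i) *+ N i)%MM.
  rewrite submK //; apply/mnm_lepP => j; rewrite mulmnE mnm1E.
  by case: eqP => [<-|_]; rewrite ?mul1n ?mul0n.
rewrite mpolyXD mulrCA -mpolyXn [a * _]mulrC.
exact: ideal_mull.
Qed.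

End Saturation.

(** * The generic resultant *)

Section GenericForms.
Variables (n : nat) (mu : 'I_n -> nat).
Local Notation C := (coef_ring mu).
Local Notation P := (@generic_form n mu).

Definition spec (R : comNzRingType) (F : 'I_n -> {mpoly R[n]}) : {rmorphism C -> R} :=
  mmap (intr : int -> R)
    (fun v : 'I_#|{: coef_index mu}| => let x := val (enum_val v) in (F x.1)@_(x.2)).

Lemma specE (R : comNzRingType) (F : 'I_n -> {mpoly R[n]}) r : spec F r = specialize F r.
Proof. by []. Qed.

Lemma specX (R : comNzRingType) (F : 'I_n -> {mpoly R[n]}) (x : coef_index mu) :
  spec F 'X_(enum_rank x) = (F (val x).1)@_((val x).2).
Proof. by rewrite /spec /= mmapX mmap1U enum_rankK. Qed.

Lemma generic_form_homog : homog_family mu P.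
Proof.
move=> i; rewrite /generic_form; apply: rpred_sum => x /eqP <-.
by apply: rpredZ; rewrite dhomogX; exact: (valP x).
Qed.

Lemma coef_indexP (i : 'I_n) (m : 'X_{1..n}) : mdeg m = mu i ->
  exists x : coef_index mu, (val x).1 = i /\ (val x).2 = m :> 'X_{1..n}.
Proof.
move=> E; have mb : (mdeg m < (\max_j mu j).+1)%N by rewrite ltnS E leq_bigmax.
have xP : (mdeg (i, BMultinom mb).2 == mu (i, BMultinom mb).1)%N by apply/eqP.
by exists (exist _ (i, BMultinom mb) xP).
Qed.

Lemma coef_index_inj (x y : coef_index mu) : (val x).1 = (val y).1 ->
  (val x).2 = (val y).2 :> 'X_{1..n} -> x = y.
Proof.
move=> e1 e2; apply: val_inj; rewrite [val x]surjective_pairing [val y]surjective_pairing e1.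
by congr (_, _); apply: val_inj.
Qed.

Lemma map_generic_form (R : comNzRingType) (F : 'I_n -> {mpoly R[n]}) i :
  homog_family mu F -> map_mpoly (spec F) (P i) = F i.
Proof.
move=> Fh; rewrite /generic_form rmorph_sum /=; apply/mpolyP => m.
have [E|E] := eqVneq (mdeg m) (mu i); last first.
  rewrite [RHS]memN_msupp_eq0; last by apply/negP => /(dhomog_supp (Fh i)) /eqP; apply/negP.
  rewrite raddf_sum /= big1 // => x /eqP xi.
  rewrite map_mpolyZ map_mpolyX mcoeffZ mcoeffX; case: eqP => [xm|]; last by rewrite mulr0.
  by case/eqP: E; rewrite -xm -xi; apply/eqP/(valP x).
have [x [xi xm]] := coef_indexP E.
rewrite raddf_sum /= (bigD1 x) /=; last by rewrite xi.
rewrite map_mpolyZ map_mpolyX mcoeffZ mcoeffX xm eqxx mulr1 specX xi xm.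
rewrite big1 ?addr0 // => y /andP[/eqP yi yx].
rewrite map_mpolyZ map_mpolyX mcoeffZ mcoeffX; case: eqP => [ym|]; last by rewrite mulr0.
by case/eqP: yx; apply: coef_index_inj; rewrite ?xi ?xm.
Qed.

End GenericForms.

Lemma mpoly_subring_ind (n : nat) (R : comNzRingType) (Q : {mpoly R[n]} -> Prop) :
  (forall c, Q c%:MP) -> (forall i, Q 'X_i) -> (forall p q, Q p -> Q q -> Q (p + q)) ->
  (forall p q, Q p -> Q q -> Q (p * q)) -> forall p, Q p.
Proof.
move=> QC QX QD QM p; rewrite (mpolyE p); apply: (big_ind Q) => //.
  by rewrite -mpolyC0.
move=> m _; rewrite -mul_mpolyC; apply: (QM) => //.
rewrite mpolyXE_id; apply: (big_ind Q) => [|//|i _]; first by rewrite -mpolyC1.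
elim: (m i) => [|k IH]; first by rewrite expr0 -mpolyC1.
by rewrite exprS; apply: (QM).
Qed.

Lemma rmorph_monomial (n : nat) (R : comNzRingType) (S : comNzRingType)
    (f g : {rmorphism {mpoly R[n]} -> S}) m :
  (forall i, f 'X_i = g 'X_i) -> f 'X_[m] = g 'X_[m].
Proof.
move=> fg; rewrite mpolyXE_id !rmorph_prod; apply: eq_bigr => i _.
by rewrite !rmorphXn fg.
Qed.

Lemma mpolyX_neq0 (n : nat) (R : nzRingType) (m : 'X_{1..n}) :
  'X_[m] != 0 :> {mpoly R[n]}.
Proof.
apply/eqP => /(congr1 (mcoeff m))/eqP.
by rewrite mcoeffX eqxx mcoeff0 oner_eq0.
Qed.

Section LiftModuloIdeal.
Variables (W E : comNzRingType) (th tf : {rmorphism W -> E}) (I : W -> Prop) (s : W).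
Hypothesis I_ideal : is_ideal I.

(** Up to a power of [s], the element [a] is congruent modulo [I] to some [y] for which tf(y)
    computes the image of [a]. Once [tf] is injective, th(a) = 0 forces y = 0 and puts a multiple of
    [a] by a power of [s] in [I]. *)
Definition lifts a := exists N y, th a * tf (s ^+ N) = tf y /\ I (s ^+ N * a - y).

Lemma liftsD a b : lifts a -> lifts b -> lifts (a + b).
Proof.
move=> [N [y [e1 i1]]] [M [z [e2 i2]]].
exists (N + M)%N, (s ^+ M * y + s ^+ N * z); split.
  by rewrite rmorphD exprD !rmorphM rmorphD !rmorphM -e1 -e2; ring.
have -> : s ^+ (N + M) * (a + b) - (s ^+ M * y + s ^+ N * z) =
   s ^+ M * (s ^+ N * a - y) + s ^+ N * (s ^+ M * b - z) by rewrite exprD; ring.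
by case: (I_ideal) => _; apply=> //; apply: ideal_mull.
Qed.

Lemma liftsM a b : lifts a -> lifts b -> lifts (a * b).
Proof.
move=> [N [y [e1 i1]]] [M [z [e2 i2]]].
exists (N + M)%N, (y * z); split; first by rewrite exprD !rmorphM -e1 -e2; ring.
have -> : s ^+ (N + M) * (a * b) - y * z =
   (s ^+ M * b) * (s ^+ N * a - y) + y * (s ^+ M * b - z) by rewrite exprD; ring.
by case: (I_ideal) => _; apply=> //; apply: ideal_mull.
Qed.

Lemma lifts_id a : th a = tf a -> lifts a.
Proof.
move=> e; exists 0%N, a; rewrite expr0 rmorph1 mulr1 mul1r subrr; split=> //.
by case: I_ideal.
Qed.

End LiftModuloIdeal.

(* Solving P_i = 0 for the coefficient of X_v^(mu i) embeds the quotient of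
   C[X] by the saturation of (P_1, ..., P_n) into a field containing C[X]. *)
Section EliminationIdeal.
Variables (n : nat) (mu : 'I_n -> nat).
Local Notation C := (coef_ring mu).
Local Notation P := (@generic_form n mu).
Variables (E : fieldType) (tf : {rmorphism {mpoly C[n]} -> E}).
Hypothesis tf_inj : forall x, tf x = 0 -> x = 0.

Section Variable_v.
Variable v : 'I_n.

Definition pivot (x : coef_index mu) := (val x).2 == (U_(v) *+ mu (val x).1)%MM :> 'X_{1..n}.
Definition rest (i : 'I_n) : {mpoly C[n]} :=
  \sum_(y : coef_index mu | ((val y).1 == i) && ~~ pivot y)
     ('X_(enum_rank y) : C) *: 'X_[(val y).2].
Definition solve (k : 'I_#|{: coef_index mu}|) : E :=
  let x := enum_val k in
  if pivot x then - tf (rest (val x).1) / tf ('X_v ^+ mu (val x).1)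
  else tf ('X_k : C)%:MP.
Definition solveC : {rmorphism C -> E} := mmap (intr : int -> E) solve.
Definition theta : {rmorphism {mpoly C[n]} -> E} := mmap solveC (fun i => tf 'X_i).

Lemma thetaX i : theta 'X_i = tf 'X_i.
Proof. by rewrite /theta /= mmapX mmap1U. Qed.

Lemma theta_Xm m : theta 'X_[m] = tf 'X_[m].
Proof. by apply: rmorph_monomial => i; apply: thetaX. Qed.

Lemma thetaU (x : coef_index mu) : theta ('X_(enum_rank x) : C)%:MP = solve (enum_rank x).
Proof. by rewrite /theta /= mmapC /= mmapX mmap1U. Qed.

Lemma Xv_neq0 N : tf ('X_v ^+ N : {mpoly C[n]}) != 0.
Proof.
by apply/eqP => /tf_inj/eqP; rewrite mpolyXn (negPf (mpolyX_neq0 _ _)).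
Qed.

Lemma generic_form_split i : exists x : coef_index mu,
  [/\ (val x).1 = i, pivot x & P i = ('X_(enum_rank x) : C) *: 'X_v ^+ mu i + rest i].
Proof.
have [|x [xi xm]] := @coef_indexP n mu i (U_(v) *+ mu i)%MM.
  by rewrite mdegMn mdeg1 mul1n.
have px : pivot x by rewrite /pivot xi xm.
exists x; split=> //; rewrite /generic_form (bigD1 x) ?xi //= xm -mpolyXn; congr (_ + _).
apply: eq_bigl => y; case: eqP => //= yi; congr (~~ _); apply/eqP/idP => [-> //|/eqP py].
by apply: coef_index_inj; rewrite ?yi ?xi // py yi xm.
Qed.

Lemma thetaZ (c : C) p : theta (c *: p) = theta c%:MP * theta p.
Proof. by rewrite -mul_mpolyC rmorphM. Qed.

Lemma theta_rest i : theta (rest i) = tf (rest i).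
Proof.
rewrite /rest !rmorph_sum; apply: eq_bigr => y /andP[yi py].
by rewrite thetaZ thetaU theta_Xm /solve enum_rankK (negPf py) -rmorphM mul_mpolyC.
Qed.

Lemma theta_generic_form i : theta (P i) = 0.
Proof.
have [x [xi px ->]] := generic_form_split i.
rewrite rmorphD thetaZ thetaU theta_rest rmorphXn thetaX -rmorphXn.
by rewrite /solve enum_rankK px xi divfK ?Xv_neq0 // addNr.
Qed.

Lemma theta_ideal x : ideal_gen P x -> theta x = 0.
Proof.
case=> c ->; rewrite rmorph_sum; apply: big1 => i _.
by rewrite rmorphM theta_generic_form mulr0.
Qed.

Lemma theta_lift x : lifts theta tf (ideal_gen P) 'X_v x.
Proof.
have Pid := ideal_gen_ideal P.
move: x; apply: mpoly_subring_ind => [|i|p q|p q]; last 2 first.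
- exact: liftsD.
- exact: liftsM.
- have QU (x : coef_index mu) : lifts theta tf (ideal_gen P) 'X_v ('X_(enum_rank x) : C)%:MP.
    have [px|px] := boolP (pivot x); last first.
      by apply: lifts_id => //; rewrite thetaU /solve enum_rankK (negPf px).
    have [x' [xi px' PE]] := generic_form_split (val x).1.
    have xx : x' = x by apply: coef_index_inj => //; rewrite (eqP px) (eqP px') xi.
    exists (mu (val x).1), (- rest (val x).1); split.
      by rewrite thetaU /solve enum_rankK px divfK ?Xv_neq0 // rmorphN.
    have -> : 'X_v ^+ mu (val x).1 * ('X_(enum_rank x) : C)%:MP - (- rest (val x).1) = P (val x).1.
      by rewrite PE xx opprK mulrC mul_mpolyC.
    exact: ideal_gen_gen.
  apply: mpoly_subring_ind => [c|k|a b|a b].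
  + have -> : (c%:MP : C)%:MP = c%:~R :> {mpoly C[n]}.
      by rewrite -[c in LHS]intz !rmorph_int.
    by apply: lifts_id => //; rewrite !rmorph_int.
  + by rewrite -[k]enum_valK; apply: QU.
  + by rewrite rmorphD; apply: liftsD.
  + by rewrite rmorphM; apply: liftsM.
- by apply: lifts_id => //; apply: thetaX.
Qed.

Lemma theta_kernel x : theta x = 0 -> exists N, ideal_gen P ('X_v ^+ N * x).
Proof.
move=> x0; have [N [y [e1 i1]]] := theta_lift x; exists N.
suff y0 : y = 0 by rewrite y0 subr0 in i1.
by apply: tf_inj; rewrite -e1 x0 mul0r.
Qed.

End Variable_v.

(** The kernel of [theta v] does not depend on [v]: every other [theta w] kills some X_v^N x and
    sends X_v to a nonzero element of the field. So [x] is killed by powers of all variables modulo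
    the ideal. *)
Lemma saturation_theta v x : saturation (ideal_gen P) x <-> theta v x = 0.
Proof.
have Pid := ideal_gen_ideal P.
split=> [/(saturationP _ Pid)[N /(_ (U_(v) *+ N)%MM)]|x0].
  rewrite mdegMn mdeg1 mul1n => /(_ erefl)/(theta_ideal v).
  rewrite rmorphM -mpolyXn rmorphXn thetaX -rmorphXn => /eqP; rewrite mulf_eq0 (negPf (Xv_neq0 v N)) orbF.
  by move/eqP.
apply: saturation_X => // w; have [N xN] := theta_kernel x0.
have := theta_ideal w xN; rewrite rmorphM rmorphXn thetaX -rmorphXn => /eqP.
by rewrite mulf_eq0 (negPf (Xv_neq0 v N)) /= => /eqP/theta_kernel.
Qed.

(** The elimination ideal is the kernel of a morphism to a field, hence prime; the normalization of
    the resultant excludes r = 0. *)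
Lemma resultant_prime (v : 'I_n) (r : C) : is_generic_resultant r -> prime_elt r.
Proof.
case=> satr specr.
have rP a : principal r a <-> theta v a%:MP = 0.
  by rewrite -satr -saturation_theta.
split.
  apply/eqP => r0; have : spec mu (fun i => 'X_i ^+ mu i : {mpoly int[n]}) r = 1 by [].
  by rewrite r0 rmorph0 => /eqP; rewrite eq_sym oner_eq0.
split; first exact: principal_ideal.
  by move/rP; rewrite rmorph1 => /eqP; rewrite oner_eq0.
move=> a b /rP; rewrite !rmorphM => /eqP; rewrite mulf_eq0.
by case/orP => /eqP/rP; [left|right].
Qed.

End EliminationIdeal.

(** * Forms over the integers in one parameter t with a minor equal to t *)

Section MonomialExample.
Variables (W : comNzRingType) (K : W -> Prop) (t x y z : W).
Hypothesis K_ideal : is_ideal K.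

Let KD u v : K u -> K v -> K (u + v).
Proof. by move=> Ku Kv; rewrite -[u]mul1r; apply: K_ideal.2. Qed.
Let KN u : K u -> K (- u).
Proof. by rewrite -mulN1r; apply: ideal_mull. Qed.
Let KM u v : K v -> K (u * v). Proof. exact: ideal_mull. Qed.

(** A monomial divisible by y x^b is in [K]. Otherwise i < b forces a large power of y, and y^(a+1)
    may be replaced by -t x^(a+1), keeping the degree and lowering the power of y. *)
Lemma example2_monomial a b i j : K (t * x ^+ a.+1 + y ^+ a.+1) -> K (y * x ^+ b) ->
  (a + b + 1 <= i + j)%N -> (0 < j)%N -> K (x ^+ i * y ^+ j).
Proof.
move=> K0 K1; elim/ltn_ind: j i => j IH i le j0.
have [bi|ib] := leqP b i.
  have -> : x ^+ i * y ^+ j = (x ^+ (i - b) * y ^+ j.-1) * (y * x ^+ b).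
    by rewrite -{1}(subnK bi) -{1}(prednK j0) exprD exprS; ring.
  exact: KM.
have aj : (a.+1 < j)%N by lia.
have -> : x ^+ i * y ^+ j = (x ^+ i * y ^+ (j - a.+1)) * (t * x ^+ a.+1 + y ^+ a.+1)
    + - (t * (x ^+ (i + a.+1) * y ^+ (j - a.+1))).
  by rewrite -{1}(subnK (ltnW aj)) !exprD; ring.
apply: KD; first exact: KM.
by apply/KN/KM/IH; lia.
Qed.

Lemma example3_monomial a b c i j l : K (t * x ^+ a.+1 + y ^+ a.+1) ->
  K (y * x ^+ b + z ^+ b.+1) -> K (z * x ^+ c) ->
  (a + b + c + 1 <= i + j + l)%N -> (0 < j + l)%N -> K (x ^+ i * y ^+ j * z ^+ l).
Proof.
(* The weight encodes the lexicographic order on (l, j) in fixed total degree: trading z^(b+1) for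
   -y x^b lowers l at the price of raising j by 1. *)
move=> K0 K1 K2; move Ew : ((i + j + l + 2) * l + j)%N => w.
elim/ltn_ind: w i j l Ew => w IH i j l Ew le jl0.
have reduce_y : (a < j)%N -> (a.+1 < j + l)%N -> K (x ^+ i * y ^+ j * z ^+ l).
  move=> aj ajl; have -> : x ^+ i * y ^+ j * z ^+ l =
     (x ^+ i * y ^+ (j - a.+1) * z ^+ l) * (t * x ^+ a.+1 + y ^+ a.+1)
    + - (t * (x ^+ (i + a.+1) * y ^+ (j - a.+1) * z ^+ l)).
    by rewrite -{1}(subnK aj) !exprD; ring.
  apply: KD; first exact: KM.
  apply/KN/KM/(IH _ _ _ _ _ erefl); try lia.
  have -> : (i + a.+1 + (j - a.+1) + l = i + j + l)%N by lia.
  by lia.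
have kill_z i' j' l' : (c <= i')%N -> (0 < l')%N -> K (x ^+ i' * y ^+ j' * z ^+ l').
  move=> ci l0; have -> : x ^+ i' * y ^+ j' * z ^+ l' =
     (x ^+ (i' - c) * y ^+ j' * z ^+ l'.-1) * (z * x ^+ c).
    by rewrite -{1}(subnK ci) -{1}(prednK l0) exprD exprS; ring.
  exact: KM.
case: (posnP l) => [l0|l0].
  have [bci|ibc] := leqP (b + c) i; last by apply: reduce_y; lia.
  have j0 : (0 < j)%N by lia.
  have bi : (b <= i)%N by lia.
  have -> : x ^+ i * y ^+ j * z ^+ l = (x ^+ (i - b) * y ^+ j.-1) * (y * x ^+ b + z ^+ b.+1)
     + - (x ^+ (i - b) * y ^+ j.-1 * z ^+ b.+1).
    by rewrite l0 -{1}(subnK bi) -{1}(prednK j0) exprD exprS; ring.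
  by apply: KD; [exact: KM | apply/KN/kill_z => //; lia].
have [ci|ic] := leqP c i; first exact: kill_z.
have [aj|ja] := leqP a.+1 j; first by apply: reduce_y; lia.
have bl : (b.+1 < l)%N by lia.
have -> : x ^+ i * y ^+ j * z ^+ l =
   (x ^+ i * y ^+ j * z ^+ (l - b.+1)) * (y * x ^+ b + z ^+ b.+1)
  + - (x ^+ (i + b) * y ^+ j.+1 * z ^+ (l - b.+1)).
  by rewrite -{1}(subnK (ltnW bl)) !exprD !exprS; ring.
apply: KD; first exact: KM.
apply/KN/(IH _ _ _ _ _ erefl); try lia.
have -> : (i + b + j.+1 + (l - b.+1) = i + j + l)%N by lia.
set s := (i + j + l)%N in Ew le *.
have -> : l = (l - b.+1 + b.+1)%N by lia.
by nia.
Qed.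

End MonomialExample.

Section DegreePiece.
Variables (n nu : nat) (mu : 'I_n -> nat) (R : comNzRingType).
Variable L : 'I_n -> {mpoly R[n]}.
Hypothesis Lh : homog_family mu L.

Lemma Phi_row_ideal (v : 'rV_#|{: piece n nu mu}|) : ideal_gen L (pol (v *m Phi mu nu L) tt).
Proof. by rewrite pol_Phi //; exists (pol v). Qed.

Lemma ideal_Phi_row p : shomog nu 0 p -> ideal_gen L p ->
  exists v, pol (v *m Phi mu nu L) tt = p.
Proof.
move=> ph [c pE]; exists (vec nu mu c); rewrite pol_Phi // -(pr_id ph) pE raddf_sum /=.
apply: eq_bigr => i _; rewrite vecK (@pr_mul n nu R 0 (mu i)) // => m.
by rewrite addn0; apply: dhomog_supp.
Qed.

Lemma Phi_scalar_ideal (T : 'M_(#|{: piece n nu (shift0 : unit -> nat)}|, #|{: piece n nu mu}|)) a m :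
  T *m Phi mu nu L = a%:M -> mdeg m = nu -> ideal_gen L (a%:MP * 'X_[m]).
Proof.
move=> Ta mnu; have mb : (mdeg m < nu.+1)%N by rewrite mnu.
have xP : (mdeg (tt, BMultinom mb).2 + shift0 (tt, BMultinom mb).1 == nu)%N.
  by rewrite /shift0 addn0; apply/eqP.
pose x : piece n nu shift0 := exist _ (tt, BMultinom mb) xP.
have := Phi_row_ideal (delta_mx 0 (enum_rank x) *m T).
rewrite -mulmxA Ta mul_mx_scalar polZ pol_delta eqxx scale1r /=.
by rewrite mul_mpolyC.
Qed.

End DegreePiece.

Section ExampleForms.
Local Notation Zt := {poly int}.

(** The conditions say that in degree [nu] the cokernel of [Phi] is generated by X_v^nu and killed
    by t, that t is a coefficient, so that specialization is onto, and that at t = 0 the coordinate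
    point of X_v is a common zero, so that t divides the specialized resultant. *)
Definition example_spec n (mu : 'I_n -> nat) (v : 'I_n) (G : 'I_n -> {mpoly Zt[n]}) :=
  [/\ homog_family mu G,
      forall nu, (\sum_i mu i < nu + n)%N ->
        (forall m, mdeg m = nu -> m <> (U_(v) *+ nu)%MM -> ideal_gen G 'X_[m]) /\
        ideal_gen G (('X : Zt)%:MP * 'X_v ^+ nu),
      (G v)@_(U_(v) *+ mu v) = 'X
    & forall i, mmap (horner_eval (0 : int)) (fun j => (j == v)%:R) (G i) = 0].

Lemma dhomog_Xn n (R : nzRingType) (i : 'I_n) d : ('X_i ^+ d : {mpoly R[n]}) \is d.-homog.
Proof. by rewrite mpolyXn dhomogX /= mdegMn mdeg1 mul1n. Qed.

Lemma dhomog_XXn n (R : comNzRingType) (i j : 'I_n) d : (0 < d)%N ->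
  ('X_i * 'X_j ^+ d.-1 : {mpoly R[n]}) \is d.-homog.
Proof.
case: d => // d _; have := dhomogM (dhomog_Xn R i 1) (dhomog_Xn R j d).
by rewrite expr1 add1n.
Qed.

Lemma dhomog_CM n (R : nzRingType) (c : R) (p : {mpoly R[n]}) d :
  p \is d.-homog -> c%:MP * p \is d.-homog.
Proof. by move=> pd; rewrite mul_mpolyC; apply: rpredZ. Qed.

Lemma mcoeff_Xn n (R : nzRingType) (i j : 'I_n) d : (0 < d)%N ->
  ('X_i ^+ d : {mpoly R[n]})@_(U_(j) *+ d) = (i == j)%:R.
Proof.
move=> d0; rewrite mpolyXn mcoeffX; congr (_%:R); congr nat_of_bool.
apply/eqP/eqP => [/(congr1 (fun m : 'X_{1..n} => m i))|->//].
by rewrite !mulmnE !mnm1E eqxx mul1n; case: eqP => // _; rewrite mul0n => d0'; rewrite d0' in d0.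
Qed.

Lemma example2 (mu : 'I_2 -> nat) : (forall i, 0 < mu i)%N ->
  exists v G, example_spec mu v G.
Proof.
move=> mu0.
pose x : {mpoly Zt[2]} := 'X_o20; pose y : {mpoly Zt[2]} := 'X_o21.
pose t : {mpoly Zt[2]} := ('X : Zt)%:MP.
pose G (i : 'I_2) := if i == o20 then t * x ^+ (mu o20) + y ^+ (mu o20)
  else y * x ^+ (mu o21).-1.
have Gid := ideal_gen_ideal G.
exists o20, G; split.
- move=> i; case: (ord2E i) => ->; rewrite /G /=.
    by rewrite rpredD ?dhomog_CM ?dhomog_Xn.
  exact: dhomog_XXn.
- move=> nu; rewrite big_ord2 /= => nule.
  have m0 := mu0 o20; have m1 := mu0 o21.
  have G0 : ideal_gen G (t * x ^+ (mu o20).-1.+1 + y ^+ (mu o20).-1.+1).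
    by rewrite prednK //; apply: (ideal_gen_gen G o20).
  have G1 : ideal_gen G (y * x ^+ (mu o21).-1) := ideal_gen_gen G o21.
  have mon i j : (i + j = nu)%N -> (0 < j)%N -> ideal_gen G (x ^+ i * y ^+ j).
    by move=> ij j0; apply: (example2_monomial Gid G0 G1) => //; lia.
  split=> [m mnu mv|].
    rewrite mpolyXE_id big_ord2 /=; apply: mon.
      by rewrite -mnu mdegE big_ord2.
    rewrite lt0n; apply/eqP => m1z; apply: mv; apply/mnmP => i.
    rewrite mulmnE mnm1E -mnu mdegE big_ord2 /= m1z addn0.
    by case: (ord2E i) => ->; rewrite /= ?mul1n ?mul0n.
  have -> : t * x ^+ nu = x ^+ (nu - mu o20) * (t * x ^+ mu o20 + y ^+ mu o20)
     + - (x ^+ (nu - mu o20) * y ^+ mu o20).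
    by rewrite -{1}[nu](@subnK (mu o20)) ?exprD; [ring | lia].
  rewrite -(prednK m0); case: (Gid) => _ GD.
  apply: GD; first exact: G0.
  by rewrite -mulN1r; apply: ideal_mull => //; apply: mon; lia.
- by rewrite /G /= mcoeffD mcoeffCM !mcoeff_Xn //= mulr1 addr0.
- move=> i; case: (ord2E i) => ->; rewrite /G /= !(rmorphD, rmorphM, rmorphXn) /=.
    rewrite /t mmapC /x /y !mmapX !mmap1U /= expr1n /horner_eval hornerX mul0r add0r.
    by rewrite expr0n; case: (mu o20) (mu0 o20).
  by rewrite /y mmapX mmap1U /= mul0r.
Qed.

Lemma example3 (mu : 'I_3 -> nat) : (forall i, 0 < mu i)%N ->
  exists v G, example_spec mu v G.
Proof.
move=> mu0.
pose x : {mpoly Zt[3]} := 'X_o30; pose y : {mpoly Zt[3]} := 'X_o31.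
pose z : {mpoly Zt[3]} := 'X_o32; pose t : {mpoly Zt[3]} := ('X : Zt)%:MP.
pose G (i : 'I_3) := if i == o30 then t * x ^+ (mu o30) + y ^+ (mu o30)
  else if i == o31 then y * x ^+ (mu o31).-1 + z ^+ (mu o31)
  else z * x ^+ (mu o32).-1.
have Gid := ideal_gen_ideal G.
exists o30, G; split.
- move=> i; case: (ord3E i) => ->; rewrite /G /=.
  + by rewrite rpredD ?dhomog_CM ?dhomog_Xn.
  + by rewrite rpredD ?dhomog_XXn ?dhomog_Xn.
  + exact: dhomog_XXn.
- move=> nu; rewrite big_ord3 /= => nule.
  have m0 := mu0 o30; have m1 := mu0 o31; have m2 := mu0 o32.
  have G0 : ideal_gen G (t * x ^+ (mu o30).-1.+1 + y ^+ (mu o30).-1.+1).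
    by rewrite prednK //; apply: (ideal_gen_gen G o30).
  have G1 : ideal_gen G (y * x ^+ (mu o31).-1 + z ^+ (mu o31).-1.+1).
    by rewrite prednK //; apply: (ideal_gen_gen G o31).
  have G2 : ideal_gen G (z * x ^+ (mu o32).-1) := ideal_gen_gen G o32.
  have mon i j l : (i + j + l = nu)%N -> (0 < j + l)%N -> ideal_gen G (x ^+ i * y ^+ j * z ^+ l).
    by move=> ijl jl0; apply: (example3_monomial Gid G0 G1 G2) => //; lia.
  split=> [m mnu mv|].
    rewrite mpolyXE_id big_ord3 /= mulrA; apply: mon.
      by rewrite -mnu mdegE big_ord3 /= addnA.
    rewrite lt0n addn_eq0; apply/negP => /andP[/eqP m1z /eqP m2z].
    apply: mv; apply/mnmP => i.
    rewrite mulmnE mnm1E -mnu mdegE big_ord3 /= m1z m2z !addn0.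
    by case: (ord3E i) => ->; rewrite /= ?mul1n ?mul0n.
  have -> : t * x ^+ nu = x ^+ (nu - mu o30) * (t * x ^+ mu o30 + y ^+ mu o30)
     + - (x ^+ (nu - mu o30) * y ^+ mu o30 * z ^+ 0).
    by rewrite expr0 -{1}[nu](@subnK (mu o30)) ?exprD; [ring | lia].
  rewrite -(prednK m0); case: (Gid) => _ GD.
  apply: GD; first exact: G0.
  by rewrite -mulN1r; apply: ideal_mull => //; apply: mon; lia.
- by rewrite /G /= mcoeffD mcoeffCM !mcoeff_Xn //= mulr1 addr0.
- move=> i; case: (ord3E i) => ->; rewrite /G /= !(rmorphD, rmorphM, rmorphXn) /=.
  + rewrite /t mmapC /x /y !mmapX !mmap1U /= expr1n /horner_eval hornerX mul0r add0r.
    by rewrite expr0n; case: (mu o30) (mu0 o30).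
  + rewrite /y /z !mmapX !mmap1U /= mul0r add0r.
    by rewrite expr0n; case: (mu o31) (mu0 o31).
  + by rewrite /z mmapX mmap1U /= mul0r.
Qed.

(** Every monomial of degree [nu] is reached, with multiplier t for X_v^nu alone; the product is
    diagonal with a single entry t. *)
Lemma example_det n (mu : 'I_n -> nat) nu v G : example_spec mu v G ->
  (\sum_i mu i < nu + n)%N ->
  exists T, \det (T *m Phi mu nu G) = 'X :> Zt.
Proof.
case=> Gh Gnu _ _ /Gnu[Gm Gt].
pose K0 := piece n nu (shift0 : unit -> nat).
pose e (x : K0) : 'X_{1..n} := (val x).2.
have emd (x : K0) : mdeg (e x) = nu by have /eqP := valP x; rewrite /shift0 addn0.
pose d (x : K0) : Zt := if e x == (U_(v) *+ nu)%MM then 'X else 1.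
have rowx x : exists w, pol (w *m Phi mu nu G) tt = d x *: 'X_[e x].
  apply: (ideal_Phi_row Gh) => [m /msuppZ_le|].
    by rewrite msuppX inE addn0 => /eqP->.
  rewrite /d; case: eqP => [->|ne]; first by rewrite -mul_mpolyC -mpolyXn.
  by rewrite scale1r; apply: Gm.
have [w wE] := boolp.choice rowx.
exists (\matrix_(i < #|{: K0}|) w (enum_val i)).
have -> : (\matrix_i w (enum_val i)) *m Phi mu nu G = diag_mx (\row_(i < #|{: K0}|) d (enum_val i)).
  apply/row_matrixP => i; rewrite row_mul rowK row_diag_mx mxE.
  apply: pol_inj => -[]; rewrite wE polZ.
  have := @pol_delta n nu unit shift0 Zt (enum_val i) tt; rewrite enum_valK => ->.
  by case: (val (enum_val i)).1; rewrite eqxx scale1r.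
rewrite det_diag; under eq_bigr => i _ do rewrite mxE.
have mb : (mdeg (U_(v) *+ nu)%MM < nu.+1)%N by rewrite mdegMn mdeg1 mul1n.
have xP : (mdeg (tt, BMultinom mb).2 + shift0 (tt, BMultinom mb).1 == nu)%N.
  by rewrite /shift0 addn0 /= mdegMn mdeg1 mul1n.
pose x0 : K0 := exist _ (tt, BMultinom mb) xP.
rewrite (bigD1 (enum_rank x0)) //= enum_rankK {1}/d eqxx big1 ?mulr1 // => i ix0.
rewrite /d; case: eqP => // E; case/eqP: ix0; apply: (canRL enum_valK).
apply: val_inj; rewrite [val (enum_val i)]surjective_pairing; congr (_, _).
  by case: (val (enum_val i)).1.
exact: val_inj.
Qed.

End ExampleForms.

Lemma domain_embeds (R : idomainType) :
  exists (E : fieldType) (tf : {rmorphism R -> E}), forall x, tf x = 0 -> x = 0.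
Proof.
exists {fraction R}, (@FracField.tofrac R) => x /eqP.
by rewrite tofrac_eq0 => /eqP.
Qed.

Lemma mpoly_embeds n (R : idomainType) :
  exists (E : fieldType) (tf : {rmorphism {mpoly R[n]} -> E}), forall x, tf x = 0 -> x = 0.
Proof. exact: domain_embeds. Qed.

Lemma mpoly_mpoly_embeds (n m : nat) :
  exists (E : fieldType) (tf : {rmorphism {mpoly {mpoly int[m]}[n]} -> E}),
    forall x, tf x = 0 -> x = 0.
Proof. exact: mpoly_embeds. Qed.

Lemma gmx_ext n nu (J1 J2 : finType) (a1 : J1 -> nat) (a2 : J2 -> nat) (R : comNzRingType)
    (G G' : J1 -> J2 -> {mpoly R[n]}) :
  (forall i j, G i j = G' i j) -> gmx nu a1 a2 G = gmx nu a1 a2 G'.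
Proof. by move=> GG'; apply/matrixP => x y; rewrite !mxE GG'. Qed.

Lemma map_Phi n (mu : 'I_n -> nat) nu (R R' : comNzRingType) (f : {rmorphism R -> R'})
    (F : 'I_n -> {mpoly R[n]}) (F' : 'I_n -> {mpoly R'[n]}) :
  (forall i, map_mpoly f (F i) = F' i) -> map_mx f (Phi mu nu F) = Phi mu nu F'.
Proof. by move=> FF'; rewrite map_gmx; apply: gmx_ext => i []; apply: FF'. Qed.

Lemma map_Psi n (mu : 'I_n -> nat) nu (R R' : comNzRingType) (f : {rmorphism R -> R'})
    (F : 'I_n -> {mpoly R[n]}) (F' : 'I_n -> {mpoly R'[n]}) :
  (forall i, map_mpoly f (F i) = F' i) -> map_mx f (Psi mu nu F) = Psi mu nu F'.
Proof.
move=> FF'; rewrite map_gmx; apply: gmx_ext => x l.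
by rewrite /koszul2 -!FF' rmorphB !rmorphM !rmorph_nat.
Qed.

Lemma map_dhomog n (R R' : nzRingType) (f : {rmorphism R -> R'}) (p : {mpoly R[n]}) d :
  p \is d.-homog -> map_mpoly f p \is d.-homog.
Proof.
move=> pd; apply/dhomogP => m; rewrite mcoeff_msupp mcoeff_map_mpoly => fm.
apply: (dhomog_supp pd); rewrite mcoeff_msupp; apply: contra_neq fm => ->.
by rewrite raddf0.
Qed.

Lemma map_ideal_gen n r (R R' : comNzRingType) (f : {rmorphism R -> R'})
    (F : 'I_r -> {mpoly R[n]}) (F' : 'I_r -> {mpoly R'[n]}) x :
  (forall i, map_mpoly f (F i) = F' i) -> ideal_gen F x -> ideal_gen F' (map_mpoly f x).
Proof.
move=> FF' [c ->]; exists (fun i => map_mpoly f (c i)); rewrite rmorph_sum.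
by apply: eq_bigr => i _; rewrite rmorphM -FF'.
Qed.

Lemma mulmx_select (R : comNzRingType) m p q (A : 'M[R]_(m, p)) (g : 'I_q -> 'I_p) :
  A *m (\matrix_(i, j) (i == g j)%:R) = colsub g A.
Proof.
apply/matrixP => i j; rewrite !mxE (bigD1 (g j)) //= mxE eqxx mulr1 big1 ?addr0 //.
by move=> l /negPf lg; rewrite mxE lg mulr0.
Qed.

Lemma select_mulmx (R : comNzRingType) m p q (A : 'M[R]_(m, p)) (g : 'I_q -> 'I_m) :
  (\matrix_(i, j) (j == g i)%:R) *m A = rowsub g A.
Proof.
apply/matrixP => i j; rewrite !mxE (bigD1 (g i)) //= mxE eqxx mul1r big1 ?addr0 //.
by move=> l /negPf lg; rewrite mxE lg mul0r.
Qed.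

(** * Minors of the generic Koszul map, and lengths after specialization *)

Section Resultant.
Variables (n : nat) (mu : 'I_n -> nat) (nu : nat) (r : coef_ring mu).
Hypotheses (n23 : n = 2%N \/ n = 3%N) (mu_pos : forall i, (0 < mu i)%N).
Hypotheses (nu_large : (\sum_i mu i < nu + n)%N) (r_res : is_generic_resultant r).
Local Notation C := (coef_ring mu).
Local Notation P := (@generic_form n mu).
Local Notation h0 := #|{: piece n nu (shift0 : unit -> nat)}|.
Local Notation h1 := #|{: piece n nu mu}|.
Local Notation Ph := (@generic_form_homog n mu).

Lemma ord_inhabited : exists v : 'I_n, True.
Proof. by case: n23 => E; subst n; exists ord0. Qed.

Lemma r_prime : prime_elt r.
Proof.
have [v _] := ord_inhabited.
have [E [tf tf_inj]] := mpoly_mpoly_embeds n #|{: coef_index mu}|.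
exact: resultant_prime tf_inj v r r_res.
Qed.

Lemma r_dvd (a : C) : saturation (ideal_gen P) a%:MP <-> principal r a.
Proof. exact: (r_res.1 a). Qed.

Lemma scalar_dvd (T : 'M[C]_(h0, h1)) a : T *m Phi mu nu P = a%:M -> principal r a.
Proof.
move=> Ta; apply/r_dvd/saturationP; first exact: ideal_gen_ideal.
by exists nu => m; apply: Phi_scalar_ideal Ta; apply: Ph.
Qed.

Lemma det_dvd (T : 'M[C]_(h0, h1)) : principal r (\det (T *m Phi mu nu P)).
Proof. by apply: (scalar_dvd (T := \adj (T *m Phi mu nu P) *m T)); rewrite -mulmxA mul_adj_mx. Qed.

Lemma r_X : exists N, forall m, mdeg m = N -> ideal_gen P (r%:MP * 'X_[m]).
Proof.
by apply/saturationP; [exact: ideal_gen_ideal | apply/r_dvd/principal_refl].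
Qed.

Lemma example_exists : exists v G, @example_spec n mu v G.
Proof.
case: n23 => E; subst n; [exact: example2 | exact: example3].
Qed.

(** The matrix of the example is lifted through the surjection onto the polynomials in t. If r^2
    divided the lifted determinant, then t would be a multiple of the square of the image of [r],
    which vanishes at t = 0. *)
Lemma det_simple : exists (T : 'M[C]_(h0, h1)) c,
  \det (T *m Phi mu nu P) = c * r /\ ~ principal r c.
Proof.
have [v [G Gs]] := example_exists; have [T0 T0E] := example_det Gs nu_large.
case: Gs => Gh _ Gv G0; pose f := spec mu G.
have PG i : map_mpoly f (P i) = G i by apply: map_generic_form.
have f_surj x : exists c, f c = x.
  elim/poly_ind: x => [|q a [c cE]]; first by exists 0; rewrite rmorph0.
  have [|u [ui um]] := @coef_indexP n mu v (U_(v) *+ mu v)%MM.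
    by rewrite mdegMn mdeg1 mul1n.
  exists (c * 'X_(enum_rank u) + a%:~R).
  rewrite rmorphD rmorphM rmorph_int cE specX ui um Gv; congr (_ + _).
  by rewrite -[a in RHS]intz rmorph_int.
have /boolp.choice[s sE] := f_surj.
pose T := map_mx s T0.
have TE : map_mx f T = T0 by apply/matrixP => i j; rewrite !mxE sE.
have [c cE] := det_dvd T; exists T, c; split=> // -[c' c'E].
(* The relation putting r X_v^N in the ideal of the generic forms is specialized and evaluated at t
   = 0 and at the coordinate point, where all forms vanish. *)
have fr0 : (f r)`_0 = 0.
  have [N NX] := r_X; have mN : mdeg (U_(v) *+ N)%MM = N by rewrite mdegMn mdeg1 mul1n.
  have [h hE] := map_ideal_gen PG (NX _ mN).
  pose ev : {rmorphism {mpoly {poly int}[n]} -> int} :=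
    mmap (horner_eval (0 : int)) (fun j => (j == v)%:R).
  have evG i : ev (G i) = 0 by apply: G0.
  have evC c0 : ev c0%:MP = c0`_0 by rewrite /ev /= mmapC; apply: horner_coef0.
  have evX : ev 'X_v = 1 by rewrite /ev /= mmapX mmap1U eqxx.
  have h0E : ev (\sum_i h i * G i) = 0.
    by rewrite (rmorph_sum ev); apply: big1 => i _; rewrite (rmorphM ev) evG mulr0.
  have := congr1 ev hE; rewrite h0E.
  have -> : map_mpoly f (r%:MP * 'X_[U_(v) *+ N]) = (f r)%:MP * 'X_v ^+ N.
    by rewrite rmorphM /= map_mpolyC map_mpolyX -mpolyXn.
  by rewrite (rmorphM ev) (rmorphXn ev) evX evC expr1n mulr1.
(* The right side has no linear term in t, because f(r) has no constant term. *)
have : 'X = f c' * f r * f r :> {poly int}.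
  by rewrite -!rmorphM -c'E -cE -det_map_mx map_mxM TE (map_Phi mu nu PG) T0E.
move/(congr1 (fun q : {poly int} => q`_1)); rewrite coefX /= coefM.
by rewrite !big_ord_recl big_ord0 /= coefM big_ord_recl big_ord0 /= fr0 !(mulr0, mul0r, addr0).
Qed.

(** Otherwise a prime contains all determinants T Phi but not [r]. Over its residue field [r]
    becomes invertible, so the forms generate a power of the irrelevant ideal, [Phi] has full column
    rank, and one of the determinants is nonzero there. *)
Lemma power_det : exists (I : finType) (T : I -> 'M[C]_(h0, h1)) (c : I -> C) M,
  r ^+ M = \sum_i c i * \det (T i *m Phi mu nu P).
Proof.
pose J (a : C) := exists (I : finType) (T : I -> 'M[C]_(h0, h1)) (c : I -> C),
  a = \sum_i c i * \det (T i *m Phi mu nu P).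
suff [M [I [T [c E]]]] : exists M, J (r ^+ M) by exists I, T, c, M.
have J_ideal : is_ideal J.
  split; first by exists void, (fun=> 0), (fun=> 0); apply/esym; apply: big1 => -[].
  move=> a x y [I [T [c ->]]] [I' [T' [c' ->]]].
  exists (I + I')%type, (fun i => match i with inl j => T j | inr j => T' j end),
    (fun i => match i with inl j => a * c j | inr j => c' j end).
  rewrite big_sumType /= mulr_sumr; congr (_ + _).
  by apply: eq_bigr => i _; rewrite mulrA.
apply: boolp.contrapT => nJ.
have [|q [qp Jq qr]] := @krull_prime C J r J_ideal.
  by move=> N JN; apply: nJ; exists N.
have [F [rho [rhoP rho_frac]]] := quot_field qp.
pose L i := map_mpoly rho (P i).
have Lh : homog_family mu L by move=> i; apply: map_dhomog; apply: Ph.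
have rho_r : rho r != 0 by apply/eqP => /rhoP.
have LX : X_primary L.
  have [N NX] := r_X; exists N => i.
  have mN : mdeg (U_(i) *+ N)%MM = N by rewrite mdegMn mdeg1 mul1n.
  have := map_ideal_gen (F' := L) (fun i => erefl) (NX _ mN).
  rewrite rmorphM /= map_mpolyC map_mpolyX -mpolyXn.
  move/(ideal_mull (rho r)^-1%:MP (ideal_gen_ideal L)).
  by rewrite mulrA -mpolyCM mulVf // mpolyC1 mul1r.
have := rank_Phi n23 Lh nu_large LX; rewrite -(map_Phi mu nu (f := rho) (F := P) (fun i => erefl)).
move/eqP; rewrite -/(row_full _) => /row_fullP[T0 T0E].
have [b [T [b0 TE]]] := clear_denominators_mx T0 rho_frac.
have : rho (\det (T *m Phi mu nu P)) != 0.
  by rewrite -det_map_mx map_mxM TE -scalemxAl T0E scalemx1 det_scalar expf_neq0.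
move/eqP; apply; apply/rhoP/Jq.
by exists unit, (fun=> T), (fun=> 1); rewrite big_unit1 mul1r.
Qed.

Section Specialization.
Variables (B : idomainType) (F : 'I_n -> {mpoly B[n]}).
Hypothesis Fh : homog_family mu F.
Let phi := spec mu F.
Let PF i : map_mpoly phi (P i) = F i. Proof. exact: map_generic_form. Qed.

(** The rows and columns of a minor of [Psi] that is nonzero modulo [p] are used over the generic
    ring: [K] consists of these rows, [S] selects these columns, and det(K S) specializes to a unit
    at [p]. This makes both the transfer of valuations and the completion of [Phi] to a square
    matrix available. *)
Lemma resultant_length (p : B) (kappa : fieldType) (rho : {rmorphism B -> kappa}) v :
  prime_elt p -> (forall b, rho b = 0 <-> principal p b) ->
  koszul_generic (fun i => map_mpoly rho (F i)) ->
  has_val p (phi r) v ->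
  chain_over (principal p) (row_span (Phi mu nu F)) v /\
  ~ chain_over (principal p) (row_span (Phi mu nu F)) v.+1.
Proof.
move=> pp rhoP Fgen rv.
pose L i := map_mpoly rho (F i).
have Lh : homog_family mu L by move=> i; apply: map_dhomog.
have rk := rank_Psi n23 Lh nu_large Fgen.
have [f [g fg]] := minor_ex (Psi mu nu L).
set s := \rank _ in rk f g fg.
have E : h1 = (h0 + s)%N by rewrite -rk addnC.
pose K := rowsub f (Psi mu nu P).
pose S : 'M[C]_(h1, s) := \matrix_(i, j) (i == g j)%:R.
have KA : K *m Phi mu nu P = 0.
  by rewrite /K -[Psi mu nu P]mul1mx -mul_rowsub_mx -mulmxA Psi_Phi ?mulmx0 //; apply: Ph.
have KS : K *m S = mxsub f g (Psi mu nu P).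
  by rewrite mulmx_select; apply/matrixP => i j; rewrite !mxE.
have pKS : ~ principal p (phi (\det (K *m S))).
  move=> /rhoP; rewrite KS -!det_map_mx !map_mxsub (map_Psi mu nu PF).
  by rewrite (map_Psi mu nu (F' := L) (fun i => erefl)) => /eqP; apply/negP.
have := val_transfer E r_prime pp KA (fun a T => @scalar_dvd T a) det_simple power_det pKS rv.
rewrite map_row_det (map_Phi mu nu PF); apply: (chain_over_row_det (K := map_mx phi K)) => //.
  by rewrite -(map_Phi mu nu PF) -map_mxM KA map_mx0.
by rewrite -map_mxM det_map_mx.
Qed.

Lemma resultant_torsion : phi r != 0 ->
  exists b, b != 0 /\ forall x, row_span (Phi mu nu F) (b *: x).
Proof.
move=> r0; have [I [T [c [M rM]]]] := power_det.
exists (phi r ^+ M); split; first exact: expf_neq0.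
move=> x; pose A i := map_mx phi (T i) *m Phi mu nu F.
exists (\sum_i phi (c i) *: (x *m \adj (A i) *m map_mx phi (T i))).
rewrite mulmx_suml -rmorphXn rM rmorph_sum scaler_suml; apply: eq_bigr => i _.
rewrite rmorphM -det_map_mx map_mxM (map_Phi mu nu PF) -/(A i) -scalemxAl -!mulmxA.
by rewrite -/(A i) mul_adj_mx mul_mx_scalar scalerA.
Qed.

(** A torsion cokernel means full rank over the fraction field, hence a nonzero maximal minor; the
    resultant divides every such minor. *)
Lemma resultant_nontorsion b : b != 0 ->
  (forall x, row_span (Phi mu nu F) (b *: x)) -> phi r != 0.
Proof.
move=> b0 bF; apply/eqP => r0.
pose tf : {rmorphism B -> {fraction B}} := @FracField.tofrac B.
have full : row_full (map_mx tf (Phi mu nu F)).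
  rewrite -sub1mx; apply/row_subP => i.
  have [w wE] := bF (delta_mx 0 i); apply/submxP; exists ((tf b)^-1 *: map_mx tf w).
  rewrite -scalemxAl -map_mxM -wE map_mxZ scalerA mulVf ?tofrac_eq0 // scale1r.
  by rewrite row1; apply/rowP => j; rewrite !mxE rmorph_nat.
have := fullrowsub_unit full; rewrite unitmxE unitfE => /eqP; apply.
pose T : 'M[C]_(h0, h1) := \matrix_(i, j) (j == fullrankfun full i)%:R.
have [c cE] := det_dvd T.
have : phi (\det (T *m Phi mu nu P)) = 0 by rewrite cE rmorphM r0 mulr0.
rewrite -det_map_mx map_mxM (map_Phi mu nu PF) => /(congr1 tf).
rewrite rmorph0 -det_map_mx => <-; congr (\det _).
have -> : map_mx phi T = \matrix_(i, j) (j == fullrankfun full i)%:R.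
  by apply/matrixP => i j; rewrite !mxE rmorph_nat.
by rewrite select_mulmx map_mxsub.
Qed.

End Specialization.
End Resultant.

(** * MacRae invariants over a unique factorization domain *)

Section MacRaePrincipal.
Variables (B : idomainType) (B_ufd : ufd B).

Lemma same_setE (R : comNzRingType) (I J : R -> Prop) : same_set I J -> I = J.
Proof. by move=> IJ; apply: boolp.funext => x; apply/boolp.propext/IJ. Qed.

Lemma ideal_mul_principal (a b : B) :
  ideal_mul (principal a) (principal b) = principal (a * b).
Proof.
apply: same_setE => x; split=> [[r [u [v [uv ->]]]]|[c ->]].
  apply: principal_sum => i _; have [[c ->] [c' ->]] := uv i.
  by exists (c * c'); rewrite mulrACA.
exists 1%N, (fun=> c * a), (fun=> b); split; last by rewrite big_ord1 mulrA.
by split; [exists c | exact: principal_refl].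
Qed.

Lemma ideal_one_principal : @ideal_one B = principal 1.
Proof. by apply: same_setE => x; split=> // _; exists x; rewrite mulr1. Qed.

Lemma ideal_exp_principal (a : B) e : ideal_exp (principal a) e = principal (a ^+ e).
Proof.
elim: e => [|e IH]; first by rewrite expr0; exact: ideal_one_principal.
by rewrite exprS -ideal_mul_principal -IH.
Qed.

Lemma ideal_prod_principal r (p : 'I_r -> B) l :
  \big[@ideal_mul B/@ideal_one B]_(i < r) ideal_exp (principal (p i)) (l i)
  = principal (\prod_i p i ^+ l i).
Proof.
apply: (big_rec2 (fun I a => I = principal a)) => [|i I a _ ->].
  exact: ideal_one_principal.
by rewrite ideal_exp_principal ideal_mul_principal.
Qed.

Lemma prime_principal_eq (p q : B) : prime_elt p -> prime_elt q -> principal p q ->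
  principal p = principal q.
Proof.
move=> pp qq pq; apply: same_setE => x; split; last exact: principal_trans.
have [u uu ->] := prime_elt_assoc pp qq pq.
by move=> [c ->]; exists (c / u); rewrite mulrA divrK.
Qed.

Lemma has_val_assoc (p q b : B) e : prime_elt p -> prime_elt q ->
  principal p = principal q -> has_val p b e -> has_val q b e.
Proof.
move=> pp qq pq; have /(prime_elt_assoc pp qq)[u uu qE] : principal p q.
  by rewrite pq; apply: principal_refl.
case=> y -> py; exists (y * u ^- e).
  by rewrite qE exprMn mulrA divrK ?unitrX.
by rewrite -pq => H; apply: py; have := principal_mulr (u ^+ e) H; rewrite divrK ?unitrX.
Qed.

Lemma val_dvd (a b : B) : a != 0 -> b != 0 ->
  (forall p v w, prime_elt p -> has_val p a v -> has_val p b w -> (v <= w)%N) ->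
  principal a b.
Proof.
move=> a0; have [u [s [uu ps aE]]] := B_ufd a0; rewrite {a a0}aE.
elim: s b ps => [|p s IH] b ps b0 ab.
  by exists (b / u); rewrite big_nil mulr1 divrK.
have pp : prime_elt p by apply: ps; rewrite mem_head.
have ps' q : q \in s -> prime_elt q by move=> qs; apply: ps; rewrite inE qs orbT.
have a0 : u * \prod_(q <- s) q != 0.
  rewrite mulf_neq0 //; first by apply: contraTneq uu => ->; rewrite unitr0.
  by rewrite prodf_seq_neq0; apply/allP => q /ps' [].
rewrite big_cons mulrCA in ab *.
have [v av] := has_val_ex B_ufd pp a0; have [w bw] := has_val_ex B_ufd pp b0.
have vp : has_val p p 1 by exists 1; [rewrite mul1r expr1 | case: pp => _ []].
have := ab _ _ _ pp (has_valM pp vp av) bw; case: w bw => // w [y bE py] _.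
pose b' := y * p ^+ w.
have bE' : b = p * b' by rewrite bE /b' exprS mulrCA.
have b'0 : b' != 0 by apply: contra_neq b0 => b'0; rewrite bE' b'0 mulr0.
have [c cE] : principal (u * \prod_(q <- s) q) b'.
  apply: IH => // q v' w' qq av' bw'; have [p0 _] := pp.
  have [e qpe] := has_val_ex B_ufd qq p0.
  by rewrite -(leq_add2l e); apply: (ab q) => //; rewrite ?bE'; apply: has_valM.
by exists c; rewrite {1}bE' cE; ring.
Qed.

Lemma has_val_unique_prime r (p : 'I_r -> B) l : (forall i, prime_elt (p i)) ->
  (forall i j, i != j -> principal (p i) <> principal (p j)) ->
  forall i, has_val (p i) (\prod_i p i ^+ l i) (l i).
Proof.
move=> pp pne i; rewrite (bigD1 i) //= -[X in has_val _ _ X]addn0.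
apply: has_valM => //; first by exists 1; [rewrite mul1r | case: (pp i) => _ []].
apply/has_val0; elim/big_rec: _ => [|j x ji IH]; first by case: (pp i) => _ [].
case/(prime_eltM (pp i)) => // /(prime_elt_dvdX (pp i)) pij.
by apply: (pne i j); [rewrite eq_sym | apply: prime_principal_eq].
Qed.

Lemma has_val_other_prime r (p : 'I_r -> B) l q : (forall i, prime_elt (p i)) ->
  prime_elt q -> (forall i, principal q <> principal (p i)) ->
  has_val q (\prod_i p i ^+ l i) 0.
Proof.
move=> pp qq pne; apply/has_val0.
elim/big_rec: _ => [|j x _ IH]; first by case: qq => _ [].
case/(prime_eltM qq) => // /(prime_elt_dvdX qq) pij.
by apply: (pne j); apply: prime_principal_eq.
Qed.

Lemma prime_reps (s : seq B) : (forall p, p \in s -> prime_elt p) ->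
  exists r (p : 'I_r -> B), [/\ forall i, prime_elt (p i),
    forall i j, i != j -> principal (p i) <> principal (p j)
    & forall q, q \in s -> exists i, principal q = principal (p i)].
Proof.
elim: s => [_|q s IH qs]; first by exists 0%N, (fun=> 0); split=> // -[].
have [|r [p [pp pne ps]]] := IH; first by move=> x xs; apply: qs; rewrite inE xs orbT.
have [[i qi]|nq] := boolp.pselect (exists i, principal q = principal (p i)).
  exists r, p; split=> // x; rewrite inE => /orP[/eqP->|/ps //].
  by exists i.
exists r.+1, (fun i => oapp p q (unlift ord0 i)); split=> [i|i j|x].
- by case: (unlift ord0 i) => [j|] /=; [exact: pp | apply: qs; rewrite mem_head].
- case: (unliftP ord0 i) => [i'|] ->; case: (unliftP ord0 j) => [j'|] -> //=.
  + by rewrite (inj_eq lift_inj) => /pne.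
  + by move=> _ /esym E; apply: nq; exists i'.
  + by move=> _ E; apply: nq; exists j'.
- rewrite inE => /orP[/eqP->|/ps[i ->]]; first by exists ord0; rewrite unlift_none.
  by exists (lift ord0 i); rewrite liftK.
Qed.

Lemma prime_power_factorization (a : B) : a != 0 ->
  exists r (p : 'I_r -> B) (l : 'I_r -> nat), [/\ forall i, prime_elt (p i),
    forall i j, i != j -> principal (p i) <> principal (p j),
    forall i, has_val (p i) a (l i)
    & forall q, prime_elt q -> (forall i, principal q <> principal (p i)) -> has_val q a 0].
Proof.
move=> a0; have [u [s [uu ps aE]]] := B_ufd a0.
have [r [p [pp pne prep]]] := prime_reps ps.
have /boolp.choice[l lE] i : exists e, has_val (p i) a e by exact: has_val_ex.
exists r, p, l; split=> // q qq qp; apply/has_val0; rewrite aE => /(prime_eltM qq)[].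
  exact: prime_elt_unit.
case/(prime_elt_prod qq) => x xs qx; have [i xi] := prep x xs.
by apply: (qp i); rewrite -xi; apply: prime_principal_eq => //; apply: ps.
Qed.

Variable M : lmodType B.

Lemma has_loc_chain_sub (q : B -> Prop) r r' : (r <= r')%N ->
  has_loc_chain q M r' -> has_loc_chain q M r.
Proof.
move=> rr [N [Ns Nl]]; exists N; split=> i ir.
  by apply: Ns; apply: leq_trans rr.
by apply: Nl; apply: leq_trans rr.
Qed.

Lemma loc_length_inj (q : B -> Prop) l l' : loc_length q M l -> loc_length q M l' -> l = l'.
Proof.
move=> [H1 H2] [H1' H2']; apply/eqP; rewrite eqn_leq; apply/andP; split; rewrite leqNgt.
  by apply/negP => ll; apply: H2'; apply: has_loc_chain_sub H1.
by apply/negP => ll; apply: H2; apply: has_loc_chain_sub H1'.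
Qed.

Lemma macrae_principal (a : B) : (a != 0 -> torsion M) -> (torsion M -> a != 0) ->
  (forall p v, prime_elt p -> has_val p a v -> loc_length (principal p) M v) ->
  same_set (principal a) (macrae M).
Proof.
move=> aT Ta alen x; have [a0|a0] := eqVneq a 0.
  have nT : ~ torsion M by move/Ta; rewrite a0 eqxx.
  by split=> [[c ->]|[[] //|[_ ->]]]; [right; rewrite a0 mulr0 | exists 0; rewrite mul0r].
have prod_neq0 r (p : 'I_r -> B) l : (forall i, prime_elt (p i)) -> \prod_i p i ^+ l i != 0.
  by move=> pp; apply/prodf_neq0 => i _; rewrite expf_neq0 //; case: (pp i).
split=> [ax|[[_ [r [q [l [qh qne q0 qx]]]]]|[/(_ (aT a0))] //]].
  left; split; first exact: aT.
  have [r [p [l [pp pne pa qa]]]] := prime_power_factorization a0.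
  exists r, (fun i => principal (p i)), l; split.
  - by move=> i; split; [exact: height_one_prime_elt | exact: alen].
  - by move=> i j ij /same_setE; apply: pne; apply/eqP.
  - move=> q /(height_one_principal B_ufd)[p' pp' /same_setE ->] qp.
    apply: alen => //; apply: qa => // i E; apply: (qp i).
    by rewrite E.
  - rewrite ideal_prod_principal; apply: principal_trans ax.
    apply: val_dvd => //; first exact: prod_neq0.
    move=> q v w qq; have [[i qi]|nq] := boolp.pselect (exists i, principal q = principal (p i)).
      move=> /(has_val_assoc qq (pp i) qi) Hv /(has_val_assoc qq (pp i) qi) Hw.
      have vE := has_val_inj (pp i) Hv (has_val_unique_prime l pp pne i).
      by rewrite (has_val_inj (pp i) Hw (pa i)) vE.
    move=> Hv Hw.
    by rewrite (has_val_inj qq Hv (has_val_other_prime l pp qq _)) // => i E; apply: nq; exists i.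
have /boolp.choice[p pP] i : exists p, prime_elt p /\ q i = principal p.
  by have [p pp /same_setE qp] := height_one_principal B_ufd (qh i).1; exists p.
have qE : q = fun i => principal (p i) by apply: boolp.funext => i; case: (pP i).
have pp i : prime_elt (p i) by case: (pP i).
have pne i j : i != j -> principal (p i) <> principal (p j).
  by move=> /eqP ij E; apply: (qne i j ij); rewrite (pP i).2 (pP j).2 E.
rewrite qE ideal_prod_principal in qx; apply: principal_trans qx.
apply: val_dvd => //; first exact: prod_neq0.
move=> p' v w pp' av Hw; have p'h := height_one_prime_elt B_ufd pp'.
have len := alen _ _ pp' av.
have [[i pi]|np] := boolp.pselect (exists i, principal p' = principal (p i)).
  have vl : v = l i by apply: loc_length_inj len _; rewrite pi -(pP i).2; case: (qh i).
  have Hw' := has_val_assoc pp' (pp i) pi Hw.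
  by rewrite vl (has_val_inj (pp i) Hw' (has_val_unique_prime l pp pne i)).
have -> // : v = 0%N.
apply: loc_length_inj len _; apply: q0 => // i /same_setE E.
by apply: np; exists i; rewrite E (pP i).2.
Qed.

End MacRaePrincipal.

(** * The symmetric algebra *)

Section AlgebraAlongMorphism.
Variables (A Q : comNzRingType) (phi : {rmorphism A -> Q}).

(** An alias of [Q] that carries the A-algebra structure through [phi], so that the universal
    property of [S] can be applied to a quotient ring. *)
Definition alg_along of {rmorphism A -> Q} : Type := Q.
Local Notation T := (alg_along phi).
HB.instance Definition _ := GRing.ComNzRing.on T.

Definition along_scale (a : A) (x : T) : T := phi a * x.

Lemma along_scaleA a b x : along_scale a (along_scale b x) = along_scale (a * b) x.
Proof. by rewrite /along_scale mulrA rmorphM. Qed.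
Lemma along_scale1 : left_id 1 along_scale.
Proof. by move=> x; rewrite /along_scale rmorph1 mul1r. Qed.
Lemma along_scaleDr : right_distributive along_scale +%R.
Proof. by move=> a x y; rewrite /along_scale mulrDr. Qed.
Lemma along_scaleDl x : {morph along_scale^~ x : a b / a + b}.
Proof. by move=> a b; rewrite /along_scale rmorphD mulrDl. Qed.
HB.instance Definition _ := GRing.Zmodule_isLmodule.Build A T
  along_scaleA along_scale1 along_scaleDr along_scaleDl.

Lemma along_scaleAl (a : A) (x y : T) : a *: (x * y) = (a *: x) * y.
Proof. by rewrite /GRing.scale /= /along_scale mulrA. Qed.
HB.instance Definition _ := GRing.Lmodule_isLalgebra.Build A T along_scaleAl.
HB.instance Definition _ := GRing.Lalgebra_isComAlgebra.Build A T.

Lemma along_scaleE (a : A) (x : T) : a *: x = (phi a : T) * x.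
Proof. by []. Qed.

End AlgebraAlongMorphism.

Section SymmetricAlgebra.
Variables (n : nat) (k : fieldType) (f : 'I_n.+1 -> {mpoly k[n]}).
Variables (P : 'M[{mpoly k[n]}]_(n.+1, n)).
Local Notation A := {mpoly k[n]}.
Local Notation B := {mpoly k[n.+1]}.
Local Notation AB := {mpoly B[n]}.
Local Notation L := (syzygy_form P).
Local Notation I := (ideal_gen f).
Hypothesis fP : forall w : 'cV[A]_n.+1, (\row_j f j) *m w = 0 <-> exists v, w = P *m v.

(* [liftA] is [map_mpoly (@mpolyC n.+1 k)], kept abstract so that simplification
   does not unfold it. *)
Variable liftA : {rmorphism A -> AB}.
Hypothesis liftAE : forall p, liftA p = map_mpoly (@mpolyC n.+1 k) p.

Lemma syzygy_formE i : L i = \sum_j liftA (P j i) * ('X_j : B)%:MP.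
Proof. by apply: eq_bigr => j _; rewrite liftAE -mul_mpolyC mulrC. Qed.

Lemma syzygy_combination (c : 'I_n.+1 -> A) : \sum_j c j * f j = 0 ->
  ideal_gen L (\sum_j liftA (c j) * ('X_j : B)%:MP).
Proof.
move=> cf; have [|v vE] := (fP (\col_j c j)).1.
  apply/matrixP => x y; rewrite !mxE -[RHS]cf; apply: eq_bigr => j _.
  by rewrite !mxE mulrC.
exists (fun i => liftA (v i 0)).
under [RHS]eq_bigr do rewrite syzygy_formE mulr_sumr.
rewrite exchange_big /=; apply: eq_bigr => j _.
have -> : c j = \sum_i P j i * v i 0 by have := congr1 (fun M : 'cV_n.+1 => M j 0) vE; rewrite !mxE.
rewrite rmorph_sum mulr_suml; apply: eq_bigr => i _.
by rewrite rmorphM mulrA [liftA (P j i) * _]mulrC.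
Qed.

Lemma syzygy_column i : \sum_j P j i * f j = 0.
Proof.
have : (\row_j f j) *m col i P = 0 by apply/fP; exists (delta_mx i 0); rewrite colE.
move/(congr1 (fun M : 'M_1 => M 0 0)); rewrite !mxE => H; rewrite -[RHS]H.
by apply: eq_bigr => j _; rewrite !mxE mulrC.
Qed.

(** Sending every T_j to 0 kills all the L_i. Properness is what makes the quotient ring below
    nonzero. *)
Lemma syzygy_form_proper : ~ ideal_gen L 1.
Proof.
pose ev0 : {rmorphism AB -> A} := mmap (mmap (@mpolyC n k) (fun=> 0)) (fun i => 'X_i).
have evT j : ev0 ('X_j : B)%:MP = 0 by rewrite /ev0 /= mmapC /= mmapX mmap1U.
have evL i : ev0 (L i) = 0.
  rewrite syzygy_formE rmorph_sum; apply: big1 => j _.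
  by rewrite rmorphM evT mulr0.
case=> c cE; have : ev0 1 = 0.
  by rewrite cE rmorph_sum; apply: big1 => i _; rewrite rmorphM evL mulr0.
by move/eqP; rewrite rmorph1 oner_eq0.
Qed.

Variables (S : comAlgType A) (iota : A -> S).
Hypothesis iotaP : is_symmetric_algebra I iota.

Let sm : {rmorphism AB -> S} :=
  mmap (mmap (in_alg S \o @mpolyC n k) (fun j => iota (f j))) (fun i => in_alg S 'X_i).

Lemma smX i : sm 'X_i = ('X_i : A)%:A.
Proof. by rewrite /sm /= mmapX mmap1U. Qed.

Lemma smT j : sm ('X_j : B)%:MP = iota (f j).
Proof. by rewrite /sm /= mmapC /= mmapX mmap1U. Qed.

Lemma smA p : sm (liftA p) = p%:A.
Proof.
apply: (@mpoly_rmorph_ext _ _ _ (sm \o liftA) (in_alg S)) => [c|i].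
  by rewrite /= liftAE map_mpolyC /= mmapC /= mmapC.
by rewrite -[LHS]/(sm (liftA 'X_i)) liftAE map_mpolyX smX.
Qed.

Lemma iota_sum (J : Type) (s : seq J) (c : J -> A) (x : J -> A) : (forall i, I (x i)) ->
  iota (\sum_(i <- s) c i * x i) = \sum_(i <- s) c i *: iota (x i).
Proof.
have [I0 ID] := ideal_gen_ideal f; case: iotaP => iotaL _ Ix.
have iota0 : iota 0 = 0.
  by have /esym/eqP := iotaL 1 0 0 I0 I0; rewrite scale1r mul1r addr0 -subr_eq0 addrK => /eqP.
suff [] : I (\sum_(i <- s) c i * x i) /\
    iota (\sum_(i <- s) c i * x i) = \sum_(i <- s) c i *: iota (x i) by [].
elim: s => [|i s [Is IH]]; rewrite ?big_nil // !big_cons.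
by split; [apply: ID | rewrite iotaL // IH].
Qed.

Lemma sm_syzygy x : ideal_gen L x -> sm x = 0.
Proof.
case=> c ->; rewrite rmorph_sum; apply: big1 => i _; rewrite rmorphM.
suff -> : sm (L i) = 0 by rewrite mulr0.
rewrite syzygy_formE rmorph_sum.
transitivity (\sum_j P j i *: iota (f j)).
  by apply: eq_bigr => j _; rewrite rmorphM smA smT mulr_algl.
rewrite -iota_sum => [|j]; last exact: ideal_gen_gen.
rewrite syzygy_column; have := @iota_sum void [::] (fun=> 0) (fun=> 0) (fun v => match v with end).
by rewrite !big_nil.
Qed.

(** The quotient of A[T] by the L_i receives the linear map sending the sum of c_j f_j to the class
    of the sum of c_j T_j. It is well defined because [P] generates the syzygies of [f]. The
    universal property extends it to [S], and the composite with [sm] is the projection, so the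
    kernel of [sm] is no larger than the ideal. *)
Lemma sm_kernel x : sm x = 0 -> ideal_gen L x.
Proof.
have Lid := ideal_gen_ideal L.
have [Q [pi [pi0 _]]] := quot_ring Lid syzygy_form_proper.
pose phi : {rmorphism A -> Q} := pi \o liftA.
pose T (c : 'I_n.+1 -> A) := \sum_j liftA (c j) * ('X_j : B)%:MP.
have Twd c c' : \sum_j c j * f j = \sum_j c' j * f j -> pi (T c) = pi (T c').
  move=> cc'; apply/eqP; rewrite -subr_eq0 -rmorphB; apply/eqP/pi0.
  have -> : T c - T c' = T (fun j => c j - c' j).
    by rewrite /T -sumrB; apply: eq_bigr => j _; rewrite rmorphB mulrBl.
  apply: syzygy_combination; under eq_bigr do rewrite mulrBl.
  by rewrite sumrB cc' subrr.
(* Outside the ideal the map takes the value 0; [linear_on] tests only elements of the ideal. *)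
have [g gP] : exists g : A -> alg_along phi, forall c, g (\sum_j c j * f j) = pi (T c).
  have /boolp.choice[g gP] (y : A) : exists z : alg_along phi,
      forall c, y = \sum_j c j * f j -> z = pi (T c).
    have [[c ->]|ny] := boolp.pselect (I y); first by exists (pi (T c)) => c' /Twd.
    by exists 0 => c cE; case: ny; exists c.
  by exists g => c; apply: gP.
have gL : linear_on I g.
  move=> a _ _ [c ->] [c' ->]; rewrite mulr_sumr -big_split /=.
  have -> : \sum_i (a * (c i * f i) + c' i * f i) = \sum_i (a * c i + c' i) * f i.
    by apply: eq_bigr => i _; rewrite mulrDl mulrA.
  rewrite !gP along_scaleE.
  transitivity (pi (liftA a * T c + T c')); last by rewrite rmorphD rmorphM.
  congr (pi _).
  rewrite /T mulr_sumr -big_split /=; apply: eq_bigr => i _.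
  by rewrite rmorphD rmorphM mulrDl mulrA.
case: iotaP => _ /(_ _ g gL)[h [hI _]].
have hf j : h (iota (f j)) = pi ('X_j : B)%:MP.
  rewrite hI; last exact: ideal_gen_gen.
  have {1}-> : f j = \sum_i (i == j)%:R * f i.
    by rewrite (bigD1 j) //= eqxx mul1r big1 ?addr0 // => i /negPf ->; rewrite mul0r.
  rewrite gP /T (bigD1 j) //= eqxx rmorph1 mul1r big1 ?addr0 // => i /negPf ->.
  by rewrite rmorph0 mul0r.
have hA p : h p%:A = pi (liftA p) by rewrite linearZ /= rmorph1 along_scaleE mulr1.
have liftC (c : k) : liftA c%:MP = ((c%:MP : B)%:MP : AB) by rewrite liftAE map_mpolyC.
move=> x0; apply/pi0; rewrite -[RHS](rmorph0 h) -x0.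
apply/esym; apply: (@mpoly_rmorph_ext _ _ _ (h \o sm) pi) => [b|i].
  apply: (@mpoly_rmorph_ext _ _ _ ((h \o sm) \o @mpolyC n B) (pi \o @mpolyC n B)) => [c|j].
    by rewrite -[LHS]/(h (sm ((c%:MP : B)%:MP))) -[RHS]/(pi ((c%:MP : B)%:MP)) -liftC smA hA.
  by rewrite -[LHS]/(h (sm ('X_j)%:MP)) smT hf.
by rewrite -[LHS]/(h (sm 'X_i)) smX hA liftAE map_mpolyX.
Qed.

Variables (M : lmodType B).

Lemma sym_piece_presentation (mu : 'I_n -> nat) (nu : nat) (j : M -> S) :
  homog_family mu L -> is_sym_piece f iota nu%:Z j ->
  exists pi : 'rV[B]_#|{: piece n nu (shift0 : unit -> nat)}| -> M,
    [/\ forall a x y, pi (a *: x + y) = a *: pi x + pi y,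
        forall m, exists x, pi x = m
      & forall x, pi x = 0 <-> row_span (Phi mu nu L) x].
Proof.
move=> Lh [jinj jD jZ jim].
have j0 : j 0 = 0.
  by have /esym/eqP := jD 0 0; rewrite addr0 -subr_eq0 addrK => /eqP.
have pol_homogz (x : 'rV[B]_#|{: piece n nu (shift0 : unit -> nat)}|) : homogz nu (pol x tt).
  by move=> m /(@pol_shomog n nu unit shift0); rewrite /shift0 addn0 => ->.
have [pi piE] : exists pi, forall x : 'rV[B]_#|{: piece n nu (shift0 : unit -> nat)}|,
    j (pi x) = sm (pol x tt).
  suff /boolp.choice[pi piE] (x : 'rV[B]_#|{: piece n nu (shift0 : unit -> nat)}|) :
    exists m, j m = sm (pol x tt) by exists pi.
  by apply/jim; exists (pol x tt).
exists pi; split.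
- by move=> a x y; apply: jinj; rewrite jD jZ !piE polD polZ rmorphD -mul_mpolyC rmorphM.
- move=> m; have [y yh jm] := (jim (j m)).1 (ex_intro _ m erefl).
  exists (vec nu (shift0 : unit -> nat) (fun=> y)); apply: jinj.
  rewrite piE vecK pr_id ?jm // => w /yh [<-].
  by rewrite /shift0 addn0.
- move=> x; split=> [x0|[v ->]].
    have /sm_kernel xL : sm (pol x tt) = 0 by rewrite -piE x0 j0.
    have [v vE] := ideal_Phi_row Lh (@pol_shomog n nu unit shift0 _ x tt) xL.
    by exists v; apply: (@pol_inj n nu unit shift0) => u; case: u; rewrite vE.
  by apply: jinj; rewrite piE j0; apply: sm_syzygy; apply: Phi_row_ideal.
Qed.

Lemma sym_piece_neg (nu : int) (j : M -> S) : (nu < 0)%R ->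
  is_sym_piece f iota nu j -> forall m : M, m = 0.
Proof.
move=> nu0 [jinj jD jZ jim] m.
have j0 : j 0 = 0.
  by have /esym/eqP := jD 0 0; rewrite addr0 -subr_eq0 addrK => /eqP.
have [y yh jm] := (jim (j m)).1 (ex_intro _ m erefl).
suff y0 : y = 0 by apply: jinj; rewrite jm j0 y0; apply: (rmorph0 sm).
apply/eqP; rewrite -msupp_eq0; case E : (msupp y) => [//|w s].
have := yh w; rewrite E mem_head => /(_ isT) nuE.
by move: nu0; rewrite -nuE.
Qed.

End SymmetricAlgebra.

Lemma ord3_others (i0 : 'I_3) : exists a b : 'I_3,
  [/\ a != i0, b != i0, a != b & forall i, [\/ i = i0, i = a | i = b]].
Proof.
by case: (ord3E i0) => ->; [exists o31, o32|exists o30, o32|exists o30, o31]; split=> // i;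
  case: (ord3E i) => ->; first [exact: Or31|exact: Or32|exact: Or33].
Qed.

(** * Resolutions with a form of degree zero in X *)

Section ConstantForm.
Variables (F : fieldType) (nu : nat).

(** The corank is the dimension of the degree [nu] part of the quotient by the single remaining
    form, which is the degree of that form. The kernel of [Phi] is the summand of index [i0]. *)
Lemma corank_Phi2 (mu : 'I_2 -> nat) (L : 'I_2 -> {mpoly F[2]}) i0 :
  homog_family mu L -> (\sum_i mu i < nu + 2)%N -> mu i0 = 0%N -> L i0 = 0 ->
  (exists i, L i != 0) ->
  #|{: piece 2 nu (shift0 : unit -> nat)}| =
    (\rank (Phi mu nu L) + \prod_(j < 2 | j != i0) mu j)%N.
Proof.
move=> Lh; pose b : 'I_2 := if i0 == o20 then o21 else o20.
have bi : b != i0 by rewrite /b; case: (ord2E i0) => ->.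
have ib i : i != i0 -> i = b by rewrite /b; case: (ord2E i0) => ->; case: (ord2E i) => ->.
rewrite (bigD1 i0) //= (bigD1 b) //= [X in (_ + (_ + X))%N]big1 => [|i /andP[/ib -> /eqP //]].
rewrite (bigD1 b) //= big1 => [|i /andP[/ib -> /eqP //]]; rewrite muln1.
move=> nul mui Li [i Lin].
have Lb : L b != 0.
  by move: Lin; have [->|/ib -> //] := eqVneq i i0; rewrite Li eqxx.
pose H (_ : unit) (j : 'I_2) : {mpoly F[2]} := (j == i0)%:R.
have Hg : graded (shift0 : unit -> nat) mu H.
  move=> u j m; rewrite /H /shift0; case: eqP => [->|_]; rewrite ?msupp0 //.
  by rewrite msupp1 inE => /eqP ->; rewrite mdeg0 mui.
have key : (\rank (Phi mu nu L) + \rank (gmx nu (shift0 : unit -> nat) mu H) =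
    #|{: piece 2 nu mu}|)%N.
  apply: gmx_exact => //; first exact: graded_koszul1.
  - by move=> u v; rewrite (bigD1 i0) //= /koszul1 Li mulr0 add0r big1 // => j /negPf ji; rewrite /H ji mul0r.
  - move=> c cL; exists (fun=> c i0) => j; rewrite big_unit1 /H.
    have [->|/ib ->] := eqVneq j i0; rewrite ?mulr1 ?mulr0 //.
    have /eqP := cL tt; rewrite (bigD1 i0) //= (bigD1 b) //= /koszul1 Li mulr0 add0r.
    rewrite big1 ?addr0 => [|j' /andP[/ib -> /eqP //]].
    by rewrite mulf_eq0 (negPf Lb) orbF => /eqP.
have rkH : \rank (gmx nu (shift0 : unit -> nat) mu H) = #|{: piece 2 nu (shift0 : unit -> nat)}|.
  by apply: gmx_inj => // g gH []; have := gH i0; rewrite big_unit1 /H eqxx mulr1.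
move: key; rewrite rkH; set r := \rank _ => key.
have c0 : #|{: piece 2 nu (shift0 : unit -> nat)}| = nmon 2 nu 0 by rewrite card_piece big_unit1.
have c1 : #|{: piece 2 nu mu}| = (nmon 2 nu 0 + nmon 2 nu (mu b))%N.
  rewrite card_piece (bigD1 i0) //= (bigD1 b) //= mui.
  by rewrite big1 => [|j /andP[/ib -> /eqP //]]; rewrite addn0.
rewrite c0 c1 in key *; move: key; rewrite !nmon2; lia.
Qed.

(** The quotient by two coprime forms has dimension the product of their degrees in the given range
    of [nu], as in Bezout's theorem. The kernel of [Phi] has two generators, given by [H]. *)
Lemma corank_Phi3 (mu : 'I_3 -> nat) (L : 'I_3 -> {mpoly F[3]}) i0 :
  homog_family mu L -> (\sum_i mu i < nu + 3)%N -> mu i0 = 0%N -> L i0 = 0 ->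
  (exists i, L i != 0) -> coprime_family L ->
  #|{: piece 3 nu (shift0 : unit -> nat)}| =
    (\rank (Phi mu nu L) + \prod_(j < 3 | j != i0) mu j)%N.
Proof.
move=> Lh; have [a [b [ai bi ab iab]]] := ord3_others i0.
have sumE (V : nmodType) (G : 'I_3 -> V) : \sum_i G i = G i0 + (G a + G b).
  rewrite (bigD1 i0) // (bigD1 a) //= (bigD1 b) /=; last by rewrite bi eq_sym.
  rewrite [X in _ + (_ + (_ + X))]big1 ?addr0 // => i /andP[/andP[]].
  by case: (iab i) => ->; rewrite eqxx.
have sumnE (G : 'I_3 -> nat) : (\sum_i G i = G i0 + (G a + G b))%N by exact: (sumE nat).
rewrite sumnE (bigD1 a) //= (bigD1 b) /=; last by rewrite bi eq_sym.
rewrite big1 => [|i /andP[/andP[]]]; last by case: (iab i) => ->; rewrite eqxx.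
rewrite muln1 => nul mui Li Lnz Lcop.
(* The index [true] stands for the unit vector at [i0], and [false] for the Koszul relation between
   the other two forms. *)
pose H (t : bool) (j : 'I_3) : {mpoly F[3]} :=
  if t then (j == i0)%:R else if j == a then L b else if j == b then - L a else 0.
pose a0 (t : bool) := if t then 0%N else (mu a + mu b)%N.
have [Ha Hb Hi] : [/\ H false a = L b, H false b = - L a & H false i0 = 0].
  by rewrite /H eqxx (eq_sym b) (negPf ab) eqxx ![i0 == _]eq_sym (negPf ai) (negPf bi).
have [Ta Tb Ti] : [/\ H true a = 0, H true b = 0 & H true i0 = 1].
  by rewrite /H eqxx (negPf ai) (negPf bi).
have Hg : graded a0 mu H.
  move=> [] j m; rewrite [a0 _]/=.
    case: (iab j) => ->; rewrite ?Ta ?Tb ?Ti ?msupp0 // -mpolyC1 msupp1 inE => /eqP ->.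
    by rewrite mdeg0 mui.
  case: (iab j) => ->; rewrite ?Ha ?Hb ?Hi ?msupp0 //.
    by move/(dhomog_supp (Lh b)) => ->; rewrite addnC.
  by rewrite (perm_mem (msuppN _)) => /(dhomog_supp (Lh a)) ->.
have sumb (V : nmodType) (G : bool -> V) : \sum_t G t = G true + G false.
  by rewrite (bigD1 true) //= (bigD1 false) //= big1 ?addr0 // => -[].
have Lab : L a != 0 \/ L b != 0.
  case: Lnz => i; case: (iab i) => ->; rewrite ?Li ?eqxx //; [by left|by right].
have key : (\rank (Phi mu nu L) + \rank (gmx nu a0 mu H) = #|{: piece 3 nu mu}|)%N.
  apply: gmx_exact => //; first exact: graded_koszul1.
  - move=> [] u; rewrite sumE ?Ta ?Tb ?Ti ?Ha ?Hb ?Hi /koszul1 Li; ring.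
  - move=> c cL; have := cL tt; rewrite sumE /koszul1 Li mulr0 add0r => cab.
    pose x j := if j == a then - c b else if j == b then c a else 0.
    have [xa xb xi] : [/\ x a = - c b, x b = c a & x i0 = 0].
      by rewrite /x eqxx (eq_sym b) (negPf ab) eqxx ![i0 == _]eq_sym (negPf ai) (negPf bi).
    have cE : c a * L a = - (c b * L b) by apply/eqP; rewrite -addr_eq0 cab.
    have [i j|g gE] := coprime_family_prop (@ufd_mpoly F 3) (x := x) Lcop Lnz.
      case: (iab i) => ->; case: (iab j) => ->; rewrite ?xa ?xb ?xi ?Li ?mulr0 ?mul0r //.
        by rewrite cE mulNr.
      by rewrite cE mulNr.
    exists (fun t => if t then c i0 else g) => j; rewrite sumb.
    case: (iab j) => ->; rewrite ?Ta ?Tb ?Ti ?Ha ?Hb ?Hi ?mulr0 ?mulr1 ?addr0 ?add0r //.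
      by rewrite -gE xb.
    by rewrite mulrN -gE xa opprK.
have rkH : \rank (gmx nu a0 mu H) = #|{: piece 3 nu a0}|.
  apply: gmx_inj => // g gH.
  have gf : g false = 0.
    case: Lab => Lx; [have := gH b | have := gH a];
    by rewrite sumb ?Ha ?Hb ?Ta ?Tb mulr0 add0r => /eqP; rewrite mulf_eq0 ?oppr_eq0 (negPf Lx) orbF => /eqP.
  by case=> //; have := gH i0; rewrite sumb Hi Ti mulr1 mulr0 addr0.
move: key; rewrite rkH; set r := \rank _ => key.
have c0 : #|{: piece 3 nu (shift0 : unit -> nat)}| = nmon 3 nu 0 by rewrite card_piece big_unit1.
have c1 : #|{: piece 3 nu mu}| = (nmon 3 nu 0 + (nmon 3 nu (mu a) + nmon 3 nu (mu b)))%N.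
  by rewrite card_piece sumnE mui.
have c2 : #|{: piece 3 nu a0}| = (nmon 3 nu 0 + nmon 3 nu (mu a + mu b))%N.
  by rewrite card_piece; exact: (sumb nat).
rewrite c0 c1 c2 in key *; move: key.
rewrite !nmon3; [|lia..].
set N := nu.+2 in nul *.
have [x Nx] : exists x, N = (x + (mu a + mu b))%N by exists (N - (mu a + mu b))%N; lia.
rewrite Nx addnK.
have -> : (x + (mu a + mu b) - mu a = x + mu b)%N by lia.
have -> : (x + (mu a + mu b) - mu b = x + mu a)%N by lia.
rewrite subn0 !bin2D; lia.
Qed.

End ConstantForm.

Section ConstantFormLength.
Variables (n : nat) (mu : 'I_n -> nat) (nu : nat) (B : idomainType) (F : 'I_n -> {mpoly B[n]}).
Variable i0 : 'I_n.
Hypotheses (n23 : n = 2%N \/ n = 3%N) (nu_large : (\sum_i mu i < nu + n)%N).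
Hypotheses (Fh : homog_family mu F) (mu0 : mu i0 = 0%N).
Local Notation l := ((F i0)@_0%MM).

Lemma constant_formE : F i0 = l%:MP.
Proof.
apply/mpolyP => m; rewrite mcoeffC; have [->|m0] := eqVneq m 0%MM; first by rewrite mulr1.
rewrite mulr0; apply/eqP; rewrite mcoeff_eq0; apply: contra m0 => /(dhomog_supp (Fh i0)).
by rewrite mu0 => /eqP; rewrite mdeg_eq0.
Qed.

Lemma constant_form_span x : row_span (Phi mu nu F) (l *: x).
Proof.
have xh : shomog nu 0 (pol (l *: x) tt) by exact: (@pol_shomog n nu unit shift0 _ (l *: x) tt).
have [|v vE] := ideal_Phi_row Fh xh.
  rewrite polZ -mul_mpolyC mulrC -constant_formE.
  by apply: ideal_mull; [exact: ideal_gen_ideal | exact: ideal_gen_gen].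
by exists v; apply: (@pol_inj n nu unit shift0) => -[]; rewrite vE.
Qed.

Lemma constant_form_length0 (p : B) : prime_elt p -> ~ principal p l ->
  chain_over (principal p) (row_span (Phi mu nu F)) 0 /\
  ~ chain_over (principal p) (row_span (Phi mu nu F)) 1.
Proof.
move=> [_ [_ _ _]] pl; split.
  by exists (fun _ _ => True); split=> //; split=> // i _; split.
case=> C [[Csat Clt] C0]; have [_ [x [_ C0x]]] := Clt 0%N isT; apply: C0x.
have [_ _ Cs] := Csat 0%N isT; apply: (Cs l) => //.
exact/C0/constant_form_span.
Qed.

Lemma constant_form_length (p u : B) (kappa : fieldType) (rho : {rmorphism B -> kappa}) :
  prime_elt p -> (forall b, rho b = 0 <-> principal p b) -> frac_map rho ->
  koszul_generic (fun i => map_mpoly rho (F i)) -> u \is a GRing.unit -> l = u * p ->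
  chain_over (principal p) (row_span (Phi mu nu F)) (\prod_(j < n | j != i0) mu j)%N /\
  ~ chain_over (principal p) (row_span (Phi mu nu F)) (\prod_(j < n | j != i0) mu j)%N.+1.
Proof.
move=> pp rhoP rho_frac [L0 Lcop] uu lE; pose L i := map_mpoly rho (F i).
have Lh : homog_family mu L by move=> i; apply: map_dhomog.
have Li0 : L i0 = 0.
  rewrite /L constant_formE map_mpolyC; apply/eqP; rewrite mpolyC_eq0; apply/eqP/rhoP.
  by rewrite lE; exists u.
have pspan x : row_span (Phi mu nu F) (p *: x).
  have [v vE] := constant_form_span (u^-1 *: x); exists v.
  by rewrite -vE scalerA lE mulrAC divrr // mul1r.
have := corank_length pp rhoP rho_frac pspan.
rewrite (map_Phi mu nu (f := rho) (F' := L) (fun i => erefl)).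
suff -> : (#|{: piece n nu (shift0 : unit -> nat)}| - \rank (Phi mu nu L))%N =
  (\prod_(j < n | j != i0) mu j)%N by [].
have E : #|{: piece n nu (shift0 : unit -> nat)}| =
    (\rank (Phi mu nu L) + \prod_(j < n | j != i0) mu j)%N.
  clear pspan; case: n23 => E; subst n; first exact: corank_Phi2.
  by apply: corank_Phi3 => //; apply: Lcop.
by rewrite [X in (X - _)%N]E addKn.
Qed.

End ConstantFormLength.

(** * Degrees in the resolution *)

Section DegreeBound.
Variables (n : nat) (k : fieldType) (d : nat) (f : 'I_n.+1 -> {mpoly k[n]}).
Variables (mu : 'I_n -> nat) (P : 'M[{mpoly k[n]}]_(n.+1, n)).
Hypothesis Pmu : forall j i, P j i \is (mu i).-homog.
Hypothesis P_inj : forall v : 'cV_n, P *m v = 0 -> v = 0.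
Hypothesis fP : forall w : 'cV_n.+1, (\row_j f j) *m w = 0 <-> exists v, w = P *m v.

Lemma syzygy_exact (c : 'I_n.+1 -> {mpoly k[n]}) :
  \sum_j c j * f j = 0 <-> exists g : 'I_n -> {mpoly k[n]}, forall j, c j = \sum_i g i * P j i.
Proof.
split=> [cf|[g gE]].
  have [|v vE] := (fP (\col_j c j)).1.
    apply/matrixP => x y; rewrite !mxE -[RHS]cf; apply: eq_bigr => j _.
    by rewrite !mxE mulrC.
  exists (fun i => v i 0) => j; have := congr1 (fun M : 'cV_n.+1 => M j 0) vE.
  by rewrite !mxE => ->; apply: eq_bigr => i _; rewrite mulrC.
have : (\row_j f j) *m (\col_j c j) = 0.
  apply/fP; exists (\col_i g i); apply/matrixP => j z; rewrite !mxE gE.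
  by apply: eq_bigr => i _; rewrite !mxE mulrC.
move/(congr1 (fun M : 'M_1 => M 0 0)); rewrite !mxE => H; rewrite -[RHS]H.
by apply: eq_bigr => j _; rewrite !mxE mulrC.
Qed.

(** Stated for any family with the same syzygies as [f], since it is applied to [f] itself in three
    variables and to the minors of [P] in two. *)
Lemma rank_from_syzygies (e nu : nat) (F : 'I_n.+1 -> {mpoly k[n]}) :
  (forall i, F i \is e.-homog) ->
  (forall c, \sum_j c j * F j = 0 <-> \sum_j c j * f j = 0) ->
  (\rank (gmx nu (fun=> e) (shift0 : unit -> nat) (fun i _ => F i)) +
     \sum_i nmon n nu (mu i + e) = n.+1 * nmon n nu e)%N.
Proof.
move=> Fe Ff; pose H i j := P j i.
have Hg : graded (fun i => mu i + e)%N (fun=> e) H.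
  by move=> i j m /(dhomog_supp (Pmu j i)) ->.
have Fg : graded (fun=> e) (shift0 : unit -> nat) (fun i _ => F i).
  by move=> i u m /(dhomog_supp (Fe i)); rewrite addn0.
have := @gmx_exact n nu k _ _ _ _ _ _ H (fun i _ => F i) Hg Fg.
rewrite (@gmx_inj n nu k _ _ _ _ H Hg) => [|g gH]; last first.
  have g0 : \col_i g i = 0.
    apply: P_inj; apply/matrixP => j z; rewrite !mxE -[RHS](gH j).
    by apply: eq_bigr => i _; rewrite !mxE mulrC.
  by move=> i; have := congr1 (fun M : 'cV_n => M i 0) g0; rewrite !mxE.
move=> E; rewrite -card_piece E ?card_piece.
- by rewrite sum_nat_const card_ord.
- move=> i u; rewrite /H; have := (syzygy_exact (fun j => P j i)).2 _.
  move=> /(_ _)/Ff -> //; exists (fun i' => (i' == i)%:R) => j.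
  by rewrite (bigD1 i) //= eqxx mul1r big1 ?addr0 // => i' /negPf ->; rewrite mul0r.
- by move=> c cF; apply/syzygy_exact/Ff/cF.
Qed.

End DegreeBound.

(** The rank of [f] in degree [nu] is at most the number of monomials. With nu + 2 = x + d + s, the
    terms quadratic in x cancel, and the linear ones give 2s at most d + s. *)
Lemma degree_bound3 (k : fieldType) d (f : 'I_4 -> {mpoly k[3]}) (mu : 'I_3 -> nat)
    (P : 'M[{mpoly k[3]}]_(4, 3)) :
  graded_resolution d f mu P -> (\sum_i mu i <= d)%N.
Proof.
case=> fd Pmu P_inj fP; rewrite leqNgt; apply/negP; rewrite big_ord3 /=.
set m0 := mu o30; set m1 := mu o31; set m2 := mu o32; set s := (m0 + (m1 + m2))%N => ds.
(* [x] exceeds all the constants left after the cancellation, so that the linear term decides. *)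
have [x Kx] : exists x,
    ('C(d + s, 2) + ('C(m1 + m2, 2) + 'C(m0 + m2, 2) + 'C(m0 + m1, 2)) + 2 < x)%N.
  by eexists; apply: ltnSn.
pose nu := (x + d + s - 2)%N.
have := rank_from_syzygies Pmu P_inj fP nu fd (fun c => iff_refl _).
set G := gmx _ _ _ _; have := rank_leq_col G; move: (\rank G) => r.
rewrite card_piece big_unit1 big_ord3 /= /shift0 -/m0 -/m1 -/m2.
have nuE : nu.+2 = (x + (d + s))%N by rewrite /nu; lia.
rewrite !nmon3 ?nuE; [|rewrite /s; lia..].
have -> : (x + (d + s) - 0 = x + (d + s))%N by rewrite subn0.
have -> : (x + (d + s) - d = x + s)%N by lia.
have -> : (x + (d + s) - (m0 + d) = x + (m1 + m2))%N by rewrite /s; lia.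
have -> : (x + (d + s) - (m1 + d) = x + (m0 + m2))%N by rewrite /s; lia.
have -> : (x + (d + s) - (m2 + d) = x + (m0 + m1))%N by rewrite /s; lia.
rewrite !(bin2D x).
have : (x * d + x <= x * s)%N by rewrite addnC -mulnS leq_mul2l ds orbT.
have -> : (x * (d + s) = x * d + x * s)%N by rewrite mulnDr.
have : (x * s = x * m0 + x * m1 + x * m2)%N by rewrite /s !mulnDr addnA.
rewrite !mulnDr; lia.
Qed.

Section TwoVariables.
Variables (k : fieldType) (d : nat) (f : 'I_3 -> {mpoly k[2]}) (mu : 'I_2 -> nat).
Variable P : 'M[{mpoly k[2]}]_(3, 2).
Hypothesis hres : graded_resolution d f mu P.
Hypothesis f0 : exists i, f i != 0.
Local Notation s := (\sum_i mu i)%N.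

Definition minor2 (i j : 'I_3) := P i o20 * P j o21 - P i o21 * P j o20.
Definition minors (i : 'I_3) :=
  if i == o30 then minor2 o31 o32 else if i == o31 then minor2 o32 o30 else minor2 o30 o31.

Let fd i : f i \is d.-homog. Proof. by case: hres. Qed.
Let Pmu j i : P j i \is (mu i).-homog. Proof. by case: hres. Qed.
Let P_inj (v : 'cV_2) : P *m v = 0 -> v = 0. Proof. by case: hres => _ _ H _; apply: H. Qed.
Let fP (w : 'cV_3) : (\row_j f j) *m w = 0 <-> exists v, w = P *m v. Proof. by case: hres. Qed.

Lemma minors_homog i : minors i \is s.-homog.
Proof.
rewrite big_ord2 /= /minors /minor2.
have H a b : P a o20 * P b o21 - P a o21 * P b o20 \is (mu o20 + mu o21).-homog.
  by apply: rpredB; [|rewrite addnC]; apply: dhomogM.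
by case: ifP => _; [|case: ifP => _]; apply: H.
Qed.

Lemma minors_neq0 : exists i, minors i != 0.
Proof.
apply: boolp.contrapT => nm.
have {}nm i : minors i = 0 by apply: boolp.contrapT => /eqP mi; apply: nm; exists i.
have m01 := nm o32; have m12 := nm o30; have m20 := nm o31; rewrite /minors /= in m01 m12 m20.
have mm i j : minor2 i j = 0.
  have mN a b : minor2 a b = 0 -> minor2 b a = 0.
    by move=> ab; have -> : minor2 b a = - minor2 a b; [rewrite /minor2; ring | rewrite ab oppr0].
  case: (ord3E i) => ->; case: (ord3E j) => -> //; try exact: mN;
  by rewrite /minor2 mulrC subrr.
have P0 i j : P i j = 0.
  pose v : 'cV_2 := \col_l if l == o20 then - P i o21 else P i o20.
  have vE : v = 0.
    apply: P_inj; apply/matrixP => a z; rewrite !mxE big_ord2 !mxE /=.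
    by rewrite -[RHS](mm i a) /minor2; ring.
  have := congr1 (fun M : 'cV_2 => M o20 0) vE; have := congr1 (fun M : 'cV_2 => M o21 0) vE.
  by rewrite !mxE /=; case: (ord2E j) => -> // _ /eqP; rewrite oppr_eq0 => /eqP.
have /P_inj/(congr1 (fun M : 'cV_2 => M o20 0))/eqP : P *m (const_mx 1 : 'cV_2) = 0.
  by apply/matrixP => a z; rewrite !mxE; apply: big1 => j _; rewrite P0 mul0r.
by rewrite !mxE oner_eq0.
Qed.

(** Both [f] and the signed minors are orthogonal to the two columns of [P], as in the Hilbert-Burch
    theorem; the proportionality is an explicit combination of the two column relations. *)
Lemma minors_prop i j : f i * minors j = f j * minors i.
Proof.
have c0 : P o30 o20 * f o30 + (P o31 o20 * f o31 + P o32 o20 * f o32) = 0.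
  by have := syzygy_column fP o20; rewrite big_ord3.
have c1 : P o30 o21 * f o30 + (P o31 o21 * f o31 + P o32 o21 * f o32) = 0.
  by have := syzygy_column fP o21; rewrite big_ord3.
have e01 : f o30 * minors o31 - f o31 * minors o30 =
    P o32 o20 * (P o30 o21 * f o30 + (P o31 o21 * f o31 + P o32 o21 * f o32))
    - P o32 o21 * (P o30 o20 * f o30 + (P o31 o20 * f o31 + P o32 o20 * f o32)).
  by rewrite /minors /minor2 /=; ring.
have e12 : f o31 * minors o32 - f o32 * minors o31 =
    P o30 o20 * (P o30 o21 * f o30 + (P o31 o21 * f o31 + P o32 o21 * f o32))
    - P o30 o21 * (P o30 o20 * f o30 + (P o31 o20 * f o31 + P o32 o20 * f o32)).
  by rewrite /minors /minor2 /=; ring.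
have e02 : f o32 * minors o30 - f o30 * minors o32 =
    P o31 o20 * (P o30 o21 * f o30 + (P o31 o21 * f o31 + P o32 o21 * f o32))
    - P o31 o21 * (P o30 o20 * f o30 + (P o31 o20 * f o31 + P o32 o20 * f o32)).
  by rewrite /minors /minor2 /=; ring.
move: e01 e12 e02; rewrite c0 c1 !mulr0 subrr => /eqP; rewrite subr_eq0 => /eqP e01.
move=> /eqP; rewrite subr_eq0 => /eqP e12 /eqP; rewrite subr_eq0 => /eqP e02.
by case: (ord3E i) => ->; case: (ord3E j) => ->.
Qed.

Lemma minors_syzygies c : \sum_j c j * minors j = 0 <-> \sum_j c j * f j = 0.
Proof.
have [a ma] := minors_neq0; have [b fb] := f0; split=> E.
  apply/eqP; have : minors a * (\sum_j c j * f j) = f a * (\sum_j c j * minors j).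
    rewrite !mulr_sumr; apply: eq_bigr => j _.
    by rewrite mulrCA [minors a * _]mulrC minors_prop; ring.
  by rewrite E mulr0 => /eqP; rewrite mulf_eq0 (negPf ma).
apply/eqP; have : f b * (\sum_j c j * minors j) = minors b * (\sum_j c j * f j).
  rewrite !mulr_sumr; apply: eq_bigr => j _.
  by rewrite mulrCA minors_prop; ring.
by rewrite E mulr0 => /eqP; rewrite mulf_eq0 (negPf fb).
Qed.

(** In degree 2s the rank formula gives 3(s+1) - (s+1-mu_0) - (s+1-mu_1) = 2s+1, the number of all
    monomials, so the minors generate everything there. *)
Lemma minors_primary v : exists a : 'I_3 -> {mpoly k[2]},
  (forall j m, m \in msupp (a j) -> (mdeg m + s = 2 * s)%N) /\
  'X_v ^+ (2 * s) = \sum_j a j * minors j.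
Proof.
pose nu := (2 * s)%N.
have := rank_from_syzygies Pmu P_inj fP nu minors_homog minors_syzygies.
set G := gmx _ _ _ _ => rk.
have Gg : graded (fun=> s) (shift0 : unit -> nat) (fun i (_ : unit) => minors i).
  by move=> i u m /(dhomog_supp (minors_homog i)); rewrite addn0.
have full : row_full G.
  rewrite /row_full; apply/eqP; move: rk; move: (\rank G) => r.
  rewrite card_piece big_unit1 /shift0 {1}big_ord2 /= !nmon2; rewrite /nu big_ord2 /=; lia.
have /row_fullP[T TG] := full.
pose x := vec nu (shift0 : unit -> nat) (fun=> 'X_v ^+ nu : {mpoly k[2]}).
exists (pol (x *m T)); split; first by move=> j m /pol_shomog.
have := gmxE (x *m T) tt Gg; rewrite -/G -mulmxA TG mulmx1 => <-.
rewrite vecK pr_id // => m; rewrite /shift0 addn0.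
exact: (dhomog_supp (dhomog_Xn _ _ _)).
Qed.

(** [g] is the common factor in f_j = g minors_j. It exists because powers of two coprime variables
    are combinations of the minors, and for the same reason its products with these powers lie in
    the ideal. Its degree d - s bounds the initial degree of the saturation. *)
Lemma saturation_elt : exists g, [/\ saturation (ideal_gen f) g, g != 0
  & forall m, m \in msupp g -> (mdeg m + s = d)%N].
Proof.
have [a0 [a0d a0E]] := minors_primary o20; have [a1 [a1d a1E]] := minors_primary o21.
set N := (2 * s)%N in a0E a1E a0d a1d.
have hE (a : 'I_3 -> {mpoly k[2]}) j :
    (\sum_l a l * minors l) * f j = (\sum_l a l * f l) * minors j.
  by rewrite !mulr_suml; apply: eq_bigr => l _; rewrite -!mulrA [minors l * _]mulrC minors_prop.
pose h0 := \sum_l a0 l * f l; pose h1 := \sum_l a1 l * f l.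
have pX := @prime_elt_X k 1 o20; have [X0 _] := pX.
have h01 : h0 * 'X_o21 ^+ N = h1 * 'X_o20 ^+ N.
  have [j mj] := minors_neq0; apply: (mulIf mj).
  by rewrite mulrAC -hE [RHS]mulrAC -hE -a0E -a1E; ring.
have [g gE] : principal ('X_o20 ^+ N) h0.
  apply: (@prime_eltX_cancel _ _ ('X_o21 ^+ N)) => //.
    by move/(prime_elt_dvdX pX); apply: (@prime_X_neq k 1).
  by exists h1; rewrite mulrC.
have fE j : f j = g * minors j.
  apply: (mulIf (expf_neq0 N X0)); rewrite [LHS]mulrC {1}a0E hE -/h0 gE; ring.
have h1E : h1 = g * 'X_o21 ^+ N.
  by apply: (mulIf (expf_neq0 N X0)); rewrite -h01 gE; ring.
have Ih a : ideal_gen f (\sum_l a l * f l) by exists a.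
exists g; split.
- apply: saturation_X; first exact: ideal_gen_ideal.
  by move=> i; exists N; case: (ord2E i) => ->; rewrite mulrC; [rewrite -gE|rewrite -h1E]; apply: Ih.
- by have [j fj] := f0; apply: contra_neq fj => g0; rewrite fE g0 mul0r.
move=> m mg.
have h0d : h0 \is (s + d).-homog.
  apply: rpred_sum => l _; apply: dhomogM => //; apply/dhomogP => m' /a0d.
  by rewrite /N mul2n -addnn => /addIn.
have mh : (U_(o20) *+ N + m)%MM \in msupp h0.
  by rewrite mcoeff_msupp gE mpolyXn mcoeffMX -mcoeff_msupp.
have := dhomog_supp h0d mh; rewrite mdegD mdegMn mdeg1 mul1n /N mul2n -addnn -addnA.
by move/addnI; rewrite addnC.
Qed.

End TwoVariables.

(** * Genericity of the syzygy forms modulo a prime *)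

Definition degree_le n (R : nzRingType) e (p : {mpoly R[n]}) :=
  forall w, w \in msupp p -> (mdeg w <= e)%N.

Lemma degree_leM n (R : comNzRingType) e1 e2 (p q : {mpoly R[n]}) :
  degree_le e1 p -> degree_le e2 q -> degree_le (e1 + e2) (p * q).
Proof.
move=> pe qe w /msuppM_le /allpairsP[[w1 w2] /= [w1p w2q ->]].
by rewrite mdegD leq_add ?pe ?qe.
Qed.

Lemma degree_leX n (R : comNzRingType) e (p : {mpoly R[n]}) N :
  degree_le e p -> degree_le (N * e) (p ^+ N).
Proof.
move=> pe; elim: N => [|N IH]; last by rewrite exprS mulSn; apply: degree_leM.
by move=> w; rewrite expr0 -mpolyC1 msupp1 inE => /eqP ->; rewrite mdeg0.
Qed.

Lemma degree_le_prod n (R : comNzRingType) r e (p : 'I_r -> {mpoly R[n]}) :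
  (forall i, degree_le e (p i)) -> degree_le (r * e) (\prod_i p i).
Proof.
elim: r p => [|r IH] p pe; last first.
  by rewrite big_ord_recl mulSn; apply: degree_leM => //; apply: IH.
by move=> w; rewrite big_ord0 -mpolyC1 msupp1 inE => /eqP ->; rewrite mdeg0.
Qed.

(* The (N+1)^(m+1) monomials of bounded exponents in y_0, ..., y_m have degree
   O(N) in m variables, so for large N they are linearly dependent. *)
Lemma algebraic_dependence (k : fieldType) m (y : 'I_m.+1 -> {mpoly k[m]}) :
  exists Q : {mpoly k[m.+1]}, Q != 0 /\ mmap (@mpolyC m k) y Q = 0.
Proof.
pose D := (\max_i msize (y i))%N.
have yD i : degree_le D (y i).
  by move=> w /msize_mdeg_lt/ltnW wy; apply: leq_trans wy _; apply: (leq_bigmax i).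
(* This value makes M^m at most N (N+1)^m, which is less than (N+1)^(m+1). *)
have [N NE] : exists N, N = ((m.+1 * D).+1 ^ m)%N by eexists.
pose M := (m.+1 * (N * D)).+1.
pose rowT := {ffun 'I_m.+1 -> 'I_N.+1}; pose colT := {ffun 'I_m -> 'I_M}.
pose wr (r : rowT) : 'X_{1..m.+1} := [multinom (r i : nat) | i < m.+1].
pose wc (c : colT) : 'X_{1..m} := [multinom (c i : nat) | i < m].
pose mon (r : rowT) : {mpoly k[m]} := mmap1 y (wr r).
have monM r : degree_le M.-1 (mon r).
  apply: (degree_le_prod (e := (N * D)%N)) => i w wi.
  have := degree_leX (N := wr r i) (yD i) wi; move/leq_trans; apply.
  by rewrite leq_mul2r mnmE -ltnS ltn_ord orbT.
pose A : 'M[k]_(#|{: rowT}|, #|{: colT}|) :=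
  \matrix_(i, j) (mon (enum_val i))@_(wc (enum_val j)).
have card_lt : (#|{: colT}| < #|{: rowT}|)%N.
  rewrite !card_ffun !card_ord; apply: (@leq_ltn_trans (N * N.+1 ^ m)%N); last first.
    by rewrite expnS ltn_mul2r expn_gt0 /=.
  have exp_le a b e : (a <= b)%N -> (a ^ e <= b ^ e)%N.
    by case: e => [|e] ab; rewrite ?expn0 // leq_exp2r.
  rewrite {1}NE -expnMn; apply: exp_le.
  have -> : M = (m.+1 * D * N).+1 by rewrite /M mulnA mulnAC.
  by rewrite mulSn mulnS; lia.
have [v v0 vA] : exists2 v : 'rV[k]_#|{: rowT}|, v != 0 & v *m A = 0.
  have : kermx A != 0.
    by rewrite kermx_eq0 /row_free neq_ltn (leq_ltn_trans (rank_leq_col A)).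
  case/rowV0Pn => v /sub_kermxP vA v0; exists v => //.
pose Q : {mpoly k[m.+1]} := \sum_i v 0 i *: 'X_[wr (enum_val i)].
exists Q; split.
  have [i vi] : exists i, v 0 i != 0.
    apply: boolp.contrapT => nv; case/eqP: v0; apply/rowP => i; rewrite mxE.
    by apply: boolp.contrapT => /eqP vi; apply: nv; exists i.
  apply: contraNneq vi => Q0; have := congr1 (mcoeff (wr (enum_val i))) Q0.
  rewrite mcoeff0 /Q raddf_sum (bigD1 i) //= mcoeffZ mcoeffX eqxx mulr1.
  rewrite big1 ?addr0 => [->|j ji] //; rewrite mcoeffZ mcoeffX.
  case: eqP => [E|]; last by rewrite mulr0.
  case/eqP: ji; apply: enum_val_inj; apply/ffunP => a; apply: val_inj.
  by have := congr1 (fun w : 'X_{1..m.+1} => w a) E; rewrite !mnmE.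
have -> : mmap (@mpolyC m k) y Q = \sum_i v 0 i *: mon (enum_val i).
  rewrite /Q rmorph_sum; apply: eq_bigr => i _ /=.
  by rewrite -mul_mpolyC rmorphM /= mmapC mmapX mul_mpolyC.
apply/mpolyP => w; rewrite mcoeff0 raddf_sum /=.
have [wM|wM] := leqP (mdeg w) M.-1; last first.
  apply: big1 => i _; rewrite mcoeffZ; apply/eqP; rewrite mulf_eq0 mcoeff_eq0; apply/orP; right.
  by apply/negP => /monM; rewrite leqNgt wM.
have wi i : (w i < M)%N.
  by rewrite /M ltnS; apply: leq_trans wM; rewrite mdegE (bigD1 i) //= leq_addr.
pose c : colT := [ffun i => Ordinal (wi i)].
have wcE : wc c = w by apply/mnmP => i; rewrite mnmE ffunE.
have := congr1 (fun r : 'rV_#|{: colT}| => r 0 (enum_rank c)) vA; rewrite !mxE => H; rewrite -[RHS]H.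
by apply: eq_bigr => i _; rewrite mcoeffZ mxE enum_rankK wcE.
Qed.

(** If each of m + 1 independent elements were a polynomial in m generators, [algebraic_dependence]
    would give a relation between them. *)
Lemma transcendence_bound (k : fieldType) m (E : comNzRingType)
    (ev : {rmorphism {mpoly k[m]} -> E}) (h : {rmorphism {mpoly k[m.+1]} -> E}) :
  (forall x, h x = 0 -> x = 0) -> (forall c, h c%:MP = ev c%:MP) ->
  ~ (forall i, exists y, h 'X_i = ev y).
Proof.
move=> h_inj hC /boolp.choice[y yE]; have [Q [Q0 Qy]] := algebraic_dependence y.
case/eqP: Q0; apply: h_inj; rewrite -(rmorph0 ev) -Qy.
apply: (@mpoly_rmorph_ext _ _ _ h (ev \o mmap (@mpolyC m k) y)) => [c|i] /=.
  by rewrite mmapC hC.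
by rewrite mmapX mmap1U yE.
Qed.

Lemma polyC_mul_eq0 (R : idomainType) (g p : {poly R}) c :
  (1 < size p)%N -> c%:P = g * p -> c = 0.
Proof.
move=> p1 gE; apply/eqP; rewrite -polyC_eq0 gE mulf_eq0; apply/orP; left.
apply/negPn/negP => g0; have p0 : p != 0 by rewrite -size_poly_gt0 ltnW.
have : (size (g * p)%R <= 1)%N by rewrite -gE size_polyC leq_b1.
rewrite size_mul // leqNgt; move: p1 g0; rewrite -size_poly_gt0.
lia.
Qed.

Lemma uni_lift_dvd (R : idomainType) n (v : 'I_n.+1) (p : {mpoly R[n.+1]}) c :
  (1 < size (uni v p))%N -> principal p (lift_var v c) -> c = 0.
Proof.
move=> p1 [g gE]; apply: (polyC_mul_eq0 (g := uni v g) p1).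
by rewrite -(uni_lift v) gE; apply: (rmorphM (@uni R n v)).
Qed.

Section GenericPoint.
Variables (n : nat) (k : fieldType) (kappa Omega : fieldType).
Variables (rho : {rmorphism {mpoly k[n.+1]} -> kappa}) (p : {mpoly k[n.+1]}).
Hypotheses (pp : prime_elt p) (rhoP : forall b, rho b = 0 <-> principal p b).
Variables (psi : {rmorphism {mpoly kappa[n]} -> Omega}).
Variables (r2 : {rmorphism {mpoly kappa[2]} -> Omega}) (a : 'I_2 -> 'I_n).
Hypotheses (r2_inj : forall x, r2 x = 0 -> x = 0) (r2C : forall c, r2 c%:MP = psi c%:MP)
  (r2X : forall i, r2 'X_i = psi 'X_(a i)).
Variables (f : 'I_n.+1 -> {mpoly k[n]}).

Definition point_map : {rmorphism {mpoly k[n]} -> Omega} :=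
  psi \o map_mpoly (rho \o @mpolyC n.+1 k).

(* k(T mod p) has transcendence degree n over k, so T_j = s f_j(x) would embed
   n + 2 independent elements into a field generated by x_1, ..., x_n, s. *)
Lemma generic_point_not_proportional (s : Omega) :
  ~ (forall j, psi (rho 'X_j)%:MP = point_map (f j) * s).
Proof.
(* [p] involves the variable T_w, so the other n variables T stay independent modulo [p]; with the
   two independent coordinates of x this makes n + 2. *)
move=> ts; have [w pw] := prime_elt_nonconst pp.
pose sigma : {rmorphism {mpoly k[n]} -> kappa} := rho \o lift_var w.
have sigma_inj x : sigma x = 0 -> x = 0 by move/rhoP/(uni_lift_dvd pw).
pose spl : {rmorphism {mpoly k[2 + n]} -> {mpoly {mpoly k[n]}[2]}} :=
  mmap (@mpolyC 2 {mpoly k[n]} \o @mpolyC n k)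
    (fun i => match split i with inl j => 'X_j | inr j => ('X_j)%:MP end).
pose unspl : {rmorphism {mpoly {mpoly k[n]}[2]} -> {mpoly k[2 + n]}} :=
  mmap (mmap (@mpolyC (2 + n) k) (fun j => 'X_(rshift 2 j))) (fun j => 'X_(lshift n j)).
have splC c : spl c%:MP = (c%:MP)%:MP by exact: mmapC.
have splX i : spl 'X_i = match split i with inl j => 'X_j | inr j => ('X_j)%:MP end.
  by rewrite /spl /= mmapX mmap1U.
have splK x : unspl (spl x) = x.
  apply: (@mpoly_rmorph_ext _ _ _ (unspl \o spl) idfun) => [c|i] /=.
    by rewrite splC /unspl /= mmapC /= mmapC.
  rewrite splX; case: splitP => j ij; rewrite /unspl /=.
    by rewrite mmapX mmap1U; congr 'X_(_); apply: val_inj.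
  by rewrite mmapC /= mmapX mmap1U; congr 'X_(_); apply: val_inj.
pose h : {rmorphism {mpoly k[2 + n]} -> Omega} := (r2 \o map_mpoly sigma) \o spl.
have h_inj x : h x = 0 -> x = 0.
  move/r2_inj => E; rewrite -(splK x); suff -> : spl x = 0 by rewrite rmorph0.
  apply/mpolyP => u; rewrite mcoeff0; apply: sigma_inj.
  by have := congr1 (mcoeff u) E; rewrite /= mcoeff_map_mpoly mcoeff0.
pose x i := if unlift ord_max i is Some j then psi 'X_j else s.
pose ev : {rmorphism {mpoly k[n.+1]} -> Omega} :=
  mmap ((psi \o @mpolyC n kappa) \o (rho \o @mpolyC n.+1 k)) x.
have evX i : ev 'X_i = x i by rewrite /ev /= mmapX mmap1U.
have evC c : ev c%:MP = psi (rho c%:MP)%:MP by exact: mmapC.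
have evA q : ev (lift_var ord_max q) = point_map q.
  apply: (@mpoly_rmorph_ext _ _ _ (ev \o lift_var ord_max) point_map) => [c|i].
    by rewrite -[LHS]/(ev (lift_var ord_max c%:MP)) lift_varC evC /point_map /= map_mpolyC.
  by rewrite -[LHS]/(ev (lift_var ord_max 'X_i)) lift_varX evX /x liftK /point_map /= map_mpolyX.
apply: (@transcendence_bound k n.+1 Omega ev h h_inj) => [c|i].
  by rewrite evC /h /= splC map_mpolyC /= lift_varC r2C.
rewrite /h /= splX; case: splitP => j _.
  by exists 'X_(lift ord_max (a j)); rewrite evX /x liftK /= map_mpolyX r2X.
exists (lift_var ord_max (f (lift w j)) * 'X_ord_max).
by rewrite rmorphM evA evX /x unlift_none /= map_mpolyC /= lift_varX r2C ts.
Qed.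

End GenericPoint.

(** * A base locus containing a curve is infinite *)

Lemma root_extension (F : fieldType) (u : {poly F}) : (1 < size u)%N ->
  exists (E : fieldType) (iota : {rmorphism {poly F} -> E}), iota u = 0.
Proof.
move=> u1; have [|N [c cE]|q [qp uq _]] := @krull_prime {poly F} (principal u) 1.
- exact: principal_ideal.
- have : (1 : F) = 0 by apply: (polyC_mul_eq0 (g := c) u1); rewrite -cE expr1n.
  by move/eqP; rewrite oner_eq0.
have [E [rho [rhoP _]]] := quot_field qp.
by exists E, rho; apply/rhoP/uq/principal_refl.
Qed.

(* The Euclid trick: u = 1 + w lead(q) has a root where the leading coefficient of q survives. *)
Lemma curve_point (F : fieldType) (q : {poly {poly F}}) (u w : {poly F}) :
  (1 < size q)%N -> (1 < size u)%N -> u = 1 + w * lead_coef q ->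
  exists (E : fieldType) (chi : {rmorphism {poly {poly F}} -> E}), chi u%:P = 0 /\ chi q = 0.
Proof.
move=> q1 u1 uE; have [E1 [io io0]] := root_extension u1.
have lc : io (lead_coef q) != 0.
  apply/eqP => l0; move: io0; rewrite uE rmorphD rmorph1 rmorphM l0 mulr0 addr0.
  by move/eqP; rewrite oner_eq0.
have q1' : (1 < size (map_poly io q))%N by rewrite size_map_poly_id0.
have [E [io' io'0]] := root_extension q1'.
exists E, (io' \o map_poly io); split=> //.
by rewrite /= map_polyC /= io0 rmorph0.
Qed.

Section PseudoGenerator.
Variables (D : idomainType) (Omega : fieldType) (chi : {rmorphism {poly D} -> Omega}).
Hypothesis chi_inj : forall c, chi c%:P = 0 -> c = 0.

(** An element of least degree in the kernel generates it after inverting its leading coefficient,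
    by pseudo-division. If the kernel is 0, any nonconstant polynomial serves, and X is taken. *)
Lemma kernel_pseudo_generator : exists q : {poly D}, (1 < size q)%N /\
  forall g, chi g = 0 -> exists e h, lead_coef q ^+ e *: g = h * q.
Proof.
have [[g0 g00 cg0]|ng] := boolp.pselect (exists2 g, g != 0 & chi g = 0); last first.
  exists 'X; split=> [|g cg]; first by rewrite size_polyX.
  have -> : g = 0 by apply: boolp.contrapT => /eqP g0; apply: ng; exists g.
  by exists 0%N, 0; rewrite scaler0 mul0r.
pose Q N := boolp.asbool (exists q : {poly D}, [/\ q != 0, chi q = 0 & size q = N]).
have exQ : exists N, Q N by exists (size g0); apply/boolp.asboolP; exists g0.
case: (ex_minnP exQ) => N /boolp.asboolP[q [q0 cq qN]] Nmin.
exists q; split.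
  rewrite ltnNge; apply/negP => /size1_polyC qE.
  case/eqP: q0; rewrite qE; apply/eqP; rewrite polyC_eq0; apply/eqP/chi_inj.
  by rewrite -qE.
move=> g cg; exists (Pdiv.IdomainDefs.scalp g q), (Pdiv.IdomainDefs.divp g q).
rewrite Pdiv.Idomain.divp_eq; set r := Pdiv.IdomainDefs.modp g q.
suff -> : r = 0 by rewrite addr0.
apply/eqP/negPn/negP => r0.
have cr : chi r = 0.
  have := congr1 chi (Pdiv.Idomain.divp_eq g q).
  by rewrite -mul_polyC !(rmorphD, rmorphM) /= cg cq !mulr0 add0r.
have := Nmin (size r); rewrite -qN leqNgt Pdiv.Idomain.ltn_modpN0 // => H.
by have : false; [apply: H; apply/boolp.asboolP; exists r|].
Qed.

End PseudoGenerator.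

Lemma homog_scaling n (R S : comNzRingType) (al be : {rmorphism {mpoly R[n]} -> S}) c e p :
  (forall a, be a%:MP = al a%:MP) -> (forall i, be 'X_i = c * al 'X_i) ->
  p \is e.-homog -> be p = c ^+ e * al p.
Proof.
move=> C X ph; rewrite [in LHS](mpolyE p) [in RHS](mpolyE p) !rmorph_sum mulr_sumr.
rewrite [LHS]big_seq [RHS]big_seq; apply: eq_bigr => m /(dhomog_supp ph) mE.
rewrite -!mul_mpolyC !rmorphM C mulrCA; congr (_ * _).
rewrite -mE mdegE mpolyXE_id !rmorph_prod -prodrXr -big_split /=.
by apply: eq_bigr => i _; rewrite !rmorphXn X exprMn.
Qed.

Section ConePoint.
Variables (n : nat) (k E : fieldType) (al : {rmorphism {mpoly k[n]} -> E}).

(* X_i |-> x_i s: the kernel is the homogeneous prime ideal of the point x. *)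
Definition cone : {rmorphism {mpoly k[n]} -> {poly E}} :=
  mmap (@polyC E \o (al \o @mpolyC n k)) (fun i => 'X * (al 'X_i)%:P).

Lemma coneE e p : p \is e.-homog -> cone p = 'X ^+ e * (al p)%:P.
Proof.
apply: (@homog_scaling n k {poly E} (@polyC E \o al) cone) => [a|i].
  by rewrite /cone /= mmapC.
by rewrite /cone /= mmapX mmap1U.
Qed.

Lemma cone_homog0 e p : p \is e.-homog -> cone p = 0 <-> al p = 0.
Proof.
move=> /coneE ->; split=> [/eqP|->]; last by rewrite mulr0.
by rewrite mulf_eq0 expf_eq0 polyX_eq0 andbF polyC_eq0 => /eqP.
Qed.

Lemma coef_cone e p : (cone p)`_e = al (pihomog mdeg e p).
Proof.
have cE : cone p = \sum_(m <- msupp p) cone (p@_m)%:MP * cone 'X_[m].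
  rewrite [in LHS](mpolyE p) (rmorph_sum cone); apply: eq_bigr => m _.
  by rewrite -mul_mpolyC (rmorphM cone).
rewrite pihomogE cE (rmorph_sum al) coef_sum [RHS]big_mkcond; apply: eq_bigr => m _.
rewrite -mul_mpolyC (rmorphM al).
have mh : ('X_[m] : {mpoly k[n]}) \is (mdeg m).-homog by apply/dhomogP => w; rewrite msuppX inE => /eqP ->.
have -> : cone (p@_m)%:MP = (al (p@_m)%:MP)%:P by exact: mmapC.
rewrite (coneE mh) mulrCA -polyCM mulrC coefCM coefXn.
by rewrite [e == _]eq_sym; case: eqP => _; rewrite ?mulr1 // mulr0.
Qed.

Lemma cone_proj_point i : al 'X_i != 0 -> proj_point (fun p => cone p = 0).
Proof.
move=> xi; split.
- split; [split|by rewrite rmorph1; apply/eqP/oner_neq0|].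
  + exact: rmorph0.
  + by move=> a x y x0 y0; rewrite rmorphD rmorphM x0 y0 mulr0 addr0.
  + by move=> x y /eqP; rewrite rmorphM mulf_eq0 => /orP[]/eqP; [left|right].
- move=> x e x0; apply/(cone_homog0 (pihomogP mdeg e x)).
  by rewrite -coef_cone x0 coef0.
- exists i => /eqP; rewrite /cone /= mmapX mmap1U mulf_eq0 polyX_eq0 polyC_eq0.
  by rewrite (negPf xi).
Qed.

End ConePoint.

Section Dehomogenization.
Variables (k : fieldType) (v : 'I_3).

(** The affine chart in which the second variable other than [v] equals 1; [X_v] becomes the outer
    variable and the first other one the inner variable. *)
Definition dehom : {rmorphism {mpoly k[3]} -> {poly {poly k}}} :=
  mmap (@polyC {poly k} \o @polyC k)
    (fun i => if unlift v i is Some j then (if j == o20 then 'X%:P else 1) else 'X).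

Lemma dehomC c : dehom c%:MP = c%:P%:P. Proof. exact: mmapC. Qed.

Lemma dehomX i :
  dehom 'X_i = if unlift v i is Some j then (if j == o20 then 'X%:P else 1) else 'X.
Proof. by rewrite /dehom /= mmapX mmap1U. Qed.

(** Homogenization in degree [size c], one more than the degree of a nonzero [c]; the surplus factor
    becomes 1 in the chart. *)
Definition hom2 (c : {poly k}) : {mpoly k[2]} :=
  \sum_(i < size c) (c`_i)%:MP * ('X_o20 ^+ i * 'X_o21 ^+ (size c - i)).

Lemma hom2_homog c : hom2 c \is (size c).-homog.
Proof.
apply: rpred_sum => i _.
have H : ('X_o20 ^+ i * 'X_o21 ^+ (size c - i) : {mpoly k[2]})
    \is (i + (size c - i)).-homog.
  by apply: dhomogM; apply: dhomog_Xn.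
by rewrite mul_mpolyC; apply: rpredZ; move: H; rewrite subnKC // ltnW.
Qed.

Lemma dehom_hom2 c : dehom (lift_var v (hom2 c)) = c%:P.
Proof.
transitivity (\sum_(i < size c) ((c`_i *: 'X^i)%:P : {poly {poly k}})); last first.
  by rewrite -rmorph_sum -poly_def coefK.
pose del : {rmorphism {mpoly k[2]} -> {poly {poly k}}} := dehom \o lift_var v.
have delC a : del a%:MP = a%:P%:P by rewrite -[LHS]/(dehom (lift_var v a%:MP)) lift_varC dehomC.
have delX l : del 'X_l = if l == o20 then 'X%:P else 1.
  by rewrite -[LHS]/(dehom (lift_var v 'X_l)) lift_varX dehomX liftK.
rewrite -[LHS]/(del (hom2 c)) /hom2 (rmorph_sum del); apply: eq_bigr => i _.
rewrite !(rmorphM del) !(rmorphXn del) !delX delC /=.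
by rewrite expr1n mulr1 -mul_polyC polyCM rmorphXn.
Qed.

End Dehomogenization.

Section InfiniteLocus.
Variables (k : fieldType) (d : nat) (f : 'I_4 -> {mpoly k[3]}) (v : 'I_3).
Variables (Omega : fieldType) (phi : {rmorphism {mpoly k[3]} -> Omega}).
Hypotheses (fd : forall j, f j \is d.-homog) (phif : forall j, phi (f j) = 0).
Hypothesis phi_inj : forall g, phi (lift_var v g) = 0 -> g = 0.

Local Notation Xb := ('X_(lift v o21) : {mpoly k[3]}).

(** Dividing the coordinates of the point by the one that the chart sets to 1 rescales homogeneous
    forms by a power of it. The forms f_j thus still vanish, and the inner variable remains
    transcendental. *)
Lemma dehom_kernel : exists chi : {rmorphism {poly {poly k}} -> Omega},
  (forall c, chi c%:P = 0 -> c = 0) /\ forall j, chi (dehom k v (f j)) = 0.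
Proof.
have xb0 : phi Xb != 0.
  rewrite -lift_varX; apply/eqP => /phi_inj/eqP.
  by rewrite (negPf (mpolyX_neq0 _ _)).
pose eta : {rmorphism {poly k} -> Omega} :=
  horner_eval (phi 'X_(lift v o20) / phi Xb) \o map_poly (phi \o @mpolyC 3 k).
pose chi : {rmorphism {poly {poly k}} -> Omega} :=
  horner_eval (phi 'X_v / phi Xb) \o map_poly eta.
have etaC c : eta c%:P = phi c%:MP by rewrite /eta /= map_polyC /= horner_evalE hornerC.
have etaX : eta 'X = phi 'X_(lift v o20) / phi Xb.
  by rewrite /eta /= map_polyX horner_evalE hornerX.
have chiC c : chi c%:P = eta c by rewrite /chi /= map_polyC horner_evalE hornerC.
have chiX : chi 'X = phi 'X_v / phi Xb by rewrite /chi /= map_polyX horner_evalE hornerX.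
pose al : {rmorphism {mpoly k[3]} -> Omega} := chi \o dehom k v.
have alC c : phi c%:MP = al c%:MP by rewrite -[RHS]/(chi (dehom k v c%:MP)) dehomC chiC etaC.
have alX i : phi 'X_i = phi Xb * al 'X_i.
  rewrite -[al _]/(chi (dehom k v 'X_i)) dehomX; case: (unliftP v i) => [j|] ->; last first.
    by rewrite chiX mulrC divfK.
  have chiT : chi 'X%:P = phi 'X_(lift v o20) / phi Xb by rewrite -etaX; apply: chiC.
  case: (ord2E j) => ->; first by rewrite eqxx chiT mulrC divfK.
  have -> : (o21 == o20) = false by [].
  by rewrite (rmorph1 chi) mulr1.
exists chi; split=> [c c0|j].
  suff h0 : hom2 c = 0.
    by apply/eqP; rewrite -polyC_eq0 -(dehom_hom2 v) h0 !rmorph0.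
  apply: phi_inj.
  apply: etrans (@homog_scaling 2 k Omega (al \o lift_var v) (phi \o lift_var v) (phi Xb)
     (size c) (hom2 c) _ _ (hom2_homog c)) _ => [a|i|]; last first.
  - by rewrite -[X in _ * X]/(chi (dehom k v (lift_var v (hom2 c)))) dehom_hom2 c0 mulr0.
  - rewrite -[LHS]/(phi (lift_var v 'X_i)) -[X in _ * X]/(al (lift_var v 'X_i)) lift_varX.
    exact: alX.
  - by rewrite -[LHS]/(phi (lift_var v a%:MP)) -[RHS]/(al (lift_var v a%:MP)) lift_varC alC.
apply/eqP; have /eqP := homog_scaling alC alX (fd j).
by rewrite phif eq_sym mulf_eq0 expf_eq0 (negPf xb0) andbF.
Qed.

(** Euclid's argument produces infinitely many pairwise comaximal polynomials in the inner variable,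
    over a finite field as well. A root of each extends to a point of the curve, and these points
    are distinct. *)
Lemma infinite_locus : ~ finitely_many (proj_locus (ideal_gen f)).
Proof.
have [chi [chi_inj chif]] := dehom_kernel.
have [q [q1 qgen]] := kernel_pseudo_generator chi_inj.
(* [Pi m] is the leading coefficient of [q] times all the earlier [u i]. Hence [u m] is 1 modulo
   that coefficient and modulo each earlier [u i]. *)
pose Pi m := iter m (fun c => c * (1 + 'X * c)) (lead_coef q).
pose u m := 1 + 'X * Pi m.
have q0 : lead_coef q != 0 by rewrite lead_coef_eq0 -size_poly_gt0 ltnW.
have Pi0 m : Pi m != 0.
  elim: m => [|m IH] //; rewrite /Pi iterS -/(Pi m) mulf_neq0 //.
  apply/eqP => /(congr1 (coefp 0)); rewrite /= coefD coef1 coefXM coef0 addr0.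
  by move/eqP; rewrite oner_eq0.
have u1 m : (1 < size (u m))%N.
  have s2 : (1 < size ('X * Pi m)%R)%N.
    by rewrite mulrC size_mulX // ltnS size_poly_gt0.
  by rewrite /u addrC size_polyDl // size_poly1.
have uw m : exists w, u m = 1 + w * lead_coef q.
  suff [w wE] : exists w, Pi m = w * lead_coef q.
    by exists ('X * w); rewrite /u wE mulrA.
  elim: m => [|m [w wE]]; first by exists 1; rewrite mul1r.
  exists (w * (1 + 'X * Pi m)); rewrite /Pi iterS -/(Pi m) {1}wE; ring.
have Piu m m' : (m < m')%N -> exists c, Pi m' = c * u m.
  elim: m' => // m' IH; rewrite ltnS leq_eqVlt => /orP[/eqP->|/IH[c cE]].
    by exists (Pi m').
  exists (c * (1 + 'X * Pi m')); rewrite /Pi iterS -/(Pi m') {1}cE; ring.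
pose U (c : {poly k}) : {mpoly k[3]} := lift_var v (hom2 c).
(* The last condition separates the points: where [u m] vanishes, no polynomial congruent to 1
   modulo [u m] does. *)
have /boolp.choice[p pP] m : exists p, [/\ proj_locus (ideal_gen f) p, p (U (u m))
    & forall c c', p (U c) -> ~ p (U (1 + c' * c))].
  have [w wE] := uw m; have [E [psi [psiu psiq]]] := curve_point q1 (u1 m) wE.
  pose al : {rmorphism {mpoly k[3]} -> E} := psi \o dehom k v.
  have alU c : cone al (U c) = 0 <-> psi c%:P = 0.
    have Uh : cone al (U c) = 'X ^+ size c * (psi c%:P)%:P.
      rewrite -(dehom_hom2 v) -/(U c).
      apply: (@homog_scaling 2 k {poly E} ((@polyC E \o al) \o lift_var v)
        (cone al \o lift_var v) 'X (size c) (hom2 c)) => [a|i|]; last exact: hom2_homog.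
        rewrite -[LHS]/(cone al (lift_var v a%:MP)) -[RHS]/((al (lift_var v a%:MP))%:P).
        by rewrite lift_varC /cone /= mmapC.
      rewrite -[LHS]/(cone al (lift_var v 'X_i)) -[X in _ * X]/((al (lift_var v 'X_i))%:P).
      by rewrite lift_varX /cone /= mmapX mmap1U.
    rewrite Uh; split=> [/eqP|->]; last by rewrite mulr0.
    by rewrite mulf_eq0 expf_eq0 polyX_eq0 andbF polyC_eq0 => /eqP.
  exists (fun x => cone al x = 0); split.
  - split.
      apply: (@cone_proj_point _ _ _ al (lift v o21)).
      by rewrite -[al _]/(psi (dehom k v _)) dehomX liftK /= rmorph1 oner_neq0.
    move=> x [c ->]; rewrite (rmorph_sum (cone al)); apply: big1 => j _.
    rewrite (rmorphM (cone al)).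
    suff -> : cone al (f j) = 0 by rewrite mulr0.
    apply/(cone_homog0 al (fd j)); have [e [h eE]] := qgen _ (chif j).
    have := congr1 psi eE; rewrite -mul_polyC !rmorphM psiq mulr0 => /eqP.
    rewrite mulf_eq0 => /orP[|/eqP //]; rewrite polyC_exp rmorphXn expf_eq0 => /andP[_ /eqP l0].
    move: psiu; rewrite wE polyCD polyCM rmorphD rmorphM l0 mulr0 addr0 polyC1 rmorph1.
    by move/eqP; rewrite oner_eq0.
  - exact/alU.
  - move=> c c' /alU c0 /alU; rewrite polyCD polyCM rmorphD rmorphM c0 mulr0 addr0.
    by rewrite polyC1 rmorph1 => /eqP; rewrite oner_eq0.
case=> r [c cP]; have /boolp.choice[i iP] m := cP _ (let: And3 H _ _ := pP m in H).
have [m [m' [mm ii]]] : exists m m', (m < m')%N /\ i m = i m'.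
  apply: boolp.contrapT => nmm.
  have inj : injective (fun x : 'I_r.+1 => i x).
    move=> x y xy; apply: val_inj; apply: boolp.contrapT => /eqP.
    by rewrite neq_ltn => /orP[] H; apply: nmm; [exists x, y|exists y, x].
  by have := leq_card _ inj; rewrite !card_ord ltnn.
have [[_ pu Hp] [_ pu' _]] := (pP m, pP m'); have [c' c'E] := Piu _ _ mm.
apply: (Hp (u m) ('X * c') pu).
have -> : 1 + 'X * c' * u m = u m' by rewrite -mulrA -c'E.
by apply/iP; rewrite ii; apply/iP.
Qed.

End InfiniteLocus.

Lemma map_mpoly_inj n (F E : fieldType) (s : {rmorphism F -> E}) (p : {mpoly F[n]}) :
  map_mpoly s p = 0 -> p = 0.
Proof.
move=> p0; apply/mpolyP => m; rewrite mcoeff0; apply/eqP; rewrite -(fmorph_eq0 s).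
by rewrite -mcoeff_map_mpoly p0 mcoeff0.
Qed.

Lemma two_variables n (F : fieldType) : n = 2%N \/ n = 3%N ->
  exists (r : {rmorphism {mpoly F[2]} -> {mpoly F[n]}}) (a : 'I_2 -> 'I_n),
    [/\ forall x, r x = 0 -> x = 0, forall c, r c%:MP = c%:MP & forall i, r 'X_i = 'X_(a i)].
Proof.
case=> ->; first by exists idfun, id.
exists (@lift_var F 2 ord0), (lift ord0); split=> [x x0|c|i].
- by apply/eqP; rewrite -polyC_eq0 -(uni_lift ord0) x0 rmorph0.
- exact: lift_varC.
- exact: lift_varX.
Qed.

Section GenericResolution.
Variables (n : nat) (k : fieldType) (d : nat) (f : 'I_n.+1 -> {mpoly k[n]}).
Variables (mu : 'I_n -> nat) (P : 'M[{mpoly k[n]}]_(n.+1, n)).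
Hypotheses (n23 : n = 2%N \/ n = 3%N) (hres : graded_resolution d f mu P).
Hypotheses (f0 : exists i, f i != 0) (hX : finitely_many (proj_locus (ideal_gen f))).
Local Notation B := {mpoly k[n.+1]}.
Local Notation L := (syzygy_form P).

Let fd i : f i \is d.-homog. Proof. by case: hres. Qed.
Let Pmu j i : P j i \is (mu i).-homog. Proof. by case: hres. Qed.
Let P_inj (v : 'cV_n) : P *m v = 0 -> v = 0. Proof. by case: hres => _ _ H _; apply: H. Qed.
Let fP (w : 'cV_n.+1) : (\row_j f j) *m w = 0 <-> exists v, w = P *m v.
Proof. by case: hres. Qed.

Lemma syzygy_form_homog : homog_family mu L.
Proof.
by move=> i; apply: rpred_sum => j _; apply: rpredZ; apply: map_dhomog.
Qed.

Section ModuloPrime.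
Variables (kappa : fieldType) (rho : {rmorphism B -> kappa}) (p : B).
Hypotheses (pp : prime_elt p) (rhoP : forall b, rho b = 0 <-> principal p b).

Lemma map_syzygy_form i :
  map_mpoly rho (L i) = \sum_j (rho 'X_j)%:MP * map_mpoly (rho \o @mpolyC n.+1 k) (P j i).
Proof.
rewrite (rmorph_sum (map_mpoly rho)); apply: eq_bigr => j _.
rewrite -mul_mpolyC (rmorphM (map_mpoly rho)); congr (_ * _); first exact: map_mpolyC.
apply: (@mpoly_rmorph_ext _ _ _ (map_mpoly rho \o map_mpoly (@mpolyC n.+1 k))
  (map_mpoly (rho \o @mpolyC n.+1 k))) => [c|l] /=.
  by rewrite !map_mpolyC.
by rewrite !map_mpolyX.
Qed.

(* Where f does not vanish, the vanishing of the L_i at (x, t) makes t proportional to f(x). *)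
Lemma generic_point_in_locus (Omega : fieldType) (psi : {rmorphism {mpoly kappa[n]} -> Omega})
    (r2 : {rmorphism {mpoly kappa[2]} -> Omega}) (a : 'I_2 -> 'I_n) :
  (forall x, r2 x = 0 -> x = 0) -> (forall c, r2 c%:MP = psi c%:MP) ->
  (forall i, r2 'X_i = psi 'X_(a i)) -> (forall i, psi (map_mpoly rho (L i)) = 0) ->
  forall j, point_map rho psi (f j) = 0.
Proof.
move=> r2_inj r2C r2X psiL; pose phi := point_map rho psi; pose t j := psi (rho 'X_j)%:MP.
apply: boolp.contrapT => nf.
have [i0 fi0] : exists i0, phi (f i0) != 0.
  apply: boolp.contrapT => H; apply: nf => j; apply: boolp.contrapT => /eqP fj.
  by apply: H; exists j.
have Lt i : \sum_l phi (P l i) * t l = 0.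
  rewrite -[RHS](psiL i) map_syzygy_form (rmorph_sum psi); apply: eq_bigr => l _.
  by rewrite (rmorphM psi) mulrC.
apply: (generic_point_not_proportional pp rhoP r2_inj r2C r2X (f := f) (s := t i0 / phi (f i0))).
move=> j; pose c l := f i0 * (l == j)%:R - f j * (l == i0)%:R.
have delta (R : pzRingType) (F : 'I_n.+1 -> R) i : \sum_l (l == i)%:R * F l = F i.
  by rewrite (bigD1 i) //= eqxx mul1r big1 ?addr0 // => l /negPf ->; rewrite mul0r.
have [|g gE] := (syzygy_exact fP c).1.
  under eq_bigr do rewrite mulrBl -!mulrA.
  by rewrite sumrB -!mulr_sumr !delta mulrC subrr.
have : \sum_l phi (c l) * t l = 0.
  under eq_bigr do rewrite gE (rmorph_sum phi) mulr_suml.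
  rewrite exchange_big; apply: big1 => i _.
  under eq_bigr do rewrite (rmorphM phi) -mulrA.
  by rewrite -mulr_sumr Lt mulr0.
have cE l : phi (c l) * t l =
    phi (f i0) * ((l == j)%:R * t l) - phi (f j) * ((l == i0)%:R * t l).
  by rewrite /c (rmorphB phi) !(rmorphM phi) !rmorph_nat mulrBl !mulrA.
under eq_bigr do rewrite cE.
rewrite sumrB -!mulr_sumr !delta => /eqP; rewrite subr_eq0 => /eqP E.
by apply: (mulfI fi0); rewrite [LHS]E mulrCA [X in _ = _ * X]mulrC divfK.
Qed.

(** If all forms vanished modulo [p], they would vanish at a point with independent coordinates over
    [kappa]. The f_j would vanish there too, and hence be 0. *)
Lemma syzygy_form_mod_neq0 : exists i, map_mpoly rho (L i) != 0.
Proof.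
apply: boolp.contrapT => nL.
have L0 i : map_mpoly rho (L i) = 0.
  by apply: boolp.contrapT => /eqP Li; apply: nL; exists i.
have [E [tf tf_inj]] := mpoly_embeds n kappa.
have [r [a [r_inj rC rX]]] := two_variables kappa n23.
have fL0 : forall j, point_map rho tf (f j) = 0.
  apply: (generic_point_in_locus (r2 := tf \o r) (a := a)) => [x /tf_inj/r_inj //|c|i|i].
  - by rewrite /= rC.
  - by rewrite /= rX.
  - by rewrite L0 rmorph0.
have [j] := f0; rewrite (map_mpoly_inj (s := rho \o @mpolyC n.+1 k) (p := f j)) ?eqxx //.
by apply: tf_inj; apply: fL0.
Qed.

End ModuloPrime.
Lemma constant_syzygyE i : (L i)@_0%MM = \sum_j ((P j i)@_0%MM *: 'X_j : B).
Proof.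
rewrite /syzygy_form (raddf_sum (mcoeff 0%MM)); apply: eq_bigr => j _.
transitivity (('X_j : B) * (map_mpoly (@mpolyC n.+1 k) (P j i))@_0%MM); first exact: mcoeffZ.
by rewrite mcoeff_map_mpoly mulrC; exact: mul_mpolyC.
Qed.

Lemma constant_syzygy_neq0 i0 : mu i0 = 0%N -> (L i0)@_0%MM != 0.
Proof.
move=> mu0; apply/eqP => l0.
have Pj j : (P j i0)@_0%MM = 0.
  have := congr1 (mcoeff U_(j)%MM) l0; rewrite constant_syzygyE mcoeff0.
  rewrite (raddf_sum (mcoeff U_(j)%MM)) (bigD1 j) //= mcoeffZ mcoeffXU eqxx mulr1.
  rewrite big1 ?addr0 // => l /negPf lj.
  by rewrite mcoeffZ mcoeffXU lj mulr0.
have PC j : P j i0 = 0.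
  apply/mpolyP => m; rewrite mcoeff0; have [->|m0] := eqVneq m 0%MM; first exact: Pj.
  apply/eqP; rewrite mcoeff_eq0; apply: contra m0 => /(dhomog_supp (Pmu j i0)).
  by rewrite mu0 => /eqP; rewrite mdeg_eq0.
have /P_inj/(congr1 (fun M : 'cV_n => M i0 0))/eqP : P *m (delta_mx i0 0 : 'cV_n) = 0.
  by rewrite -colE; apply/matrixP => j z; rewrite !mxE PC.
by rewrite !mxE !eqxx oner_eq0.
Qed.

(** A linear form has no factorization into two nonconstant factors; as [p] is nonconstant, its
    cofactor is a constant. *)
Lemma constant_syzygy_prime i0 (p : B) : mu i0 = 0%N -> prime_elt p ->
  principal p (L i0)@_0%MM -> exists2 u : B, u \is a GRing.unit & (L i0)@_0%MM = u * p.
Proof.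
move=> mu0 pp [u uE]; exists u => //; have l0 := constant_syzygy_neq0 mu0.
have u0 : u != 0 by apply: contra_neq l0 => u0; rewrite uE u0 mul0r.
have p0 : p != 0 by case: pp.
have p2 : (1 < msize p)%N.
  rewrite ltnNge; apply/negP => /msize1_polyC pC.
  have c0 : p@_0%MM != 0 by apply: contra_neq p0 => c0; rewrite pC c0 mpolyC0.
  case: pp => _ [_ p1 _]; apply: p1; exists (p@_0%MM)^-1%:MP.
  by rewrite [X in _ * X]pC -mpolyCM mulVf.
have l2 : (msize ((L i0)@_0%MM : B) <= 2)%N.
  rewrite msizeE; apply/bigmax_leqP_seq => m + _.
  rewrite constant_syzygyE => /msupp_sum_le /flattenP[s /mapP[j _ ->]].
  by move=> /msuppZ_le; rewrite msuppX inE => /eqP ->; rewrite mdeg1.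
have u1 : (msize u <= 1)%N.
  by move: l2 p2; rewrite uE msizeM //; move: (msize u) (msize p); lia.
have uC := msize1_polyC u1; have c0 : u@_0%MM != 0.
  by apply: contra_neq u0 => c0; rewrite uC c0 mpolyC0.
apply/unitrPr; exists (u@_0%MM)^-1%:MP.
by rewrite [X in X * _]uC -mpolyCM mulfV.
Qed.

(** Let s be the sum of the mu_i. For n = 2, e is at most d - s, so nu >= d - 1 - e >= s - 1. For n
    = 3, both e and s are at most d, so nu >= 2(d - 1) - e >= d - 2 >= s - 2. *)
Lemma degree_bound (e : nat) (nu : int) : is_indeg (saturation (ideal_gen f)) e ->
  (n%:Z - 1) * (d%:Z - 1) - e%:Z <= nu -> (\sum_i mu i)%N%:Z < nu + n%:Z.
Proof.
case=> _ emin hnu; case: n23 => n2.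
  clear hX; subst n.
  have [g [gsat g0 gm]] := saturation_elt hres f0.
  have [m mg] : exists m, m \in msupp g.
    by case E : (msupp g) => [|m s]; [move: g0; rewrite -msupp_eq0 E | exists m; rewrite mem_head].
  have sd := gm m mg.
  have := emin (mdeg m) g gsat _ g0.
  have -> : g \is (mdeg m).-homog.
    by apply/dhomogP => m' /gm m'E; apply: (@addIn (\sum_i mu i)); rewrite m'E sd.
  move=> /(_ isT) em; move: sd hnu em; set s := (\sum_i mu i)%N; lia.
have [j fj] := f0; have Ij : saturation (ideal_gen f) (f j).
  by exists 0%N => x _; rewrite mulrC; apply: ideal_mull; [exact: ideal_gen_ideal|exact: ideal_gen_gen].
have ed := emin d (f j) Ij (fd j) fj.
clear hX Ij; subst n.
have := degree_bound3 hres; move: hnu ed; set s := (\sum_i mu i)%N; lia.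
Qed.

End GenericResolution.

Lemma syzygy_form_coprime3 (k : fieldType) d (f : 'I_4 -> {mpoly k[3]}) (mu : 'I_3 -> nat)
    (P : 'M[{mpoly k[3]}]_(4, 3)) (kappa : fieldType)
    (rho : {rmorphism {mpoly k[4]} -> kappa}) (p : {mpoly k[4]}) :
  graded_resolution d f mu P -> finitely_many (proj_locus (ideal_gen f)) ->
  prime_elt p -> (forall b, rho b = 0 <-> principal p b) ->
  coprime_family (fun i => map_mpoly rho (syzygy_form P i)).
Proof.
move=> hres hX pp rhoP G Gp GL; have [fd _ _ _] := hres.
(* [O] is the residue field of the common factor [G]. Since [G] involves the variable [v], the two
   other variables stay independent in it. *)
have [O [psi [psiP _]]] := quot_field Gp.2; have [v Gv] := prime_elt_nonconst Gp.
have r2_inj x : (psi \o lift_var v) x = 0 -> x = 0 by move/psiP/(uni_lift_dvd Gv).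
have fL0 : forall j, point_map rho psi (f j) = 0.
  apply: (generic_point_in_locus hres pp rhoP (r2 := psi \o lift_var v) (a := lift v)) => [//|c|i|i].
  - by rewrite /= lift_varC.
  - by rewrite /= lift_varX.
  - exact/psiP/GL.
apply: (infinite_locus (v := v) (phi := point_map rho psi) fd fL0 _ hX) => g g0.
apply: (map_mpoly_inj (s := rho \o @mpolyC 4 k)); apply: r2_inj; rewrite -[RHS]g0.
apply: (@mpoly_rmorph_ext _ _ _ ((psi \o lift_var v) \o map_mpoly (rho \o @mpolyC 4 k))
  (point_map rho psi \o lift_var v)) => [c|i].
  rewrite -[LHS]/(psi (lift_var v (map_mpoly (rho \o @mpolyC 4 k) c%:MP))).
  rewrite -[RHS]/(psi (map_mpoly (rho \o @mpolyC 4 k) (lift_var v c%:MP))).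
  by rewrite map_mpolyC !lift_varC map_mpolyC.
rewrite -[LHS]/(psi (lift_var v (map_mpoly (rho \o @mpolyC 4 k) 'X_i))).
rewrite -[RHS]/(psi (map_mpoly (rho \o @mpolyC 4 k) (lift_var v 'X_i))).
by rewrite map_mpolyX !lift_varX map_mpolyX.
Qed.

Lemma syzygy_form_generic n (k : fieldType) d (f : 'I_n.+1 -> {mpoly k[n]}) (mu : 'I_n -> nat)
    (P : 'M[{mpoly k[n]}]_(n.+1, n)) (kappa : fieldType)
    (rho : {rmorphism {mpoly k[n.+1]} -> kappa}) (p : {mpoly k[n.+1]}) :
  n = 2%N \/ n = 3%N -> graded_resolution d f mu P -> (exists i, f i != 0) ->
  finitely_many (proj_locus (ideal_gen f)) ->
  prime_elt p -> (forall b, rho b = 0 <-> principal p b) ->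
  koszul_generic (fun i => map_mpoly rho (syzygy_form P i)).
Proof.
move=> n23 hres f0 hX pp rhoP; split; first exact: syzygy_form_mod_neq0 hres f0 _ _ _ pp rhoP.
by move=> n3; clear n23; subst n; apply: syzygy_form_coprime3 hres hX pp rhoP.
Qed.

(** * Negative degrees and the final comparison of ideals *)

Lemma torsion_uniform (B : idomainType) m h (A : 'M[B]_(m, h)) :
  (forall x, exists2 b, b != 0 & row_span A (b *: x)) ->
  exists b, b != 0 /\ forall x, row_span A (b *: x).
Proof.
move=> H; have /boolp.choice[b bP] i : exists b, b != 0 /\ row_span A (b *: delta_mx 0 i).
  by have [b b0 bA] := H (delta_mx 0 i); exists b.
exists (\prod_i b i); split; first by apply/prodf_neq0 => i _; case: (bP i).
move=> x; have /boolp.choice[w wE] i : exists w : 'rV_m, b i *: delta_mx 0 i = w *m A by have [_ [w wE]] := bP i; exists w.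
exists (\sum_i (x 0 i * \prod_(j | j != i) b j) *: w i).
rewrite [in LHS](row_sum_delta x) scaler_sumr mulmx_suml; apply: eq_bigr => i _.
by rewrite -scalemxAl -wE !scalerA (bigD1 i) //=; congr (_ *: _); ring.
Qed.

Lemma zero_module_length (B : comNzRingType) (q : B -> Prop) (M : lmodType B) :
  is_prime q -> (forall m : M, m = 0) -> loc_length q M 0.
Proof.
move=> qp M0; have E r := @has_loc_chainP B q M M id qp (fun _ _ _ => erefl) (fun m => ex_intro _ m erefl) r.
split; first by apply/E; exists (fun _ _ => True).
by case/E => C [[Csat Clt] _]; have [_ [x [_]]] := Clt 0%N isT; rewrite (M0 x); case: (Csat 0%N isT).
Qed.

(** For nu < 0 the degree bound leaves a sum of at most n - 2. With two vanishing degrees, the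
    exponent in the convention for the resultant has a zero factor, so the resultant is 1. *)
Lemma two_zero_degrees n (mu : 'I_n -> nat) : n = 2%N \/ n = 3%N -> (\sum_i mu i + 1 < n)%N ->
  exists i j, [/\ j != i, mu i = 0%N & mu j = 0%N].
Proof.
case=> E; subst n; rewrite ?big_ord2 ?big_ord3 /= => H.
  by exists o20, o21; split=> //; lia.
have [z0|z0] := eqVneq (mu o30) 0%N; last by exists o31, o32; split=> //; lia.
have [z1|z1] := eqVneq (mu o31) 0%N; first by exists o30, o31; split.
by exists o30, o32; split=> //; lia.
Qed.

Theorem proposition7 (n : nat) (hn : n = 2%N \/ n = 3%N) (k : fieldType)
    (d : nat) (hd : (1 <= d)%N)
    (f : 'I_n.+1 -> {mpoly k[n]})
    (hf : forall i, f i \is d.-homog) (hf0 : exists i, f i != 0)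
    (hgf : generically_finite f)
    (hX : finitely_many (proj_locus (ideal_gen f)))
    (hloc : locally_generated_by (ideal_gen f) n)
    (mu : 'I_n -> nat) (P : 'M[{mpoly k[n]}]_(n.+1, n))
    (hres : graded_resolution d f mu P)
    (Res : {mpoly k[n.+1]}) (hRes : is_resultant mu (syzygy_form P) Res)
    (e : nat) (he : is_indeg (saturation (ideal_gen f)) e)
    (S : comAlgType {mpoly k[n]}) (iota : {mpoly k[n]} -> S)
    (hS : is_symmetric_algebra (ideal_gen f) iota)
    (nu : int) (hnu : (n%:Z - 1) * (d%:Z - 1) - e%:Z <= nu)
    (Sym_nu : lmodType {mpoly k[n.+1]}) (j : Sym_nu -> S)
    (hSym : is_sym_piece f iota nu j) :
  same_set (principal Res) (macrae Sym_nu).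
Proof.
have [fd _ _ fP] := hres; have Lh := syzygy_form_homog hres.
have degs := degree_bound hn hres hf0 he hnu.
(* The second case is nu = -(N + 1), where the module is 0 and the resultant is 1. *)
case: nu hSym degs {hnu} => [N|N] hSym degs; last first.
  have M0 : forall m : Sym_nu, m = 0 by apply: (sym_piece_neg _ hSym).
  have [|i0 [j0 [ji mui muj]]] := two_zero_degrees (mu := mu) hn.
    by move: degs; set s := (\sum_i mu i)%N; rewrite NegzE; lia.
  have R1 : Res = 1 by rewrite (hRes.2 i0 mui) (bigD1 j0) //= muj mul0n expr0.
  apply: macrae_principal; first exact: ufd_mpoly.
  - by move=> _ m; exists 1; rewrite oner_neq0 scale1r.
  - by rewrite R1 oner_neq0.
  - move=> p v pp; have p1 : has_val p 1 0 by apply/has_val0; apply: prime_elt_unit => //; exact: unitr1.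
    rewrite R1 => /(has_val_inj pp p1) <-.
    by apply: zero_module_length => //; case: pp.
have nul : (\sum_i mu i < N + n)%N by move: degs; set s := (\sum_i mu i)%N; lia.
have [pi [pilin pisurj piker]] :=
  sym_piece_presentation fP (liftA := map_mpoly (@mpolyC n.+1 k)) (fun=> erefl) hS Lh hSym.
have kerE : (fun x => pi x = 0) = row_span (Phi mu N (syzygy_form P)).
  by apply: boolp.funext => x; apply/boolp.propext.
have chainE p r : prime_elt p -> has_loc_chain (principal p) Sym_nu r <->
    chain_over (principal p) (row_span (Phi mu N (syzygy_form P))) r.
  by move=> pp; rewrite -kerE; apply: has_loc_chainP pisurj r => //; case: pp.
have lenE p v : prime_elt p ->
    chain_over (principal p) (row_span (Phi mu N (syzygy_form P))) v /\
    ~ chain_over (principal p) (row_span (Phi mu N (syzygy_form P))) v.+1 ->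
    loc_length (principal p) Sym_nu v.
  by move=> pp [H1 H2]; split; [apply/chainE | move/(chainE _ _ pp)].
have pi0 : pi 0 = 0 by apply/piker; exists 0; rewrite mul0mx.
have piZ b x : pi (b *: x) = b *: pi x by rewrite -[b *: x]addr0 pilin pi0 addr0.
have gen (p : {mpoly k[n.+1]}) : prime_elt p -> exists (kappa : fieldType)
    (rho : {rmorphism {mpoly k[n.+1]} -> kappa}),
    [/\ forall b, rho b = 0 <-> principal p b, frac_map rho
      & koszul_generic (fun i => map_mpoly rho (syzygy_form P i))].
  move=> pp; have [kappa [rho [rhoP rho_frac]]] := quot_field pp.2.
  by exists kappa, rho; split=> //; apply: syzygy_form_generic hn hres hf0 hX pp rhoP.
apply: macrae_principal; first exact: ufd_mpoly.
- move=> R0 m; have [x <-] := pisurj m.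
  suff [b [b0 bx]] : exists b, b != 0 /\ forall x, row_span (Phi mu N (syzygy_form P)) (b *: x).
    by exists b; split=> //; rewrite -piZ; apply/piker.
  (* A form of degree 0 in X is a nonzero element of [B] that kills the cokernel by itself. *)
  have [[i0 mui]|nmu] := boolp.pselect (exists i, mu i = 0%N).
    exists ((syzygy_form P i0)@_0%MM); split; first exact: constant_syzygy_neq0 hres _ mui.
    by move=> y; apply: constant_form_span.
  have mu_pos i : (0 < mu i)%N by rewrite lt0n; apply/eqP => mui; apply: nmu; exists i.
  have [R Rgen RE] := hRes.1 mu_pos; rewrite RE -specE in R0.
  have [b [b0 bx]] := resultant_torsion hn nul Rgen Lh R0.
  by exists b.
- move=> tors; have [[i0 mui]|nmu] := boolp.pselect (exists i, mu i = 0%N).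
    by rewrite (hRes.2 i0 mui) expf_neq0 //; apply: constant_syzygy_neq0 hres _ mui.
  have mu_pos i : (0 < mu i)%N by rewrite lt0n; apply/eqP => mui; apply: nmu; exists i.
  have [R Rgen RE] := hRes.1 mu_pos; rewrite RE -specE.
  have [|b [b0 bx]] := @torsion_uniform _ _ _ (Phi mu N (syzygy_form P)).
    by move=> x; have [b [b0 bx]] := tors (pi x); exists b => //; apply/piker; rewrite piZ.
  by have := resultant_nontorsion Rgen Lh b0 bx.
move=> p v pp Rv; apply: lenE => //; have [kappa [rho [rhoP rho_frac Lgen]]] := gen p pp.
have [[i0 mui]|nmu] := boolp.pselect (exists i, mu i = 0%N); last first.
  have mu_pos i : (0 < mu i)%N by rewrite lt0n; apply/eqP => mui; apply: nmu; exists i.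
  have [R Rgen RE] := hRes.1 mu_pos; rewrite RE -specE in Rv.
  have [len nlen] := resultant_length hn mu_pos nul Rgen Lh pp rhoP Lgen Rv.
  by split.
rewrite (hRes.2 i0 mui) in Rv; set l := (_)@_0%MM in Rv.
(* If [p] does not divide the linear form [l], then [l] is a unit at [p] that kills the module, and
   both numbers are 0. Otherwise [l] is associate to [p], and the valuation of the power of [l] is
   its exponent. *)
have [pl|npl] := boolp.pselect (principal p l); last first.
  have v0 : has_val p (l ^+ (\prod_(j < n | j != i0) mu j)%N) 0.
    by apply/has_val0 => /(prime_elt_dvdX pp).
  by rewrite (has_val_inj pp Rv v0); apply: constant_form_length0 npl.
have [u uu lE] := constant_syzygy_prime hn hres mui pp pl.
have vl : has_val p (l ^+ (\prod_(j < n | j != i0) mu j)%N) (\prod_(j < n | j != i0) mu j)%N.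
  exists (u ^+ (\prod_(j < n | j != i0) mu j)%N); first by rewrite /l lE exprMn.
  by apply: prime_elt_unit => //; rewrite unitrX.
rewrite (has_val_inj pp Rv vl).
have [len nlen] := constant_form_length hn nul Lh mui pp rhoP rho_frac Lgen uu lE.
by split.
Qed.
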